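(* Let $M$ be a $C^\infty$ real hypersurface in $\mathbb{C}^2$ and $p\in M$. If there exists an $\mathcal{N}$-canonical coordinate for $M$ at $p$, then the following seven conditions are equivalent: (1) $\Delta_1(M,p)=\infty$; (2) $\Delta_1^{\rm reg}(M,p)=\infty$; (3) there exists $\gamma\in\Gamma^{\rm reg}$ tangent to $M$ at $p$ to infinite order; (4) there exists $\gamma\in\Gamma$ tangent to $M$ at $p$ to infinite order; (5) there exists a holomorphic coordinate $(z_1,z_2)$ at $p$ with $p=0$ such that a local defining function for $M$ in this coordinate is not convenient; (6) there exists a holomorphic coordinate $(z_1,z_2)$ at $p$ with $p=0$ such that the Newton polyhedron of a local defining function $r$ for $M$ in this coordinate is $\{(\xi_1,\xi_2)\in\mathbb{R}_+^2:\xi_2\ge1\}$; (7) the Bloom-Graham type of $M$ at $p$ is infinity.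
   Context: A local defining function $r$ for $M$ near $p$ is a real-valued $C^\infty$ function with $M=\{r=0\}$ near $p$ and $\nabla r\ne0$ on $M$. $\operatorname{ord}(h)$ denotes order of vanishing at $0$. $\Gamma$: germs of nonconstant holomorphic maps $\gamma:(\mathbb{C},0)\to(\mathbb{C}^2,p)$ (good parametrization). $\Delta_1(M,p)=\sup_{\gamma\in\Gamma}\operatorname{ord}(r\circ\gamma)/\operatorname{ord}(\gamma-p)$; $\Gamma^{\rm reg}=\{\gamma\in\Gamma:\operatorname{ord}(\gamma-p)=1\}$; $\Delta_1^{\rm reg}(M,p)=\sup_{\gamma\in\Gamma^{\rm reg}}\operatorname{ord}(r\circ\gamma)$. $\gamma$ is tangent to $M$ at $p$ to infinite order if $(r\circ\gamma)(t)=O(t^N)$ for all $N$. Newton polyhedron: for real-valued smooth $F$ near $0\in\mathbb{C}^2$ with Taylor series $\sum C_{\alpha\beta}z^\alpha\bar z^\beta$, $\mathcal{N}_+(F)$ is the convex hull of $\bigcup_{C_{\alpha\beta}\ne0}(\alpha+\beta+\mathbb{R}_+^2)$; $F$ is convenient if $\mathcal{N}_+(F)$ meets every coordinate axis. For a compact face $\kappa$, $F_\kappa=\sum_{\alpha+\beta\in\kappa}C_{\alpha\beta}z^\alpha\bar z^\beta$ and $\Gamma_\kappa$ is the set of curves $t\mapsto(c_1t^{a_1},c_2t^{a_2})$, $c\in(\mathbb{C}\setminus\{0\})^2$, $a\in\mathbb{N}^2$ with $\{\xi\in\mathcal{N}_+(F):a_1\xi_1+a_2\xi_2=l\}=\kappa$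 for some $l\in\mathbb{N}$. $F$ is $\mathcal{N}$-nondegenerate if $F_\kappa\circ\gamma\not\equiv0$ for all compact faces $\kappa$ and all $\gamma\in\Gamma_\kappa$. A holomorphic coordinate centered at $p$ is $\mathcal{N}$-canonical if a local defining function of $M$ in it is $\mathcal{N}$-nondegenerate. Bloom-Graham type is infinity if for every $m$ there is a one-dimensional complex submanifold $X\ni p$ with $r|_X$ vanishing to order at least $m$ at $p$. *)

(* Defs.v *)
From HB Require Import structures.
From mathcomp Require Import all_boot all_order all_algebra.
From mathcomp Require Import all_classical all_reals all_analysis.
From mathcomp Require Import complex.
Import Order.TTheory GRing.Theory Num.Theory.
Import numFieldNormedType.Exports.

Set Implicit Arguments.
Unset Strict Implicit.
Unset Printing Implicit Defensive.

Local Open Scope ring_scope.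
Local Open Scope classical_set_scope.

Definition Cx (R : realType) := (R[i])^o.
Definition C2 (R : realType) := (Cx R * Cx R)%type.
Definition R4 (R : realType) := (R * R * (R * R))%type.

Definition cabs (R : realType) (z : Cx R) : R := complex.Re `|z|.
Definition nrm2 (R : realType) (z : C2 R) : R := Num.max (cabs z.1) (cabs z.2).

Definition toC2 (R : realType) (v : R4 R) : C2 R :=
  ((v.1.1 +i* v.1.2)%C, (v.2.1 +i* v.2.2)%C).
Definition ofC2 (R : realType) (z : C2 R) : R4 R :=
  ((complex.Re z.1, complex.Im z.1), (complex.Re z.2, complex.Im z.2)).
Definition realify (R : realType) (T : Type) (f : C2 R -> T) : R4 R -> T :=
  f \o @toC2 R.

Definition iterD (R : realType) (vs : seq (R4 R)) (f : R4 R -> R) : R4 R -> R :=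
  foldr (fun v g => 'D_v g) f vs.

Definition smooth_on (R : realType) (f : R4 R -> R) (U : set (R4 R)) : Prop :=
  forall vs : seq (R4 R),
    (forall x, U x -> {for x, continuous (iterD vs f)}) /\
    (forall x v, U x -> derivable (iterD vs f) x v).

Definition local_defining_function (R : realType) (S : set (C2 R)) (q : C2 R)
    (rho : C2 R -> R) : Prop :=
  exists W : set (C2 R),
    [/\ open W, W q,
        smooth_on (realify rho) (@toC2 R @^-1` W),
        S `&` W = [set z | W z /\ rho z = 0] &
        forall z, S z -> W z -> exists v : R4 R, 'D_v (realify rho) (ofC2 z) != 0].

Definition real_hypersurface (R : realType) (M : set (C2 R)) : Prop :=
  forall q, M q -> exists rho, local_defining_function M q rho.

(* Holomorphic maps: complex (C-linear) Frechet differentiability.      *)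
Definition holo_coord (R : realType) (p : C2 R) (Phi : C2 R -> C2 R)
    (U : set (C2 R)) : Prop :=
  [/\ open U /\ U p, Phi p = 0,
      (forall z, U z -> differentiable Phi z),
      open (Phi @` U) &
      exists Psi : C2 R -> C2 R,
        (forall w, (Phi @` U) w -> differentiable Psi w) /\
        (forall z, U z -> Psi (Phi z) = z)].

Definition bigO_pow (R : realType) (nf : Cx R -> R) (N : nat) : Prop :=
  exists K : R, \forall t \near (0 : Cx R), nf t <= K * (cabs t) ^+ N.

Definition ord0 (R : realType) (nf : Cx R -> R) : \bar R :=
  ereal_sup [set (N%:R)%:E | N in [set N : nat | bigO_pow nf N]].

Definition ord_comp (R : realType) (r : C2 R -> R) (g : Cx R -> C2 R) : \bar R :=
  ord0 (fun t => `|r (g t)|).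
Definition ord_curve (R : realType) (p : C2 R) (g : Cx R -> C2 R) : \bar R :=
  ord0 (fun t => nrm2 (g t - p)).

Definition Gamma (R : realType) (p : C2 R) (g : Cx R -> C2 R) : Prop :=
  [/\ g 0 = p,
      (\forall t \near (0 : Cx R), derivable g t 1) &
      ~ (\forall t \near (0 : Cx R), g t = p)].

Definition Gamma_reg (R : realType) (p : C2 R) (g : Cx R -> C2 R) : Prop :=
  Gamma p g /\ ord_curve p g = 1%E.

Definition Delta1 (R : realType) (r : C2 R -> R) (p : C2 R) : \bar R :=
  ereal_sup [set (ord_comp r g * ((fine (ord_curve p g))^-1)%:E)%E | g in Gamma p].

Definition Delta1_reg (R : realType) (r : C2 R -> R) (p : C2 R) : \bar R :=
  ereal_sup [set ord_comp r g | g in Gamma_reg p].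

Definition tangent_inf (R : realType) (r : C2 R -> R) (g : Cx R -> C2 R) : Prop :=
  forall N : nat, bigO_pow (fun t => `|r (g t)|) N.

Definition complex_curve (R : realType) (X : set (C2 R)) : Prop :=
  forall q, X q -> exists (U : set (C2 R)) (h : C2 R -> Cx R),
    [/\ open U, U q, (forall z, U z -> differentiable h z),
        X `&` U = [set z | U z /\ h z = 0] &
        exists v : C2 R, 'D_v h q != 0].

Definition BG_type_infinite (R : realType) (r : C2 R -> R) (p : C2 R) : Prop :=
  forall m : nat, exists X : set (C2 R),
    [/\ complex_curve X, X p &
        exists K : R, \forall z \near p, X z -> `|r z| <= K * (nrm2 (z - p)) ^+ m].

Definition ex1 (R : realType) : R4 R := ((1, 0), (0, 0)).
Definition ey1 (R : realType) : R4 R := ((0, 1), (0, 0)).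
Definition ex2 (R : realType) : R4 R := ((0, 0), (1, 0)).
Definition ey2 (R : realType) : R4 R := ((0, 0), (0, 1)).

Definition cD (R : realType) (v : R4 R) (G : R4 R -> R[i]) : R4 R -> R[i] :=
  fun x => (('D_v (fun y => complex.Re (G y)) x) +i*
            ('D_v (fun y => complex.Im (G y)) x))%C.

Definition dz (R : realType) (ex ey : R4 R) (G : R4 R -> R[i]) : R4 R -> R[i] :=
  fun x => (cD ex G x - 'i%C * cD ey G x) / 2%:R.
Definition dzb (R : realType) (ex ey : R4 R) (G : R4 R -> R[i]) : R4 R -> R[i] :=
  fun x => (cD ex G x + 'i%C * cD ey G x) / 2%:R.

Definition taylor_coef (R : realType) (F : C2 R -> R) (a b : nat * nat) : R[i] :=
  iter a.1 (dz (@ex1 R) (@ey1 R))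
    (iter a.2 (dz (@ex2 R) (@ey2 R))
      (iter b.1 (dzb (@ex1 R) (@ey1 R))
        (iter b.2 (dzb (@ex2 R) (@ey2 R))
           (fun x => ((realify F x)%:C)%C)))) 0
  / ((a.1`! * a.2`! * b.1`! * b.2`!)%N%:R).

Definition convex_hull (R : realType) (S : set (R * R)) : set (R * R) :=
  [set x | exists (n : nat) (w : 'I_n -> R) (q : 'I_n -> R * R),
     [/\ forall i, 0 <= w i, \sum_(i < n) w i = 1, forall i, S (q i) &
         x = (\sum_(i < n) w i * (q i).1, \sum_(i < n) w i * (q i).2)]].

Definition exponents (R : realType) (F : C2 R -> R) : set (R * R) :=
  [set xi | exists a b : nat * nat, taylor_coef F a b != 0 /\
            xi = (((a.1 + b.1)%N)%:R, ((a.2 + b.2)%N)%:R)].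

Definition orthant (R : realType) (v : R * R) : set (R * R) :=
  [set xi | v.1 <= xi.1 /\ v.2 <= xi.2].

Definition newton_polyhedron (R : realType) (F : C2 R -> R) : set (R * R) :=
  convex_hull (\bigcup_(v in exponents F) orthant v).

Definition convenient (R : realType) (F : C2 R -> R) : Prop :=
  (exists xi, newton_polyhedron F xi /\ xi.2 = 0) /\
  (exists xi, newton_polyhedron F xi /\ xi.1 = 0).

Definition compact_face (R : realType) (P kappa : set (R * R)) : Prop :=
  [/\ kappa !=set0, compact kappa &
      exists (w : R * R) (l : R), w != 0 /\
        (forall xi, P xi -> l <= w.1 * xi.1 + w.2 * xi.2) /\
        kappa = [set xi | P xi /\ w.1 * xi.1 + w.2 * xi.2 = l]].

(* F_kappa, with the (finite) sum truncated to exponents < K in each    *)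
(* entry; this is exactly F_kappa as soon as kappa lies in [0,K)^2.      *)
Definition F_face (R : realType) (F : C2 R -> R) (kappa : set (R * R)) (K : nat)
    (z : C2 R) : R[i] :=
  \sum_(a1 < K) \sum_(a2 < K) \sum_(b1 < K) \sum_(b2 < K)
    (if `[< kappa (((a1 + b1)%N)%:R, ((a2 + b2)%N)%:R) >]
     then taylor_coef F (nat_of_ord a1, nat_of_ord a2) (nat_of_ord b1, nat_of_ord b2)
          * z.1 ^+ a1 * z.2 ^+ a2 * (conjc z.1) ^+ b1 * (conjc z.2) ^+ b2
     else 0).

Definition N_nondegenerate (R : realType) (F : C2 R -> R) : Prop :=
  forall kappa, compact_face (newton_polyhedron F) kappa ->
  forall (c : Cx R * Cx R) (a : nat * nat) (l : nat),
    c.1 != 0 -> c.2 != 0 ->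
    [set xi | newton_polyhedron F xi /\
              (a.1%:R : R) * xi.1 + (a.2%:R : R) * xi.2 = l%:R] = kappa ->
    forall K : nat, (forall xi, kappa xi -> xi.1 < K%:R /\ xi.2 < K%:R) ->
      ~ (\forall t \near (0 : Cx R),
           F_face F kappa K (c.1 * t ^+ a.1, c.2 * t ^+ a.2) = 0).

Definition N_canonical (R : realType) (M : set (C2 R)) (p : C2 R)
    (Phi : C2 R -> C2 R) (U : set (C2 R)) : Prop :=
  holo_coord p Phi U /\
  exists rho, local_defining_function (Phi @` (M `&` U)) 0 rho /\ N_nondegenerate rho.

(* Main.v *)
(** Fix an N-nondegenerate defining function [rho] in the given canonical coordinate.

    If [rho] is convenient, let (n1, 0) and (0, n2) lie in its Newton polyhedron. The leading
    terms (c1 t^a1, c2 t^a2) of a curve select a compact face, and by nondegeneracy the part of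
    [rho] on this face does not vanish along some ray, so the order of [rho] on the curve is the
    weight of the face, hence at most min(a1, a2) max(n1, n2). Thus Delta1 <= max(n1, n2).

    If the defining function in some coordinate is not convenient, its Taylor series vanishes
    on one of the coordinate axes. This axis is a smooth complex curve tangent to infinite order
    to M, and since the gradient does not vanish, the Newton polyhedron is the half plane
    xi_2 >= 1, up to exchanging the two coordinates.

    The order of contact does not depend on the defining function: the zero set can be reached
    from z within O(|r z|) along a transversal direction, so two defining functions are bounded
    by multiples of each other. Leading terms of holomorphic functions come from Goursat's
    theorem and Cauchy's formula on a square. *)

Require Import Defs.
From HB Require Import structures.
From mathcomp Require Import all_boot all_order all_algebra.
From mathcomp Require Import all_classical all_reals all_analysis.
From mathcomp Require Import complex.
From mathcomp Require Import zify ring lra.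
Import Order.TTheory GRing.Theory Num.Theory.
Import numFieldNormedType.Exports.
Local Open Scope ring_scope.
Local Open Scope classical_set_scope.

Set Implicit Arguments.
Unset Strict Implicit.
Unset Printing Implicit Defensive.

(** * Moduli and norms *)

(** Both notions of differentiability are weak, and this shapes the analysis. [smooth_on] provides
    iterated directional derivatives, each continuous, so additivity in the direction and symmetry
    of second derivatives come before any Taylor formula; [taylor_coef] fixes one order of the
    Wirtinger derivations, hence the need for their commutation. Holomorphy is complex
    differentiability at points, with no continuity of the derivative: Lipschitz bounds and the
    implicit function theorem rest on Cauchy estimates along complex lines.

    Nondegeneracy speaks of monomial curves with both components nonzero, and [F_face] involves
    conjugates. So orders are measured on a real ray through a point where the face polynomial does
    not vanish, and a component of a curve that vanishes identically is first replaced by a high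
    power of t.

    Nondegeneracy enters through one implication: infinite [Delta1] forces the fixed [rho] not to be
    convenient. The remaining implications hold in any coordinate. *)

Section ComplexModulus.
Variable R : realType.
Implicit Types (z w : Cx R).

(** The norm of [Cx R] has values in [R[i]]; the estimates below are made with its real counterpart
    [cabs]. *)
Lemma normE z : `|z| = ((cabs z)%:C)%C.
Proof. by case: z. Qed.

Lemma cabs_ge0 z : 0 <= cabs z.
Proof. by rewrite -lecR -normE normr_ge0. Qed.

Lemma cabsM z w : cabs (z * w) = cabs z * cabs w.
Proof. exact: Normc.normcM. Qed.

Lemma cabsD z w : cabs (z + w) <= cabs z + cabs w.
Proof. exact: le_normcD. Qed.

Lemma cabsN z : cabs (- z) = cabs z.
Proof. exact: normcN. Qed.

Lemma cabsB z w : cabs (z - w) <= cabs z + cabs w.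
Proof. by rewrite -(cabsN w); exact: cabsD. Qed.

Lemma cabsC z w : cabs (z - w) = cabs (w - z).
Proof. by rewrite -cabsN opprB. Qed.

Lemma cabs0 : cabs (0 : Cx R) = 0.
Proof. exact: Normc.normc0. Qed.

Lemma cabs1 : cabs (1 : Cx R) = 1.
Proof. exact: Normc.normc1. Qed.

Lemma cabsV z : cabs (z^-1) = (cabs z)^-1.
Proof. exact: Normc.normcV. Qed.

Lemma cabs_eq0 z : (cabs z == 0) = (z == 0).
Proof.
by apply/eqP/eqP => [/Normc.eq0_normc|->] //; exact: cabs0.
Qed.

Lemma cabs_gt0 z : (0 < cabs z) = (z != 0).
Proof. by rewrite lt_neqAle cabs_ge0 andbT eq_sym cabs_eq0. Qed.

Lemma cabsX z n : cabs (z ^+ n) = cabs z ^+ n.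
Proof. by elim: n => [|n IH]; rewrite ?expr0 ?cabs1// !exprS cabsM IH. Qed.

Lemma cabs_conj (z : R[i]) : cabs (conjc z) = cabs z.
Proof. by case: z => a b; rewrite /cabs/= sqrrN. Qed.

Lemma cabs_real (x : R) : cabs ((x%:C)%C : R[i]) = `|x|.
Proof. by rewrite /cabs /= expr0n addr0 sqrtr_sqr. Qed.

Lemma cabs_sub z w : cabs z - cabs w <= cabs (z - w).
Proof. by have := cabsD (z - w) w; rewrite subrK lerBlDr. Qed.

Lemma Re_le_cabs (z : R[i]) : `|complex.Re z| <= cabs z.
Proof.
by case: z => a b; rewrite /cabs/= -sqrtr_sqr ler_sqrt ?addr_ge0 ?sqr_ge0// lerDl sqr_ge0.
Qed.

Lemma Im_le_cabs (z : R[i]) : `|complex.Im z| <= cabs z.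
Proof.
by case: z => a b; rewrite /cabs/= -sqrtr_sqr ler_sqrt ?addr_ge0 ?sqr_ge0// lerDr sqr_ge0.
Qed.

Lemma cabs_le_ReIm (z : R[i]) : cabs z <= `|complex.Re z| + `|complex.Im z|.
Proof.
case: z => a b; rewrite /cabs/= -[leRHS]ger0_norm ?addr_ge0//.
rewrite -sqrtr_sqr ler_sqrt ?sqr_ge0// sqrrD !real_normK ?num_real//.
by rewrite -addrA [_ *+ 2 + _]addrC addrA lerDl mulrn_wge0// mulr_ge0.
Qed.

(** Balls of [Cx R] have radii in [R[i]]. A positive element there is real, so its real part serves
    as radius. *)
Lemma nbhs_CxP (x : Cx R) (P : set (Cx R)) :
  nbhs x P <-> exists2 e : R, 0 < e & forall t, cabs (t - x) < e -> P t.
Proof.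
split.
  move/nbhs_ballP => [e e0 He].
  have eE : e = ((complex.Re e)%:C)%C by rewrite RRe_real// ger0_real// ltW.
  exists (complex.Re e); first by move: e0 => /=; rewrite ltcE => /andP[].
  by move=> t tx; apply: He; rewrite -ball_normE/= normE eE ltcR cabsC.
move=> [e e0 He]; apply/nbhs_ballP; exists (e%:C)%C => /=; first by rewrite ltcE /= eqxx.
by move=> t; rewrite -ball_normE/= normE ltcR cabsC; exact: He.
Qed.

Lemma nrm2_ge0 (z : C2 R) : 0 <= nrm2 z.
Proof. by rewrite /nrm2 le_max cabs_ge0. Qed.

Lemma nrm2_lt (z : C2 R) e : (nrm2 z < e) = (cabs z.1 < e) && (cabs z.2 < e).
Proof. by rewrite /nrm2 gt_max. Qed.

Lemma nrm2_le (z : C2 R) e : (nrm2 z <= e) = (cabs z.1 <= e) && (cabs z.2 <= e).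
Proof. by rewrite /nrm2 ge_max. Qed.

Lemma nrm2_1 (z : C2 R) : cabs z.1 <= nrm2 z.
Proof. by rewrite /nrm2 le_max lexx. Qed.

Lemma nrm2_2 (z : C2 R) : cabs z.2 <= nrm2 z.
Proof. by rewrite /nrm2 le_max lexx orbT. Qed.

Lemma nrm2D (z w : C2 R) : nrm2 (z + w) <= nrm2 z + nrm2 w.
Proof.
by rewrite nrm2_le; apply/andP; split;
   (apply: le_trans (cabsD _ _) _; apply: lerD; rewrite ?nrm2_1 ?nrm2_2).
Qed.

Lemma nrm2N (z : C2 R) : nrm2 (- z) = nrm2 z.
Proof. by rewrite /nrm2 !cabsN. Qed.

Lemma nrm2C (z w : C2 R) : nrm2 (z - w) = nrm2 (w - z).
Proof. by rewrite -nrm2N opprB. Qed.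

Lemma nrm2_eq0 (z : C2 R) : nrm2 z = 0 -> z = 0.
Proof.
move=> z0; have : nrm2 z <= 0 by rewrite z0.
rewrite nrm2_le => /andP[z1 z2]; case: z z1 z2 {z0} => a b /= z1 z2.
have /eqP : cabs a == 0 by rewrite eq_le z1 cabs_ge0.
have /eqP : cabs b == 0 by rewrite eq_le z2 cabs_ge0.
by move=> /eqP; rewrite cabs_eq0 => /eqP-> /eqP; rewrite cabs_eq0 => /eqP->.
Qed.

Lemma nrm2Z (l : R[i]) (z : C2 R) : nrm2 (l *: z) = cabs l * nrm2 z.
Proof. by rewrite /nrm2/= !cabsM maxr_pMr ?cabs_ge0. Qed.

Lemma nbhs_C2P (x : C2 R) (P : set (C2 R)) :
  nbhs x P <-> exists2 e : R, 0 < e & forall t, nrm2 (t - x) < e -> P t.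
Proof.
split.
  move=> [[A B] [/= /nbhs_CxP[e1 e10 h1] /nbhs_CxP[e2 e20 h2]] hAB].
  exists (Num.min e1 e2); first by rewrite lt_min e10.
  by move=> t; rewrite nrm2_lt !lt_min => /andP[/andP[a b] /andP[c d]];
     apply: hAB; split => /=; [exact: h1|exact: h2].
move=> [e e0 He].
exists ([set t | cabs (t - x.1) < e], [set t | cabs (t - x.2) < e]) => /=.
  by split; apply/nbhs_CxP; exists e.
by move=> t [/= h1 h2]; apply: He; rewrite nrm2_lt h1.
Qed.

(** The product norm unfolded to its four coordinates; [nrm_R4E] holds by conversion. *)
Definition nrm_R4 (v : R4 R) : R :=
  Num.max (Num.max `|v.1.1| `|v.1.2|) (Num.max `|v.2.1| `|v.2.2|).

Lemma nrm_R4E (v : R4 R) : nrm_R4 v = `|v|.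
Proof. by []. Qed.

Lemma nbhs_R4P (x : R4 R) (P : set (R4 R)) :
  nbhs x P <-> exists2 e : R, 0 < e & forall t, `|t - x| < e -> P t.
Proof.
split; first by move/nbhs_ballP => [e e0 He]; exists e => // t tx; apply: He;
  rewrite -ball_normE/= distrC.
move=> [e e0 He]; apply/nbhs_ballP; exists e => // t; rewrite -ball_normE/= distrC.
exact: He.
Qed.

Lemma toC2B (x y : R4 R) : toC2 (x - y) = toC2 x - toC2 y.
Proof. by []. Qed.

Lemma ofC2K (z : C2 R) : toC2 (ofC2 z) = z.
Proof. by case: z => [[a b] [c d]]. Qed.

Lemma toC2K (z : R4 R) : ofC2 (toC2 z) = z.
Proof. by case: z => [[a b] [c d]]. Qed.

Lemma nrm_ofC2_le (z : C2 R) : `|ofC2 z| <= nrm2 z.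
Proof.
rewrite -nrm_R4E /nrm_R4 !ge_max/=.
by rewrite !(le_trans (Re_le_cabs _))// ?(le_trans (Im_le_cabs _)) ?nrm2_1 ?nrm2_2.
Qed.

Lemma nrm2_toC2_le (x : R4 R) : nrm2 (toC2 x) <= 2 * `|x|.
Proof.
have h : [/\ `|x.1.1| <= `|x|, `|x.1.2| <= `|x|, `|x.2.1| <= `|x| & `|x.2.2| <= `|x| ].
  by rewrite -nrm_R4E /nrm_R4 !le_max !lexx /= !orbT.
case: h => h1 h2 h3 h4.
rewrite nrm2_le mulr_natl mulr2n; apply/andP; split;
  by apply: le_trans (cabs_le_ReIm _) _; apply: lerD.
Qed.

End ComplexModulus.

(** * Complex derivatives and contour integrals *)

Section ComplexDerivative.
Variable R : realType.

(** Complex differentiability as a first-order expansion. Without a quotient the increment 0 is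
    allowed, and restriction to real lines is immediate. *)
Definition cder (f : Cx R -> Cx R) (z l : Cx R) : Prop :=
  forall e : R, 0 < e -> exists2 d, 0 < d &
    forall h, cabs h < d -> cabs (f (z + h) - f z - l * h) <= e * cabs h.

Lemma is_derive_cder (f : Cx R -> Cx R) (z l : Cx R) :
  is_derive z (1 : Cx R) f l <-> cder f z l.
Proof.
split.
  case=> h1 h2.
  have : (fun h : Cx R => h^-1 *: (f (h *: (1 : Cx R) + z) - f z)) @ (0 : Cx R)^' --> l.
    by rewrite -h2; exact: h1.
  move=> /cvgrPdist_le H e e0.
  have ec : 0 < (e%:C)%C :> R[i] by rewrite ltcE /= eqxx.
  have /nbhs_CxP[d d0 Hd] := H _ ec.
  exists d => // h hd.
  have [->|hn0] := eqVneq h 0; first by rewrite addr0 subrr mulr0 subrr cabs0 mulr0.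
  have := Hd h; rewrite subr0 => /(_ hd hn0).
  rewrite normE lecR => H1.
  rewrite (_ : _ - _ - _ = (- h) * (l - h^-1 *: (f (h *: (1 : Cx R) + z) - f z))).
    by rewrite cabsM cabsN mulrC ler_wpM2r ?cabs_ge0.
  rewrite -!/(_ * _)%R [_ *: 1]mulr1 (addrC h) mulrBr mulNr mulrC.
  rewrite (_ : h^-1 *: (f (z + h) - f z) = h^-1 * (f (z + h) - f z))//.
  by rewrite mulNr mulrA divff// mul1r opprK addrC.
move=> H.
have cv : (fun h : Cx R => h^-1 *: (f (h *: (1 : Cx R) + z) - f z)) @ (0 : Cx R)^' --> l.
  apply/cvgrPdist_le => e e0.
  have eE : e = ((complex.Re e)%:C)%C by rewrite RRe_real// ger0_real// ltW.
  have e1 : 0 < complex.Re e by move: e0; rewrite ltcE => /andP[].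
  have [d d0 Hd] := H _ e1.
  apply/nbhs_CxP; exists d => // h; rewrite subr0 => hd hn0 /=.
  rewrite normE eE lecR.
  have := Hd h hd.
  rewrite (_ : _ - _ - _ = (- h) * (l - h^-1 *: (f (h *: (1 : Cx R) + z) - f z))).
    by rewrite cabsM cabsN mulrC ler_pM2r ?cabs_gt0.
  rewrite [_ *: 1]mulr1 (addrC h) mulrBr mulNr mulrC.
  rewrite (_ : h^-1 *: (f (z + h) - f z) = h^-1 * (f (z + h) - f z))//.
  by rewrite mulNr mulrA divff// mul1r opprK addrC.
split; first by apply/cvg_ex; exists l.
exact: cvg_lim.
Qed.

Lemma derivable_cder (f : Cx R -> Cx R) (z : Cx R) :
  derivable f z 1 -> exists l, cder f z l.
Proof. by move/derivableP => /is_derive_cder; eexists; eauto. Qed.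

Lemma cder_derivable (f : Cx R -> Cx R) (z l : Cx R) :
  cder f z l -> derivable f z 1.
Proof. by move/is_derive_cder => -[]. Qed.

Lemma cder_continuous (f : Cx R -> Cx R) (z l : Cx R) :
  cder f z l -> {for z, continuous f}.
Proof.
by move/cder_derivable => /derivable1_diffP; exact: differentiable_continuous.
Qed.

Lemma Cx_continuousP (f : Cx R -> Cx R) (z : Cx R) :
  {for z, continuous f} <->
  forall e : R, 0 < e -> exists2 d : R, 0 < d &
    forall w, cabs (w - z) < d -> cabs (f w - f z) < e.
Proof.
split.
  move=> fc e e0; have /= := fc [set w | cabs (w - f z) < e].
  by case/(_ _)/nbhs_CxP => [|d d0 Hd]; [apply/nbhs_CxP; exists e|exists d].
move=> H A /nbhs_CxP[e e0 He]; have [d d0 Hd] := H e e0.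
by apply/nbhs_CxP; exists d => // t td; apply: He; apply: Hd.
Qed.

Lemma contD (f g : Cx R -> Cx R) (z : Cx R) : {for z, continuous f} ->
  {for z, continuous g} -> {for z, continuous (fun w => f w + g w)}.
Proof. exact: continuousD. Qed.

Lemma contB (f g : Cx R -> Cx R) (z : Cx R) : {for z, continuous f} ->
  {for z, continuous g} -> {for z, continuous (fun w => f w - g w)}.
Proof. exact: continuousB. Qed.

Lemma contM (f g : Cx R -> Cx R) (z : Cx R) : {for z, continuous f} ->
  {for z, continuous g} -> {for z, continuous (fun w => f w * g w)}.
Proof. exact: continuousM. Qed.

Lemma contV (f : Cx R -> Cx R) (z : Cx R) : {for z, continuous f} -> f z != 0 ->
  {for z, continuous (fun w => (f w)^-1)}.
Proof. by move=> fc fz; exact: continuousV. Qed.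

Lemma contX (f : Cx R -> Cx R) (z : Cx R) n : {for z, continuous f} ->
  {for z, continuous (fun w => f w ^+ n)}.
Proof.
move=> fc; elim: n => [|n IH]; first exact: cst_continuous.
rewrite (_ : (fun w => f w ^+ n.+1) = (fun w => f w * f w ^+ n)); first exact: contM.
by apply/funext => w; rewrite exprS.
Qed.

Lemma cont_cst (c z : Cx R) : {for z, continuous (fun _ : Cx R => c)}.
Proof. exact: cst_continuous. Qed.

Lemma cont_id (z : Cx R) : {for z, continuous (fun w : Cx R => w)}.
Proof. exact: id. Qed.

(** The derivative is split into real and imaginary parts because the mean value theorem and the
    fundamental theorem of calculus are applied to real functions. *)
Definition rder (F : R -> R[i]) (x : R) (l : R[i]) : Prop :=
  is_derive x 1 (fun t => complex.Re (F t)) (complex.Re l) /\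
  is_derive x 1 (fun t => complex.Im (F t)) (complex.Im l).

Lemma rder_eps (F : R -> R[i]) (x : R) (l : R[i]) :
  (forall e : R, 0 < e -> exists2 d, 0 < d &
    forall h : R, `|h| < d -> cabs (F (x + h) - F x - l * (h%:C)%C) <= e * `|h|) ->
  rder F x l.
Proof.
move=> H.
(* [p] is the real or the imaginary part: dominated by the modulus, compatible with differences and
   real-homogeneous. *)
suff main (p : R[i] -> R) :
   (forall z, `|p z| <= cabs z) -> (forall z w, p (z - w) = p z - p w) ->
   (forall z (h : R), p (z * (h%:C)%C) = p z * h) ->
   is_derive x 1 (fun t => p (F t)) (p l).
  split; apply: main.
  - exact: Re_le_cabs.
  - by case=> [a b] [c d].
  - by case=> [a b] h /=; rewrite mulr0 subr0.
  - exact: Im_le_cabs.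
  - by case=> [a b] [c d].
  - by case=> [a b] h /=; rewrite mulr0 add0r.
move=> ple psub pmul.
have cv : (fun h : R => h^-1 *: (p (F (h *: 1 + x)) - p (F x))) @ 0^' --> p l.
  apply/cvgrPdist_le => e e0.
  have [d d0 Hd] := H _ e0.
  apply/nbhs_ballP; exists d => // h; rewrite /ball/= sub0r normrN => hd hn0.
  rewrite /GRing.scale/= mulr1.
  have := Hd h hd; move/(le_trans (ple _)).
  rewrite !psub pmul (addrC h) => H1.
  rewrite -(ler_pM2r (_ : 0 < `|h|)) ?normr_gt0// -normrM.
  by rewrite mulrBl mulrAC mulVf// mul1r distrC.
split; first by apply/cvg_ex; exists (p l).
exact: cvg_lim.
Qed.

Lemma rderD F G x l m : rder F x l -> rder G x m -> rder (fun t => F t + G t) x (l + m).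
Proof.
have ReD (z w : R[i]) : complex.Re (z + w) = complex.Re z + complex.Re w by case: z w => [a b] [].
have ImD (z w : R[i]) : complex.Im (z + w) = complex.Im z + complex.Im w by case: z w => [a b] [].
move=> [h1 h2] [h3 h4]; split.
  by under eq_fun do rewrite ReD; rewrite ReD; exact: is_deriveD.
by under eq_fun do rewrite ImD; rewrite ImD; exact: is_deriveD.
Qed.

Lemma rderM k F x l : rder F x l -> rder (fun t => k * F t) x (k * l).
Proof.
have ReM (z w : R[i]) : complex.Re (z * w) = complex.Re z * complex.Re w - complex.Im z * complex.Im w
  by case: z w => [a b] [].
have ImM (z w : R[i]) : complex.Im (z * w) = complex.Re z * complex.Im w + complex.Im z * complex.Re w
  by case: z w => [a b] [].
move=> [h1 h2]; split.
  under eq_fun do rewrite ReM; rewrite ReM.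
  by apply: is_deriveB; exact: is_deriveZ.
under eq_fun do rewrite ImM; rewrite ImM.
by apply: is_deriveD; exact: is_deriveZ.
Qed.

(* The base point -4 lies to the left of every contour used below. *)
Definition prim (f : R -> R) (x : R) : R :=
  (\int[lebesgue_measure]_(t in [set` `[(-4), x]]) f t)%R.

Lemma is_derive_prim (f : R -> R) (x : R) : continuous f -> -4 < x -> x < 4 ->
  is_derive x 1 (prim f) (f x).
Proof.
move=> fc x1 x2.
have := @continuous_FTC1 R f (BLeft (-4)) x 4 x2.
case.
- apply: continuous_compact_integrable; first exact: segment_compact.
  exact: continuous_subspaceT.
- by rewrite lte_fin.
- exact: fc.
by move=> h1 h2; split; [exact: h1|rewrite -derive1E; exact: h2].
Qed.

Definition rcont (F : R -> R[i]) : Prop :=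
  continuous (fun t => complex.Re (F t)) /\ continuous (fun t => complex.Im (F t)).

Definition cprim (F : R -> R[i]) (x : R) : R[i] :=
  (prim (fun t => complex.Re (F t)) x +i* prim (fun t => complex.Im (F t)) x)%C.

(** Defined as a difference of primitives, the integral splits by mere algebra, and its estimates
    reduce to the mean value theorem. *)
Definition cint (F : R -> R[i]) (a b : R) : R[i] := cprim F b - cprim F a.

Lemma rder_cprim F x : rcont F -> -4 < x < 4 -> rder (cprim F) x (F x).
Proof. by move=> [h1 h2] /andP[x1 x2]; split; apply: is_derive_prim. Qed.

Lemma derive_bound (F f : R -> R) (a b K : R) : a <= b ->
  (forall x, a <= x <= b -> is_derive x 1 F (f x)) ->
  (forall x, a <= x <= b -> `|f x| <= K) -> `|F b - F a| <= K * (b - a).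
Proof.
move=> ab Fd fK.
have [c cab ->] : exists2 c : R, c \in `[a, b]%R & F b - F a = f c * (b - a).
  apply: MVT_segment => //.
    by move=> x; rewrite in_itv/= => /andP[/ltW ax /ltW xb]; apply: Fd; rewrite ax.
  apply: derivable_within_continuous => x; rewrite in_itv/= => xab.
  by have [] := Fd x xab.
move: cab; rewrite in_itv/= => cab.
by rewrite normrM [`|b - a|]ger0_norm ?subr_ge0// ler_wpM2r ?subr_ge0 ?fK.
Qed.

(** Two primitives of the same function differ by a function of derivative 0, which [derive_bound]
    with bound 0 shows to be constant. *)
Lemma cint_FTC F G (a b : R) : -4 < a -> a <= b -> b < 4 -> rcont F ->
  (forall x, a <= x <= b -> rder G x (F x)) -> cint F a b = G b - G a.
Proof.
move=> a4 ab b4 Fc Gd.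
have P4 x : a <= x <= b -> -4 < x < 4.
  by move=> /andP[h1 h2]; rewrite (lt_le_trans a4 h1) (le_lt_trans h2 b4).
have key (p q f : R -> R) : (forall x, a <= x <= b -> is_derive x 1 p (f x)) ->
   (forall x, a <= x <= b -> is_derive x 1 q (f x)) -> p b - p a = q b - q a.
  move=> hp hq.
  have : `|(p b - q b) - (p a - q a)| <= 0 * (b - a).
    apply: (@derive_bound (fun x => p x - q x) (fun x => f x - f x)) => // x xab.
      by apply: is_deriveB; [exact: hp|exact: hq].
    by rewrite subrr normr0.
  by rewrite mul0r normr_le0 => /eqP h; lra.
rewrite /cint /cprim.
have e1 : prim (fun t => complex.Re (F t)) b - prim (fun t => complex.Re (F t)) a
          = complex.Re (G b) - complex.Re (G a).
  apply: (key _ (fun x => complex.Re (G x)) (fun x => complex.Re (F x))) => x xab.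
    by have [] := rder_cprim Fc (P4 _ xab).
  by have [] := Gd x xab.
have e2 : prim (fun t => complex.Im (F t)) b - prim (fun t => complex.Im (F t)) a
          = complex.Im (G b) - complex.Im (G a).
  apply: (key _ (fun x => complex.Im (G x)) (fun x => complex.Im (F x))) => x xab.
    by have [] := rder_cprim Fc (P4 _ xab).
  by have [] := Gd x xab.
by move: e1 e2; case: (G b) (G a) => [gb1 gb2] [ga1 ga2] /= e1 e2; congr Complex.
Qed.

(** The factor 2 comes from bounding the real and the imaginary part separately. *)
Lemma cint_le F (a b K : R) : -4 < a -> a <= b -> b < 4 -> rcont F ->
  (forall x, a <= x <= b -> cabs (F x) <= K) -> cabs (cint F a b) <= 2 * K * (b - a).
Proof.
move=> a4 ab b4 Fc FK.
have P4 x : a <= x <= b -> -4 < x < 4.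
  by move=> /andP[h1 h2]; rewrite (lt_le_trans a4 h1) (le_lt_trans h2 b4).
apply: le_trans (cabs_le_ReIm _) _.
rewrite -mulrA mulr_natl mulr2n; apply: lerD => /=.
  apply: (derive_bound (f := fun x => complex.Re (F x))) => // x xab.
    by have [] := rder_cprim Fc (P4 _ xab).
  exact: le_trans (Re_le_cabs _) (FK _ xab).
apply: (derive_bound (f := fun x => complex.Im (F x))) => // x xab.
  by have [] := rder_cprim Fc (P4 _ xab).
exact: le_trans (Im_le_cabs _) (FK _ xab).
Qed.

Lemma rcontD F G : rcont F -> rcont G -> rcont (fun t => F t + G t).
Proof.
have ReD (z w : R[i]) : complex.Re (z + w) = complex.Re z + complex.Re w by case: z w => [a b] [].
have ImD (z w : R[i]) : complex.Im (z + w) = complex.Im z + complex.Im w by case: z w => [a b] [].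
move=> [h1 h2] [h3 h4]; split => x.
  by under eq_fun do rewrite ReD; apply: continuousD; [exact: h1|exact: h3].
by under eq_fun do rewrite ImD; apply: continuousD; [exact: h2|exact: h4].
Qed.

Lemma rcontM k F : rcont F -> rcont (fun t => k * F t).
Proof.
have ReM (z w : R[i]) : complex.Re (z * w) = complex.Re z * complex.Re w - complex.Im z * complex.Im w
  by case: z w => [a b] [].
have ImM (z w : R[i]) : complex.Im (z * w) = complex.Re z * complex.Im w + complex.Im z * complex.Re w
  by case: z w => [a b] [].
move=> [h1 h2]; split => x.
  under eq_fun do rewrite ReM.
  apply: (@continuousB _ _ _ (fun t => complex.Re k * complex.Re (F t))
                             (fun t => complex.Im k * complex.Im (F t))).
    by apply: (@continuousM _ _ (fun=> complex.Re k)); [exact: cst_continuous|exact: h1].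
  by apply: (@continuousM _ _ (fun=> complex.Im k)); [exact: cst_continuous|exact: h2].
under eq_fun do rewrite ImM.
apply: (@continuousD _ _ _ (fun t => complex.Re k * complex.Im (F t))
                           (fun t => complex.Im k * complex.Re (F t))).
  by apply: (@continuousM _ _ (fun=> complex.Re k)); [exact: cst_continuous|exact: h2].
by apply: (@continuousM _ _ (fun=> complex.Im k)); [exact: cst_continuous|exact: h1].
Qed.

Lemma cintD F G (a b : R) : -4 < a -> a <= b -> b < 4 -> rcont F -> rcont G ->
  cint (fun t => F t + G t) a b = cint F a b + cint G a b.
Proof.
move=> a4 ab b4 Fc Gc.
rewrite (cint_FTC (G := fun t => cprim F t + cprim G t))//.
- by rewrite /cint; ring.
- exact: rcontD.
- move=> x /andP[h1 h2].
  by apply: rderD; apply: rder_cprim; rewrite // (lt_le_trans a4 h1) (le_lt_trans h2 b4).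
Qed.

Lemma cintM k F (a b : R) : -4 < a -> a <= b -> b < 4 -> rcont F ->
  cint (fun t => k * F t) a b = k * cint F a b.
Proof.
move=> a4 ab b4 Fc.
rewrite (cint_FTC (G := fun t => k * cprim F t))//.
- by rewrite /cint; ring.
- exact: rcontM.
- move=> x /andP[h1 h2].
  by apply: rderM; apply: rder_cprim; rewrite // (lt_le_trans a4 h1) (le_lt_trans h2 b4).
Qed.

Lemma cint_split F a m b : cint F a b = cint F a m + cint F m b.
Proof. by rewrite /cint; ring. Qed.

End ComplexDerivative.

(** * Goursat's theorem on rectangles *)

Section Goursat.
Variable R : realType.

Definition hpath (c x : R) : Cx R := (x +i* c)%C.
Definition vpath (c y : R) : Cx R := (c +i* y)%C.

(** The counterclockwise contour integral over the boundary of [[a, b] x [c, d]]; ['i] is the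
    velocity of the vertical sides. *)
Definition loop (h : Cx R -> Cx R) (a b c d : R) : R[i] :=
  cint (h \o hpath c) a b + 'i%C * cint (h \o vpath b) c d
  - cint (h \o hpath d) a b - 'i%C * cint (h \o vpath a) c d.

Lemma rcont_path (h : Cx R -> Cx R) (p : R -> Cx R) :
  (forall s t, cabs (p s - p t) = `|s - t|) ->
  (forall x, {for p x, continuous h}) -> rcont (h \o p).
Proof.
move=> pd hc.
have key x (e : R) : 0 < e -> exists2 d, 0 < d & forall y, `|y - x| < d ->
    cabs (h (p y) - h (p x)) < e.
  move=> e0; have /Cx_continuousP/(_ e e0)[d d0 Hd] := hc x.
  by exists d => // y yx; apply: Hd; rewrite pd.
by split => x; apply/cvgrPdist_lt => e e0; have [d d0 Hd] := key x e e0;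
  apply/nbhs_ballP; exists d => // y; rewrite /ball/= distrC => /Hd;
  apply: le_lt_trans; rewrite distrC;
  [rewrite -[leRHS]/(cabs _); apply: le_trans (Re_le_cabs _)
  |apply: le_trans (Im_le_cabs _)]; case: (h (p y)) (h (p x)) => [? ?] [? ?].
Qed.

Lemma hpathB c s t : cabs (hpath c s - hpath c t) = `|s - t|.
Proof.
rewrite (_ : _ - _ = ((s - t)%:C)%C) ?cabs_real//.
by rewrite /hpath; simpc.
Qed.

Lemma vpathB c s t : cabs (vpath c s - vpath c t) = `|s - t|.
Proof.
rewrite (_ : _ - _ = 'i%C * ((s - t)%:C)%C) ?cabsM ?cabs_real//; last first.
  by rewrite /vpath; simpc.
by rewrite /cabs/= expr0n expr1n add0r sqrtr1 mul1r.
Qed.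

Lemma rder_hpath G c x l : cder G (hpath c x) l -> rder (G \o hpath c) x l.
Proof.
move=> H; apply: rder_eps => e e0; have [d d0 Hd] := H e e0.
exists d => // h hd; have := Hd (h%:C)%C; rewrite cabs_real => /(_ hd).
by rewrite (_ : hpath c x + _ = hpath c (x + h))// /hpath; simpc.
Qed.

Lemma rder_vpath G c x l : cder G (vpath c x) l -> rder (G \o vpath c) x ('i%C * l).
Proof.
move=> H; apply: rder_eps => e e0; have [d d0 Hd] := H e e0.
exists d => // h hd; have := Hd ('i%C * (h%:C)%C).
have -> : cabs ('i%C * (h%:C)%C) = `|h|.
  by rewrite cabsM cabs_real /cabs/= expr0n expr1n add0r sqrtr1 mul1r.
move=> /(_ hd).
rewrite (_ : vpath c x + _ = vpath c (x + h)); last by rewrite /vpath; simpc.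
by rewrite (_ : l * _ = 'i%C * l * (h%:C)%C)//; ring.
Qed.

Definition inrect (a b c d : R) (z : R[i]) : Prop :=
  a <= complex.Re z <= b /\ c <= complex.Im z <= d.

(** The bounds -4 and 4 delimit the interval on which [prim] is known to be differentiable. *)
Definition small_rect (a b c d : R) : Prop :=
  [/\ -4 < a, a <= b, b < 4 & [/\ -4 < c, c <= d & d < 4]].

(** The four whole lines that carry the sides: [rcont] asks for continuity on all of [R], hence
    along the entire lines. *)
Definition edge (a b c d : R) (z : R[i]) : Prop :=
  [\/ complex.Re z = a, complex.Re z = b, complex.Im z = c | complex.Im z = d].

Section Edges.
Variables (a b c d : R).
Hypothesis abcd : small_rect a b c d.

Definition edge_cont (h : Cx R -> Cx R) : Prop :=
  forall z, edge a b c d z -> {for z, continuous h}.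

Lemma edge_rcont h : edge_cont h ->
  [/\ rcont (h \o hpath c), rcont (h \o vpath b), rcont (h \o hpath d)
    & rcont (h \o vpath a)].
Proof.
by move=> hc; split; apply: rcont_path; rewrite ?hpathB ?vpathB//;
   (try exact: hpathB); (try exact: vpathB); move=> x; apply: hc;
   [apply: Or43|apply: Or42|apply: Or44|apply: Or41].
Qed.

Lemma loopD h g : edge_cont h -> edge_cont g ->
  loop (fun z => h z + g z) a b c d = loop h a b c d + loop g a b c d.
Proof.
case: abcd => a4 ab b4 [c4 cd d4].
move=> /edge_rcont[h1 h2 h3 h4] /edge_rcont[g1 g2 g3 g4].
rewrite /loop (_ : _ \o hpath c = fun t => (h \o hpath c) t + (g \o hpath c) t)//.
rewrite (_ : _ \o vpath b = fun t => (h \o vpath b) t + (g \o vpath b) t)//.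
rewrite (_ : _ \o hpath d = fun t => (h \o hpath d) t + (g \o hpath d) t)//.
rewrite (_ : _ \o vpath a = fun t => (h \o vpath a) t + (g \o vpath a) t)//.
by rewrite !cintD//; ring.
Qed.

Lemma loopM k h : edge_cont h ->
  loop (fun z => k * h z) a b c d = k * loop h a b c d.
Proof.
case: abcd => a4 ab b4 [c4 cd d4].
move=> /edge_rcont[h1 h2 h3 h4].
rewrite /loop (_ : _ \o hpath c = fun t => k * (h \o hpath c) t)//.
rewrite (_ : _ \o vpath b = fun t => k * (h \o vpath b) t)//.
rewrite (_ : _ \o hpath d = fun t => k * (h \o hpath d) t)//.
rewrite (_ : _ \o vpath a = fun t => k * (h \o vpath a) t)//.
by rewrite !cintM//; ring.
Qed.

Lemma eq_loop h g : (forall z, edge a b c d z -> h z = g z) ->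
  loop h a b c d = loop g a b c d.
Proof.
move=> hg; rewrite /loop.
have -> : h \o hpath c = g \o hpath c by apply/funext => x; apply: hg; apply: Or43.
have -> : h \o hpath d = g \o hpath d by apply/funext => x; apply: hg; apply: Or44.
have -> : h \o vpath a = g \o vpath a by apply/funext => x; apply: hg; apply: Or41.
by have -> : h \o vpath b = g \o vpath b by apply/funext => x; apply: hg; apply: Or42.
Qed.

(** Each side contributes at most [2 * K] times its length, and opposite sides have equal length. *)
Lemma loop_le h (K : R) : edge_cont h ->
  (forall z, edge a b c d z -> inrect a b c d z -> cabs (h z) <= K) ->
  cabs (loop h a b c d) <= 4 * K * ((b - a) + (d - c)).
Proof.
case: abcd => a4 ab b4 [c4 cd d4].
move=> /edge_rcont[h1 h2 h3 h4] hK.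
have i1 : cabs ('i%C : Cx R) = 1 by rewrite /cabs/= expr0n expr1n add0r sqrtr1.
have e1 : cabs (cint (h \o hpath c) a b) <= 2 * K * (b - a).
  by apply: cint_le => // x xab; apply: hK; [apply: Or43|split; rewrite /= ?lexx].
have e2 : cabs (cint (h \o vpath b) c d) <= 2 * K * (d - c).
  by apply: cint_le => // x xab; apply: hK; [apply: Or42|split; rewrite /= ?lexx ?ab].
have e3 : cabs (cint (h \o hpath d) a b) <= 2 * K * (b - a).
  by apply: cint_le => // x xab; apply: hK; [apply: Or44|split; rewrite /= ?lexx ?cd].
have e4 : cabs (cint (h \o vpath a) c d) <= 2 * K * (d - c).
  by apply: cint_le => // x xab; apply: hK; [apply: Or41|split; rewrite /= ?lexx ?ab].
rewrite /loop.
apply: le_trans (cabsB _ _) _; rewrite cabsM i1 mul1r.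
apply: le_trans (lerD (cabsB _ _) (lexx _)) _.
apply: le_trans (lerD (lerD (cabsD _ _) (lexx _)) (lexx _)) _; rewrite cabsM i1 mul1r.
lra.
Qed.

(** Each side contributes the difference of [G] at its ends, and the four differences cancel at the
    corners. *)
Lemma loop_primitive h G : edge_cont h ->
  (forall z, edge a b c d z -> inrect a b c d z -> cder G z (h z)) ->
  loop h a b c d = 0.
Proof.
case: abcd => a4 ab b4 [c4 cd d4].
move=> /edge_rcont[h1 h2 h3 h4] hG.
have i2 : 'i%C * 'i%C = -1 :> R[i] by rewrite -expr2 sqr_i.
(* Along a vertical line the derivative of [G] is ['i] times [h], so [- 'i] times [G] is the
   primitive of [h] there. *)
have V u : rcont (h \o vpath u) -> (forall y, c <= y <= d -> cder G (vpath u y) (h (vpath u y))) ->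
    'i%C * cint (h \o vpath u) c d = G (vpath u d) - G (vpath u c).
  move=> hu Hu.
  rewrite (cint_FTC (G := fun t => - 'i%C * (G \o vpath u) t))//=;
    first by rewrite -mulrBr mulrA mulrN i2 opprK mul1r.
  move=> y ycd /=.
  rewrite (_ : h _ = - 'i%C * ('i%C * h (vpath u y))); last by rewrite mulrA mulNr i2 opprK mul1r.
  by apply: rderM; apply: rder_vpath; exact: Hu.
rewrite /loop V// => [|y yab]; last by apply: hG; [apply: Or42|split; rewrite /= ?lexx ?ab].
rewrite V// => [|y yab]; last by apply: hG; [apply: Or41|split; rewrite /= ?lexx ?ab].
rewrite (cint_FTC (G := G \o hpath c))//; last first.
  by move=> x xab; apply: rder_hpath; apply: hG; [apply: Or43|split; rewrite /= ?lexx ?cd].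
rewrite (cint_FTC (G := G \o hpath d))//; last first.
  by move=> x xab; apply: rder_hpath; apply: hG; [apply: Or44|split; rewrite /= ?lexx ?cd].
rewrite /= -!/(vpath _ _) -!/(hpath _ _).
rewrite (_ : hpath = fun x y => vpath y x)//; ring.
Qed.

End Edges.

Lemma loop_hsplit h a m b c d :
  loop h a b c d = loop h a m c d + loop h m b c d.
Proof. by rewrite /loop (cint_split _ a m b) (cint_split (h \o hpath d) a m b); ring. Qed.

Lemma loop_vsplit h a b c m d :
  loop h a b c d = loop h a b c m + loop h a b m d.
Proof. by rewrite /loop (cint_split _ c m d) (cint_split (h \o vpath a) c m d); ring. Qed.

Let rect := (R * R * R * R)%type.
Let loopr h (r : rect) := let: (a, b, c, d) := r in loop h a b c d.

(** Selects a quarter that carries at least a quarter of the modulus of the integral. The last one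
    is the default; [quarter_le] justifies it when the other three fail. *)
Let bisect h (r : rect) : rect :=
  let: (a, b, c, d) := r in
  let m := (a + b) / 2 in let n := (c + d) / 2 in
  let K := cabs (loop h a b c d) / 4 in
  if K <= cabs (loop h a m c n) then (a, m, c, n) else
  if K <= cabs (loop h m b c n) then (m, b, c, n) else
  if K <= cabs (loop h a m n d) then (a, m, n, d) else (m, b, n, d).

Lemma quarter_le (x x1 x2 x3 x4 : R) : x1 < x / 4 -> x2 < x / 4 -> x3 < x / 4 ->
  x <= x1 + x2 + x3 + x4 -> x / 4 <= x4.
Proof. by move=> ? ? ? ?; lra. Qed.

Let bisect_loop h r : cabs (loopr h r) / 4 <= cabs (loopr h (bisect h r)).
Proof.
case: r => [[[a b] c] d] /=.
set m := (a + b) / 2; set n := (c + d) / 2.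
case: ifP => [//|/negbT]; rewrite -ltNge => h1.
case: ifP => [//|/negbT]; rewrite -ltNge => h2.
case: ifP => [//|/negbT]; rewrite -ltNge => h3 /=.
apply: (quarter_le h1 h2 h3).
rewrite (loop_vsplit h a b c n d) !(loop_hsplit h a m b).
apply: le_trans (cabsD _ _) _.
by rewrite -[leRHS]addrA; apply: lerD; exact: cabsD.
Qed.

Lemma nested_limit (F G : nat -> R) : (forall n, F n <= F n.+1) ->
  (forall n, G n.+1 <= G n) -> (forall n, F n <= G n) ->
  exists x, forall n, F n <= x <= G n.
Proof.
move=> F1 G1 FG.
have Fm := (nondecreasing_seqP F).1 F1; have Gm := (nonincreasing_seqP G).1 G1.
have FGm n m : F n <= G m.
  have [nm|/ltnW mn] := leqP n m; first exact: le_trans (Fm _ _ nm) (FG _).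
  exact: le_trans (FG _) (Gm _ _ mn).
exists (sup (range F)) => n; apply/andP; split.
  by apply: ub_le_sup; [exists (G 0%N) => _ [k _ <-]|exists n].
by apply: ge_sup; [exists (F 0%N), 0%N|move=> _ [k _ <-]].
Qed.

(** The n-th bisected rectangle has an integral of modulus at least [K / 4 ^+ n]. Near the limit
    point [w], [h] differs by at most [e * |z - w|] from an affine function, which has a primitive;
    as [|z - w|] and the perimeter both shrink like [1 / 2 ^+ n], the integral is also at most a
    multiple of [e / 4 ^+ n]. *)
Lemma goursat (h : Cx R -> Cx R) (a b c d : R) :
  small_rect a b c d -> (forall z, {for z, continuous h}) ->
  (forall z, inrect a b c d z -> derivable h z 1) -> loop h a b c d = 0.
Proof.
move=> abcd hc hd; apply/eqP; rewrite -cabs_eq0; apply/negPn/negP => K0.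
set K := cabs (loop h a b c d) in K0.
have {}K0 : 0 < K by rewrite lt_neqAle eq_sym K0 cabs_ge0.
pose r n : rect := iter n (bisect h) (a, b, c, d).
pose A n := (r n).1.1.1; pose B n := (r n).1.1.2.
pose E n := (r n).1.2; pose D n := (r n).2.
have rE n : r n = (A n, B n, E n, D n) by rewrite /A /B /E /D; case: (r n) => [[[? ?] ?] ?].
have rS n : (A n.+1, B n.+1, E n.+1, D n.+1) = bisect h (A n, B n, E n, D n).
  by rewrite -!rE /r iterS.
have step n : [/\ A n <= B n, E n <= D n, B n.+1 - A n.+1 = (B n - A n) / 2,
    D n.+1 - E n.+1 = (D n - E n) / 2 & [/\ A n <= A n.+1, B n.+1 <= B n,
    E n <= E n.+1 & D n.+1 <= D n]].
  have H m : A m <= B m -> E m <= D m ->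
    [/\ A m.+1 <= B m.+1, E m.+1 <= D m.+1, B m.+1 - A m.+1 = (B m - A m) / 2,
    D m.+1 - E m.+1 = (D m - E m) / 2 & [/\ A m <= A m.+1, B m.+1 <= B m,
    E m <= E m.+1 & D m.+1 <= D m]].
    move=> h1 h2; have := rS m; rewrite /=.
    by do 3?[case: ifP => _]; case=> -> -> -> ->; (split; last split); lra.
  have [h1 h2] : A n <= B n /\ E n <= D n.
    elim: n => [|n [h1 h2]]; first by case: abcd => ? ? ? [].
    by have [] := H n h1 h2.
  by have [] := H n h1 h2.
have AB0 n : B n - A n = (b - a) / 2 ^+ n.
  elim: n => [|n IH]; first by rewrite expr0 divr1.
  by have [_ _ -> _ _] := step n; rewrite IH exprSr invfM mulrA.
have DE0 n : D n - E n = (d - c) / 2 ^+ n.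
  elim: n => [|n IH]; first by rewrite expr0 divr1.
  by have [_ _ _ -> _] := step n; rewrite IH exprSr invfM mulrA.
have Kn n : K / 4 ^+ n <= cabs (loop h (A n) (B n) (E n) (D n)).
  elim: n => [|n IH]; first by rewrite expr0 divr1.
  have := bisect_loop h (A n, B n, E n, D n); rewrite -rS /=; apply: le_trans.
  by rewrite exprSr invfM mulrA ler_pM2r ?invr_gt0.
have [x Hx] : exists x, forall n, A n <= x <= B n.
  by apply: nested_limit => n; have [? ? _ _ []] := step n.
have [y Hy] : exists x, forall n, E n <= x <= D n.
  by apply: nested_limit => n; have [? ? _ _ []] := step n.
pose w : Cx R := (x +i* y)%C.
have [l Hl] : exists l, cder h w l.
  by apply/derivable_cder/hd; split; [exact: (Hx 0%N)|exact: (Hy 0%N)].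
pose L := (b - a) + (d - c).
have L0 : 0 <= L by case: abcd => ? ? ? []; rewrite /L; lra.
(* Any [e] with [4 * L ^+ 2 * e < K] does; the [+ 1] covers a rectangle reduced to a point, where
   [L = 0]. *)
pose e := K / (4 * L ^+ 2 + 1).
have e0 : 0 < e by rewrite divr_gt0// ltr_wpDl// mulr_ge0// sqr_ge0.
have [dl dl0 Hdl] := Hl e e0.
have [n Hn] : exists n : nat, L / 2 ^+ n < dl.
  have : (fun n => L / 2 ^+ n) @ \oo --> (0 : R).
    rewrite -[X in _ --> X](mulr0 L); apply: cvgMr.
    under eq_fun do rewrite -exprVn.
    by apply: cvg_expr; rewrite ger0_norm ?invr_ge0// invf_lt1 // ltr1n.
  move/cvgrPdist_lt => /(_ dl dl0)[N _ HN]; exists N.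
  by have := HN N (leqnn _); rewrite sub0r normrN; apply: le_lt_trans; exact: ler_norm.
have [/= s1 s2 _ _ _] := step n.
have mono : [/\ a <= A n, B n <= b, c <= E n & D n <= d].
  elim: (n) => [|k [a0 b0 c0 d0]]; first by split.
  have [_ _ _ _ [k1 k2 k3 k4]] := step k.
  by split; [exact: le_trans a0 k1|exact: le_trans k2 b0|exact: le_trans c0 k3|exact: le_trans k4 d0].
have sr : small_rect (A n) (B n) (E n) (D n).
  case: mono => m1 m2 m3 m4; have [a1 _ a3 [a4 _ a6]] := abcd.
  by split; [exact: lt_le_trans m1|exact: s1|exact: le_lt_trans a3|split;
     [exact: lt_le_trans m3|exact: s2|exact: le_lt_trans a6]].
pose g z := h z - (h w + l * (z - w)).
have lin_cont z : {for z, continuous (fun z : Cx R => h w + l * (z - w))}.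
  by apply: contD; [exact: cont_cst|apply: contM; [exact: cont_cst|apply: contB;
     [exact: cont_id|exact: cont_cst]]].
have g_cont z : {for z, continuous g}.
  by apply: contB; [exact: hc|exact: lin_cont].
have loopE : loop h (A n) (B n) (E n) (D n) = loop g (A n) (B n) (E n) (D n).
  rewrite -[RHS](addr0) -[X in _ + X](loop_primitive sr (h := fun z => h w + l * (z - w))
    (G := fun z => h w * z + l / 2 * (z - w) ^+ 2)).
  - rewrite -(loopD sr (fun z _ => g_cont z) (fun z _ => lin_cont z)).
    by apply: eq_loop => z _; rewrite /g subrK.
  - by move=> z _; exact: lin_cont.
  move=> z _ _ ep ep0; exists (ep / (cabs l + 1)).
    by rewrite divr_gt0// ltr_wpDl// cabs_ge0.
  move=> t td.
  rewrite (_ : _ - _ = l / 2 * t ^+ 2); last by field.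
  rewrite cabsM cabsX cabsM expr2 mulrA ler_wpM2r ?cabs_ge0//.
  have -> : cabs ((2 : R[i])^-1) = 2^-1.
    by rewrite cabsV -[2 in LHS](rmorph_nat (real_complex R)) cabs_real ger0_norm.
  apply: le_trans (_ : (cabs l + 1) * cabs t <= _); last first.
    by rewrite mulrC -ler_pdivlMr ?ltW// ltr_wpDl// cabs_ge0.
  by rewrite ler_wpM2r ?cabs_ge0//; have := cabs_ge0 l; lra.
have Kl := Kn n; rewrite loopE in Kl.
have bnd : cabs (loop g (A n) (B n) (E n) (D n)) <=
    4 * (e * (L / 2 ^+ n)) * ((B n - A n) + (D n - E n)).
  apply: loop_le => [//|z _|z _ [/andP[z1 z2] /andP[z3 z4]]]; first exact: g_cont.
  have zw : cabs (z - w) <= L / 2 ^+ n.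
    apply: le_trans (cabs_le_ReIm _) _.
    have [/andP[x1 x2] /andP[y1 y2]] := (Hx n, Hy n).
    rewrite /L mulrDl -AB0 -DE0.
    case: z z1 z2 z3 z4 => [z1 z2] /= ? ? ? ?.
    by apply: lerD; rewrite ler_norml; lra.
  have := Hdl (z - w) (le_lt_trans zw Hn).
  rewrite (_ : w + (z - w) = z); last by rewrite addrC subrK.
  rewrite /g opprD addrA => /le_trans; apply.
  by rewrite ler_pM2l.
have := le_trans Kl bnd.
rewrite AB0 DE0 -mulrDl -/L.
have -> : 4 * (e * (L / 2 ^+ n)) * (L / 2 ^+ n) = (4 * L ^+ 2 * e) / 4 ^+ n.
  have -> : (4 : R) = 2 ^+ 2 by ring.
  by rewrite -exprM mulnC exprM; field; rewrite expf_neq0.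
rewrite ler_pM2r ?invr_gt0 ?exprn_gt0//.
rewrite /e mulrA ler_pdivlMr ?ltr_wpDl// ?mulr_ge0 ?sqr_ge0//.
by rewrite mulrC ler_pM2r// gerDl => /(lt_le_trans ltr01); rewrite ltxx.
Qed.

End Goursat.

(** * Cauchy's formula and estimates *)

Section Cauchy.
Variable R : realType.

Lemma cont_near (f g : Cx R -> Cx R) (z : Cx R) (e : R) : 0 < e ->
  (forall w, cabs (w - z) < e -> f w = g w) -> {for z, continuous g} ->
  {for z, continuous f}.
Proof.
move=> e0 fg /Cx_continuousP gc; apply/Cx_continuousP => k k0.
have [d d0 Hd] := gc k k0; exists (Num.min d e); first by rewrite lt_min d0.
move=> w; rewrite lt_min => /andP[w1 w2].
by rewrite !fg ?subrr ?cabs0//; exact: Hd.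
Qed.

Lemma cder_near (f g : Cx R -> Cx R) (z l : Cx R) (e : R) : 0 < e ->
  (forall w, cabs (w - z) < e -> f w = g w) -> cder g z l -> cder f z l.
Proof.
move=> e0 fg gd k k0.
have [d d0 Hd] := gd k k0; exists (Num.min d e); first by rewrite lt_min d0.
move=> w; rewrite lt_min => /andP[w1 w2].
rewrite !fg ?subrr ?cabs0//; first exact: Hd.
by rewrite addrC addKr.
Qed.

Local Notation loop1 h := (loop h (-1) 1 (-1) 1).

Lemma small_rect1 : small_rect (-1) 1 (-1) (1 : R).
Proof. by split; last split; lra. Qed.

(** A small square of half side [s] about [z0] is cut out. The four rectangles around it avoid [z0]
    and have integral 0, while that of the square is [O(s)] by continuity. *)
Lemma goursat_exception (h : Cx R -> Cx R) (z0 : Cx R) :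
  cabs z0 <= 1/2 -> (forall z, {for z, continuous h}) ->
  (forall z, inrect (-1) 1 (-1) 1 z -> z != z0 -> derivable h z 1) ->
  loop1 h = 0.
Proof.
move=> z0s hc hd; apply/eqP; rewrite -cabs_eq0; apply/negPn/negP => L0.
set L := cabs _ in L0; have {}L0 : 0 < L by rewrite lt_neqAle eq_sym L0 cabs_ge0.
have /Cx_continuousP/(_ 1 ltr01)[d d0 Hd] := hc z0.
pose K := cabs (h z0) + 1.
have K0 : 0 < K by rewrite ltr_wpDl// cabs_ge0.
(* [d / 4] keeps the square where [h] is within 1 of [h z0], [1/4] keeps it inside the unit square
   as [|z0| <= 1/2], and the last entry makes the bound [16 * K * s] at most [L / 2]. *)
pose s := Num.min (d / 4) (Num.min (1/4) (L / (32 * K))).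
have s0 : 0 < s by rewrite !lt_min !divr_gt0// mulr_gt0.
have [s1 s2 s3] : [/\ s <= d / 4, s <= 1/4 & s <= L / (32 * K)].
  by rewrite !ge_min !lexx !orbT.
have re := le_trans (Re_le_cabs z0) z0s; have im := le_trans (Im_le_cabs z0) z0s.
case: z0 {z0s} re im @K K0 @s s0 s1 s2 s3 Hd hd => [x y] /=.
rewrite !ler_norml => /andP[x1 x2] /andP[y1 y2].
set K := cabs (h (x +i* y)%C) + 1; set s := Num.min _ _ => K0 s0 s1 s2 s3 Hd hd.
have G a b c e : small_rect a b c e ->
   (forall z, inrect a b c e z -> inrect (-1) 1 (-1) 1 z /\ z != (x +i* y)%C) -> loop h a b c e = 0.
  by move=> sr H; apply: goursat => // z /H[zi zn]; apply: hd.
have neq (z : R[i]) : complex.Re z < x \/ x < complex.Re z \/ complex.Im z < y \/ y < complex.Im z ->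
    z != (x +i* y)%C.
  by move=> H; apply/negP => /eqP zE; move: H; rewrite zE /= !ltxx; intuition.
have : L <= 4 * K * ((x + s) - (x - s) + ((y + s) - (y - s))).
  rewrite /L.
  rewrite (loop_hsplit h (-1) (x - s) 1) (loop_hsplit h (x - s) (x + s) 1).
  rewrite (loop_vsplit h (x - s) (x + s) (-1) (y - s)) (loop_vsplit h (x - s) (x + s) (y - s) (y + s)).
  rewrite (G (-1)); first last.
  - by move=> [zx zy]; rewrite /inrect /= => -[/andP[? ?] /andP[? ?]]; split;
      [split; apply/andP; split; lra|apply: neq => /=; left; lra].
  - by split; last split; lra.
  rewrite (G (x + s)); first last.
  - by move=> [zx zy]; rewrite /inrect /= => -[/andP[? ?] /andP[? ?]]; split;
      [split; apply/andP; split; lra|apply: neq => /=; right; left; lra].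
  - by split; last split; lra.
  rewrite (G _ _ (-1)); first last.
  - by move=> [zx zy]; rewrite /inrect /= => -[/andP[? ?] /andP[? ?]]; split;
      [split; apply/andP; split; lra|apply: neq => /=; right; right; left; lra].
  - by split; last split; lra.
  rewrite (G _ _ (y + s)); first last.
  - by move=> [zx zy]; rewrite /inrect /= => -[/andP[? ?] /andP[? ?]]; split;
      [split; apply/andP; split; lra|apply: neq => /=; right; right; right; lra].
  - by split; last split; lra.
  rewrite !(addr0, add0r); apply: loop_le => [|z _|z _ [/andP[za zb] /andP[zc zd]]].
  - by split; last split; lra.
  - exact: hc.
  rewrite -(subrK (h (x +i* y)%C) (h z)) addrC.
  apply: le_trans (cabsD _ _) _; rewrite lerD2l ltW// Hd//.
  apply: le_lt_trans (cabs_le_ReIm _) _.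
  case: z za zb zc zd => [zx zy] /= ? ? ? ?.
  have : `|zx - x| <= s by rewrite ler_norml; lra.
  have : `|zy - y| <= s by rewrite ler_norml; lra.
  by lra.
have -> : 4 * K * (x + s - (x - s) + (y + s - (y - s))) = s * (16 * K) by ring.
move: s3; rewrite ler_pdivlMr ?mulr_gt0// => s3; lra.
Qed.

(* The value 2 pi i is never needed, only that it is not zero. *)
Definition winding : R[i] := loop1 (fun z : Cx R => z^-1).

Lemma edge1_neq0 (z : Cx R) : edge (-1) 1 (-1) 1 z -> z != 0.
Proof.
move=> H; apply/negP => /eqP zE; move: H; rewrite zE /=.
by case => /= /eqP; rewrite ?[_ == -1]eq_sym ?oppr_eq0 ?[_ == 1]eq_sym oner_eq0.
Qed.

Lemma edge1_ge1 (z : Cx R) : edge (-1) 1 (-1) 1 z -> 1 <= cabs z.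
Proof.
by case => zE; (apply: le_trans (Re_le_cabs _); by rewrite zE ?normrN normr1) ||
  (apply: le_trans (Im_le_cabs _); by rewrite zE ?normrN normr1).
Qed.

(** Each of the four sides adds to the imaginary part the same integral of [1 / (1 + x ^+ 2)] over
    [[-1, 1]], which is positive by the mean value theorem. *)
Lemma winding_neq0 : winding != 0.
Proof.
pose u (x : R) := (1 + x ^+ 2)^-1.
have u0 (x : R) : 0 < u x by rewrite invr_gt0 ltr_pwDl// sqr_ge0.
suff : 0 < complex.Im winding by case: winding => a b /=; rewrite eq_complex /= => /gt_eqF ->; rewrite andbF.
have uc : continuous u.
  move=> x; apply: (@continuousV _ _ (fun t : R => 1 + t ^+ 2)); first by rewrite gt_eqF// ltr_pwDl// sqr_ge0.
  by apply: cvgD; [exact: cvg_cst|exact: exprn_continuous].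
have E1 : (fun t => complex.Im ((fun z : Cx R => z^-1) (hpath (-1) t))) = u.
  by apply/funext => x; rewrite /u /= sqrrN expr1n [_ + 1]addrC mulN1r opprK.
have E2 : (fun t => complex.Re ((fun z : Cx R => z^-1) (vpath 1 t))) = u.
  by apply/funext => x; rewrite /u /= expr1n div1r.
have E3 : (fun t => complex.Im ((fun z : Cx R => z^-1) (hpath 1 t))) = \- u.
  by apply/funext => x; rewrite /u /= expr1n [_ + 1]addrC div1r.
have E4 : (fun t => complex.Re ((fun z : Cx R => z^-1) (vpath (-1) t))) = \- u.
  by apply/funext => x; rewrite /u /= sqrrN expr1n mulN1r.
have ImE (p q r s : R[i]) : complex.Im (p + 'i%C * q - r - 'i%C * s) =
    complex.Im p + complex.Re q - complex.Im r - complex.Re s.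
  by case: p q r s => [? ?] [? ?] [? ?] [? ?] /=; ring.
rewrite /winding /loop ImE.
rewrite /cint /cprim /=.
rewrite !(E1, E2, E3, E4) -!/(_ \o _).
have uNc : continuous (\- u) by move=> x; apply: cvgN; exact: uc.
have d4 (x : R) : x \in `[(-1), 1]%R -> -4 < x /\ x < 4.
  by rewrite in_itv/= => /andP[? ?]; split; lra.
have N : prim (\- u) 1 - prim (\- u) (-1) = - (prim u 1 - prim u (-1)).
  have : `|(prim (\- u) 1 + prim u 1) - (prim (\- u) (-1) + prim u (-1))| <= 0 * (1 - (-1)).
    apply: (@derive_bound _ (fun x => prim (\- u) x + prim u x) (fun x => - u x + u x)) => [|x xab|x xab]; first lra.
      have [x1 x2] := d4 x xab.
      by apply: is_deriveD; exact: is_derive_prim.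
    by rewrite addNr normr0.
  by rewrite mul0r normr_le0 => /eqP; lra.
have P : 0 < prim u 1 - prim u (-1).
  have [c _ ->] : exists2 c : R, c \in `[(-1), 1]%R & prim u 1 - prim u (-1) = u c * (1 - (-1)).
    apply: MVT_segment; first lra.
      move=> x; rewrite in_itv/= => /andP[x1 x2]; apply: is_derive_prim => //; lra.
    apply: derivable_within_continuous => x /d4[x1 x2].
    by have [] := is_derive_prim uc x1 x2.
  by rewrite mulr_gt0//; lra.
by rewrite N; lra.
Qed.

End Cauchy.

(** * Power expansion of Cauchy's integral *)

Section CauchyTaylor.
Variable R : realType.
Local Notation loop1 h := (loop h (-1) 1 (-1) 1).
Local Notation edge1 := (edge (-1) 1 (-1) (1 : R)).
Local Notation inrect1 := (inrect (-1) 1 (-1) (1 : R)).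

Lemma edge1_neq (z w : Cx R) : edge1 z -> cabs w <= 1/2 -> z - w != 0.
Proof.
move=> /edge1_ge1 h1 h2; rewrite subr_eq0; apply/negP => /eqP zw.
by move: h1; rewrite zw; lra.
Qed.

Lemma edge1_cont_inv (w : Cx R) : cabs w <= 1/2 ->
  edge_cont (-1) 1 (-1) 1 (fun z : Cx R => (z - w)^-1).
Proof.
move=> wh z ze; apply: contV; last exact: edge1_neq.
by apply: contB; [exact: cont_id|exact: cont_cst].
Qed.

Lemma edge1_cont_invX n : edge_cont (-1) 1 (-1) 1 (fun z : Cx R => (z ^+ n)^-1).
Proof.
move=> z ze; apply: contV; last by rewrite expf_neq0// edge1_neq0.
by apply: contX; exact: cont_id.
Qed.

Lemma loop_sum (n : nat) (F : nat -> Cx R -> Cx R) :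
  (forall k, edge_cont (-1) 1 (-1) 1 (F k)) ->
  loop1 (fun z => \sum_(k < n) F k z) = \sum_(k < n) loop1 (F k) /\
  edge_cont (-1) 1 (-1) 1 (fun z => \sum_(k < n) F k z).
Proof.
move=> Fc; elim: n => [|n [IH1 IH2]].
  have E : (fun z : Cx R => \sum_(k < 0) F k z) = fun=> 0.
    by apply/funext => z; rewrite big_ord0.
  rewrite E big_ord0; split; last by move=> z _; exact: cont_cst.
  apply: (loop_primitive (small_rect1 R) (G := fun=> 0)).
    by move=> z _; exact: cont_cst.
  move=> z _ _; apply/is_derive_cder; exact: is_derive_cst.
have E : (fun z : Cx R => \sum_(k < n.+1) F k z) = fun z => \sum_(k < n) F k z + F n z.
  by apply/funext => z; rewrite big_ord_recr.
rewrite E big_ord_recr /= -IH1; split.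
  exact: (loopD (small_rect1 R) IH2 (Fc n)).
by move=> z ze; apply: contD; [exact: IH2|exact: Fc].
Qed.

(** The geometric expansion of the Cauchy kernel with its exact remainder: finite sums keep
    convergence of series out of the argument. *)
Lemma geom_inv (z w : Cx R) n : z != 0 -> z - w != 0 ->
  (z - w)^-1 = \sum_(k < n) w ^+ k * (z ^+ k.+1)^-1
               + w ^+ n * ((z ^+ n)^-1 * (z - w)^-1).
Proof.
move=> z0 zw; elim: n => [|n IH].
  by rewrite big_ord0 add0r !expr0 invr1 !mul1r.
rewrite big_ord_recr /= {1}IH -addrA; congr (_ + _).
by rewrite !exprSr; field; rewrite z0 zw expf_neq0.
Qed.

(** On the contour [|z| >= 1] and [|z - w| >= 1/2], so the remainder is at most [2 * M * |w| ^+ n];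
    [loop_le] on the square of side 2 multiplies this by 16. *)
Lemma loop_expand (F : Cx R -> Cx R) (M : R) (w : Cx R) n :
  edge_cont (-1) 1 (-1) 1 F ->
  (forall z, edge1 z -> inrect1 z -> cabs (F z) <= M) -> cabs w <= 1/2 ->
  cabs (loop1 (fun z => F z * (z - w)^-1)
     - \sum_(k < n) loop1 (fun z => F z * (z ^+ k.+1)^-1) * w ^+ k)
   <= 32 * M * cabs w ^+ n.
Proof.
move=> Fc FM wh.
pose G k (z : Cx R) := w ^+ k * (F z * (z ^+ k.+1)^-1).
pose E (z : Cx R) := w ^+ n * (F z * ((z ^+ n)^-1 * (z - w)^-1)).
have Hc k : edge_cont (-1) 1 (-1) 1 (fun z => F z * (z ^+ k.+1)^-1).
  by move=> z ze; apply: contM; [exact: Fc|exact: edge1_cont_invX].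
have Gc k : edge_cont (-1) 1 (-1) 1 (G k).
  by move=> z ze; apply: contM; [exact: cont_cst|exact: Hc].
have Ec : edge_cont (-1) 1 (-1) 1 E.
  move=> z ze; apply: contM; first exact: cont_cst.
  apply: contM; first exact: Fc.
  by apply: contM; [exact: edge1_cont_invX|exact: edge1_cont_inv].
have [GS GSc] := loop_sum n Gc.
have -> : loop1 (fun z => F z * (z - w)^-1) = \sum_(k < n) loop1 (G k) + loop1 E.
  rewrite -GS -(loopD (small_rect1 R) GSc Ec); apply: eq_loop => z ze.
  rewrite {1}(geom_inv n (edge1_neq0 ze) (edge1_neq ze wh)) mulrDr mulr_sumr.
  by congr (_ + _); [apply: eq_bigr => k _|]; rewrite /G /E mulrCA.
have -> : \sum_(k < n) loop1 (G k) =
    \sum_(k < n) loop1 (fun z => F z * (z ^+ k.+1)^-1) * w ^+ k.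
  by apply: eq_bigr => k _; rewrite mulrC; exact: (loopM (small_rect1 R) (w ^+ k) (Hc k)).
rewrite addrC addKr.
have := @loop_le _ _ _ _ _ (small_rect1 R) E (2 * M * cabs w ^+ n) Ec.
rewrite (_ : 4 * _ * _ = 32 * M * cabs w ^+ n); last by ring.
apply=> z ze zr; rewrite /E !cabsM !cabsV !cabsX.
rewrite mulrC ler_wpM2r ?exprn_ge0 ?cabs_ge0// mulrC.
have z1 := edge1_ge1 ze.
apply: ler_pM; rewrite ?mulr_ge0 ?invr_ge0 ?exprn_ge0 ?cabs_ge0 ?FM//.
rewrite -[leRHS]mul1r; apply: ler_pM; rewrite ?mulr_ge0 ?invr_ge0 ?exprn_ge0 ?cabs_ge0//.
  by rewrite invf_le1 ?exprn_gt0 ?exprn_ege1// (lt_le_trans ltr01).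
rewrite -[leRHS]invrK lef_pV2 ?posrE ?invr_gt0//; last by rewrite cabs_gt0 edge1_neq.
by have := cabs_sub z w; lra.
Qed.

Lemma is_derive_inv (g : Cx R -> Cx R) (z l : Cx R) : g z != 0 ->
  is_derive z (1 : Cx R) g l ->
  is_derive z (1 : Cx R) (fun w => (g w)^-1) (- (g z) ^- 2 *: l).
Proof.
move=> gz [gd <-]; split; first exact: derivableV.
exact: deriveV.
Qed.

Lemma cder_invX (z : Cx R) k : z != 0 ->
  cder (fun z : Cx R => - (k.+1%:R)^-1 * (z ^+ k.+1)^-1) z ((z ^+ k.+2)^-1).
Proof.
move=> z0; apply/is_derive_cder.
have zk : z ^+ k.+1 != 0 by rewrite expf_neq0.
have hX : is_derive z (1 : Cx R) (fun z : Cx R => z ^+ k.+1) ((k.+1%:R * z ^+ k) *: (1 : Cx R)).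
  rewrite (_ : (fun z : Cx R => z ^+ k.+1) = (fun z : Cx R => z) ^+ k.+1); last first.
    by apply/funext => y; elim: k {zk} => [|k IH]; rewrite ?expr1// [LHS]exprS IH [in RHS]exprS.
  exact: (@is_deriveX _ _ _ k.+1 z (1 : Cx R) (1 : Cx R) (is_derive_id _ _)).
have hV : is_derive z (1 : Cx R) (fun z : Cx R => (z ^+ k.+1)^-1)
    (- (z ^+ k.+1) ^- 2 *: ((k.+1%:R * z ^+ k) *: (1 : Cx R))).
  exact: (@is_derive_inv (fun z : Cx R => z ^+ k.+1) z _ zk hX).
have := is_deriveZ (- (k.+1%:R)^-1 : R[i]) hV.
rewrite (_ : (z ^+ k.+2)^-1 = - (k.+1%:R)^-1 *: (- (z ^+ k.+1) ^- 2 *: ((k.+1%:R * z ^+ k) *: (1 : Cx R)))).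
  exact.
rewrite /GRing.scale/= mulr1 !exprS.
by field; rewrite z0 expf_neq0//= -(natrD _ 1) pnatr_eq0.
Qed.

(** Powers of exponent at most -2 have primitives. Hence [winding] is the only term left when the
    integral of the kernel itself is expanded. *)
Lemma loop_invX k : loop1 (fun z : Cx R => (z ^+ k.+2)^-1) = 0.
Proof.
apply: (@loop_primitive _ _ _ _ _ (small_rect1 R) _
  (fun z : Cx R => - (k.+1%:R)^-1 * (z ^+ k.+1)^-1) (@edge1_cont_invX k.+2)).
by move=> z /edge1_neq0 z0 _; exact: cder_invX.
Qed.

End CauchyTaylor.

Section CauchyTaylor.
Variable R : realType.
Local Notation loop1 h := (loop h (-1) 1 (-1) 1).

(* Retraction onto a square inside the disc of radius 3: [f \o clampC] is continuous on
   the whole plane and agrees with [f] on the contour. *)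
Definition clamp (x : R) : R := Num.max (- (5/4)) (Num.min x (5/4)).
Definition clampC (z : Cx R) : Cx R := (clamp (complex.Re z) +i* clamp (complex.Im z))%C.

Lemma clamp_cases x : [\/ x <= - (5/4) /\ clamp x = - (5/4),
  5/4 <= x /\ clamp x = 5/4 | - (5/4) <= x <= 5/4 /\ clamp x = x].
Proof.
rewrite /clamp; case: (leP x (5/4)) => h1.
  by case: (leP (- (5/4)) x) => h2; [apply: Or33|apply: Or31]; split; lra.
by case: (leP (- (5/4)) (5/4)) => h2; [apply: Or32|apply: Or31]; split; lra.
Qed.

Lemma clamp_dist x y : `|clamp x - clamp y| <= `|x - y|.
Proof.
have h x' y' : x' <= y' -> `|clamp x' - clamp y'| <= `|x' - y'|.
  move=> xy; rewrite [leRHS]ler0_norm ?subr_le0// ler_norml.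
  by case: (clamp_cases x') => -[? ->]; case: (clamp_cases y') => -[? ->]; lra.
by have [/h//|/ltW/h] := leP x y; rewrite distrC (distrC y).
Qed.

Lemma clamp_bnd x : `|clamp x| <= 5/4.
Proof. by rewrite ler_norml; case: (clamp_cases x) => -[? ->]; lra. Qed.

Lemma clamp_id x : `|x| < 5/4 -> clamp x = x.
Proof. by rewrite ltr_norml => /andP[? ?]; case: (clamp_cases x) => -[? ->]; lra. Qed.

(** The level 5/4 exceeds 1, so that [clampC] is the identity near the contour, and [5/4 + 5/4 < 3]
    keeps its values in the disc. *)
Lemma clampC_lt3 z : cabs (clampC z) < 3.
Proof.
apply: le_lt_trans (cabs_le_ReIm _) _ => /=.
by have := clamp_bnd (complex.Re z); have := clamp_bnd (complex.Im z); lra.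
Qed.

Lemma clampC_id (z : Cx R) : `|complex.Re z| < 5/4 -> `|complex.Im z| < 5/4 -> clampC z = z.
Proof. by case: z => a b /= h1 h2; rewrite /clampC/= !clamp_id. Qed.

Lemma clampC_continuous f (z : Cx R) : (forall w : Cx R, cabs w < 3 -> {for w, continuous f}) ->
  {for z, continuous (fun w => f (clampC w) : Cx R)}.
Proof.
move=> fc; apply/Cx_continuousP => e e0.
have /Cx_continuousP/(_ e e0)[d d0 Hd] := fc _ (clampC_lt3 z).
exists (d / 2); first by rewrite divr_gt0.
move=> w wz; apply: Hd.
apply: le_lt_trans (cabs_le_ReIm _) _.
rewrite /clampC /=.
have := clamp_dist (complex.Re w) (complex.Re z).
have := clamp_dist (complex.Im w) (complex.Im z).
have : `|complex.Re w - complex.Re z| <= cabs (w - z).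
  by apply: le_trans (Re_le_cabs _); case: (w) (z) => [? ?] [? ?].
have : `|complex.Im w - complex.Im z| <= cabs (w - z).
  by apply: le_trans (Im_le_cabs _); case: (w) (z) => [? ?] [? ?].
by lra.
Qed.

(** The difference quotient of [f] at [w], completed by the derivative, is continuous at [w] and
    differentiable elsewhere, so [goursat_exception] applies. The integral of the kernel is left
    unevaluated. *)
Lemma cauchy_formula (f : Cx R -> Cx R) (w : Cx R) :
  (forall z : Cx R, cabs z < 3 -> derivable f z 1) -> cabs w <= 1/2 ->
  loop1 (fun z => f (clampC z) * (z - w)^-1) = f w * loop1 (fun z => (z - w)^-1).
Proof.
move=> fd wh.
have fc (z : Cx R) : cabs z < 3 -> {for z, continuous f}.
  by move=> /fd/derivable_cder[l]; exact: cder_continuous.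
pose ft z := f (clampC z).
have ftc z : {for z, continuous ft} := @clampC_continuous f z fc.
rewrite -/ft.
have w3 : cabs w < 3 by apply: le_lt_trans wh _; lra.
have [l Hl] := derivable_cder (fd w w3).
pose q (z : Cx R) := (ft z - f w) * (z - w)^-1.
pose g (z : Cx R) := if z == w then l else q z.
have gq z : z != w -> forall y, cabs (y - z) < cabs (z - w) -> g y = q y.
  move=> zw y yz; rewrite /g; case: eqP => // yw.
  by move: yz; rewrite yw cabsC ltxx.
have small y : cabs (y - w) < 1/4 -> ft y = f y.
  move=> yw; rewrite /ft clampC_id//; last first.
    apply: le_lt_trans (Im_le_cabs _) _.
    by rewrite -(subrK w y); apply: le_lt_trans (cabsD _ _) _; lra.
  apply: le_lt_trans (Re_le_cabs _) _.
  by rewrite -(subrK w y); apply: le_lt_trans (cabsD _ _) _; lra.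
have gc z : {for z, continuous g}.
  have [->|zw] := eqVneq z w.
    apply/Cx_continuousP => e e0.
    have e20 : 0 < e / 2 by rewrite divr_gt0.
    have [d d0 Hd] := Hl _ e20.
    exists (Num.min d (1/4)); first by rewrite lt_min d0; lra.
    move=> y; rewrite lt_min => /andP[yd y4].
    rewrite /g eqxx; case: eqP => [_|/eqP yw]; first by rewrite subrr cabs0.
    have yw0 : y - w != 0 by rewrite subr_eq0.
    have := Hd (y - w) yd.
    rewrite (_ : w + (y - w) = y); last by rewrite addrC subrK.
    rewrite /q (small _ y4) (_ : (f y - f w) * _ - l = (f y - f w - l * (y - w)) * (y - w)^-1).
      rewrite cabsM cabsV => H; rewrite ltr_pdivrMr ?cabs_gt0//.
      by apply: le_lt_trans H _; rewrite ltr_pM2r ?cabs_gt0//; lra.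
    by rewrite [RHS]mulrBl mulfK.
  apply: (@cont_near _ g q z (cabs (z - w))); first by rewrite cabs_gt0 subr_eq0.
    exact: gq.
  apply: contM; first by apply: contB; [exact: ftc|exact: cont_cst].
  by apply: contV; [apply: contB; [exact: cont_id|exact: cont_cst]|rewrite subr_eq0].
have gd z : inrect (-1) 1 (-1) 1 z -> z != w -> derivable g z 1.
  move=> [/andP[z1 z2] /andP[z3 z4]] zw.
  have z0 : cabs z < 3.
    apply: le_lt_trans (cabs_le_ReIm _) _.
    have : `|complex.Re z| <= 1 by rewrite ler_norml z1.
    have : `|complex.Im z| <= 1 by rewrite ler_norml z3.
    by lra.
  have [m Hm] := derivable_cder (fd z z0).
  have Hft : derivable ft z 1.
    apply: cder_derivable; apply: (cder_near (e := 1/4)) Hm; first lra.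
    move=> y yz; rewrite /ft clampC_id//.
      have : `|complex.Re y - complex.Re z| < 1/4.
        by apply: le_lt_trans yz; apply: le_trans (Re_le_cabs _); case: (y) (z) => [? ?] [? ?].
      by rewrite !ltr_norml => /andP[? ?]; lra.
    have : `|complex.Im y - complex.Im z| < 1/4.
      by apply: le_lt_trans yz; apply: le_trans (Im_le_cabs _); case: (y) (z) => [? ?] [? ?].
    by rewrite !ltr_norml => /andP[? ?]; lra.
  have Hq : derivable q z 1.
    apply: (@derivableM _ _ (fun y => ft y - f w) (fun y : Cx R => (y - w)^-1)).
      by apply: (@derivableB _ _ _ ft (fun=> f w)); [exact: Hft|exact: derivable_cst].
    apply: (@derivableV _ _ (fun y : Cx R => y - w)); first by rewrite subr_eq0.
    apply: (@derivableB _ _ _ (fun y : Cx R => y) (fun=> w)); first exact: derivable_id.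
    exact: derivable_cst.
  have [n Hn] := derivable_cder Hq.
  apply: cder_derivable; apply: (cder_near (e := cabs (z - w))) Hn; last exact: gq.
  by rewrite cabs_gt0 subr_eq0.
have L0 := goursat_exception wh gc gd.
have c1 : edge_cont (-1) 1 (-1) 1 (fun z => - f w * (z - w)^-1).
  by move=> z ze; apply: contM; [exact: cont_cst|exact: edge1_cont_inv].
have c2 : edge_cont (-1) 1 (-1) 1 (fun z => ft z * (z - w)^-1).
  by move=> z ze; apply: contM; [exact: ftc|exact: edge1_cont_inv].
have E : loop1 g = loop1 (fun z => ft z * (z - w)^-1) + - f w * loop1 (fun z => (z - w)^-1).
  rewrite -(loopM (small_rect1 R) (- f w) (edge1_cont_inv wh)) -(loopD (small_rect1 R) c2 c1).
  apply: eq_loop => z ze; rewrite /g; case: eqP => [zw|_].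
    by have := edge1_neq ze wh; rewrite zw subrr eqxx.
  by rewrite /q mulrBl mulNr.
by apply/eqP; rewrite -subr_eq0 -mulNr -E L0.
Qed.

(** Both integrals in [cauchy_formula] are expanded in [w]. On the right the expansion reduces to
    the constant [J], up to [O(|w| ^+ n)]; dividing by [J] produces the coefficients [a k / J]. The
    constant [A] depends on neither [f] nor [n]. *)
Theorem cauchy_taylor : exists2 A : R, 0 < A & forall (f : Cx R -> Cx R) (M : R),
  (forall z : Cx R, cabs z < 3 -> derivable f z 1) ->
  (forall z : Cx R, cabs z < 3 -> cabs (f z) <= M) ->
  exists c : nat -> Cx R, forall n z, cabs z <= 1/2 ->
    cabs (f z - \sum_(k < n) c k * z ^+ k) <= A * M * cabs z ^+ n.
Proof.
pose J := winding R; have J0 := winding_neq0 R; rewrite -/J in J0.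
have Jp : 0 < cabs J by rewrite cabs_gt0.
exists (64 / cabs J + 1); first by rewrite ltr_wpDl// divr_ge0// cabs_ge0.
move=> f M fd fM.
have M0 : 0 <= M by apply: le_trans (fM 0 _); rewrite ?cabs_ge0 ?cabs0.
have fc (z : Cx R) : cabs z < 3 -> {for z, continuous f}.
  by move=> /fd/derivable_cder[l]; exact: cder_continuous.
pose ft z := f (clampC z).
have ftc : edge_cont (-1) 1 (-1) 1 ft by move=> z _; exact: clampC_continuous.
have ftM z : edge (-1) 1 (-1) 1 z -> inrect (-1) 1 (-1) 1 z -> cabs (ft z) <= M.
  by move=> _ _; apply: fM; exact: clampC_lt3.
pose a k := loop1 (fun z => ft z * (z ^+ k.+1)^-1).
exists (fun k => a k / J) => n w wh.
(* For [n = 0] the sum is empty and does not contain [J]; the bound is then [M] itself, whence the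
   [+ 1] in [A]. *)
case: n => [|n].
  rewrite big_ord0 subr0 expr0 mulr1.
  have w3 : cabs w < 3 by apply: le_lt_trans wh _; lra.
  apply: le_trans (fM _ w3) _; rewrite mulrDl mul1r lerDr.
  by rewrite mulr_ge0// divr_ge0// ltW.
have E1 := loop_expand n.+1 ftc ftM wh.
have one_le (z : Cx R) : edge (-1) 1 (-1) 1 z -> inrect (-1) 1 (-1) 1 z -> cabs (1 : Cx R) <= 1.
  by rewrite cabs1.
have E2 := @loop_expand _ (fun=> 1) 1 w n.+1 (fun z _ => @cont_cst _ 1 z) one_le wh.
have L0 : loop1 (fun z : Cx R => 1 * (z - w)^-1) = loop1 (fun z => (z - w)^-1).
  by apply: eq_loop => z _; rewrite mul1r.
have LS : \sum_(k < n.+1) loop1 (fun z : Cx R => 1 * (z ^+ k.+1)^-1) * w ^+ k = J.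
  rewrite big_ord_recl big1 ?addr0 => [|k _].
    by rewrite expr0 mulr1; apply: eq_loop => z _; rewrite mul1r expr1.
  rewrite (_ : loop1 _ = 0) ?mul0r// -[RHS](loop_invX R k).
  by apply: eq_loop => z _; rewrite mul1r.
rewrite L0 LS in E2.
rewrite -(ler_pM2r Jp) -cabsM mulrBl mulr_suml.
rewrite (cauchy_formula fd wh) in E1.
have -> : f w * J - \sum_(k < n.+1) a k / J * w ^+ k * J =
  (f w * loop1 (fun z => (z - w)^-1) - \sum_(k < n.+1) a k * w ^+ k)
  - f w * (loop1 (fun z => (z - w)^-1) - J).
  rewrite (eq_bigr (fun k : 'I_n.+1 => a k * w ^+ k)); first by ring.
  by move=> k _; field.
apply: le_trans (cabsB _ _) _; rewrite cabsM.
have -> : (64 / cabs J + 1) * M * cabs w ^+ n.+1 * cabs J =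
   (64 + cabs J) * (M * cabs w ^+ n.+1) by field; rewrite gt_eqF.
apply: le_trans (lerD E1 (ler_pM (cabs_ge0 _) (cabs_ge0 _) (fM w _) E2)) _.
  by apply: le_lt_trans wh _; lra.
have : 0 <= cabs J * (M * cabs w ^+ n.+1) by rewrite !mulr_ge0 ?exprn_ge0 ?cabs_ge0.
by lra.
Qed.

End CauchyTaylor.

(** * Leading terms and Cauchy estimates on discs *)

Section CauchyEstimates.
Variable R : realType.

Lemma le_geom0 (x C : R) : (forall n, x <= C / 2 ^+ n) -> x <= 0.
Proof.
move=> H; have : (fun n => C / 2 ^+ n) @ \oo --> (0 : R).
  rewrite -[X in _ --> X](mulr0 C); apply: cvgMr.
  under eq_fun do rewrite -exprVn.
  by apply: cvg_expr; rewrite ger0_norm ?invr_ge0// invf_lt1 // ltr1n.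
move=> /cvgrPdist_lt cv; rewrite leNgt; apply/negP => x0.
have [N _ HN] := cv x x0.
have := HN N (leqnn _); rewrite sub0r normrN => /(le_lt_trans (ler_norm _)).
by rewrite ltNge H.
Qed.

Lemma ball_comp (F : C2 R -> Cx R) (g : Cx R -> C2 R) (t : Cx R) :
  differentiable F (g t) -> derivable g t 1 -> derivable (F \o g) t 1.
Proof.
move=> Fd /derivable1_diffP gd; apply/derivable1_diffP.
exact: differentiable_comp.
Qed.

Lemma derivable_line (z v : C2 R) (t : Cx R) :
  derivable (fun s : Cx R => z + s *: v) t (1 : Cx R).
Proof.
apply: (@derivableD _ _ _ (fun=> z) (fun s : Cx R => s *: v)).
  exact: derivable_cst.
apply/derivable1_diffP.
by apply: (@differentiableZl _ _ _ (fun s : Cx R => s) v); apply/derivable1_diffP; exact: derivable_id.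
Qed.

(** Rescaling by [r / 3] carries the disc of radius 3 to that of radius [r], and the range [1/2] to
    [r / 6]. *)
Lemma cauchy_taylor_disc : exists2 A : R, 0 < A & forall (f : Cx R -> Cx R) (z0 : Cx R) (M r : R),
  0 < r ->
  (forall z : Cx R, cabs (z - z0) < r -> derivable f z 1) ->
  (forall z : Cx R, cabs (z - z0) < r -> cabs (f z) <= M) ->
  exists c : nat -> Cx R, forall n h, cabs h <= r / 6 ->
    cabs (f (z0 + h) - \sum_(k < n) c k * h ^+ k) <= A * M * (3 * cabs h / r) ^+ n.
Proof.
have [A A0 HA] := cauchy_taylor R; exists A => // f z0 M r r0 fd fM.
pose q : Cx R := ((r / 3)%:C)%C.
have q0 : cabs q = r / 3 by rewrite cabs_real ger0_norm ?divr_ge0// ltW.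
have qn : q != 0 by rewrite -cabs_gt0 q0 divr_gt0.
have small z : cabs z < 3 -> cabs (z0 + z * q - z0) < r.
  by move=> z3; rewrite addrC addKr cabsM q0 mulrA ltr_pdivrMr// mulrC ltr_pM2l.
have [|z /small/fM//|c Hc] := HA (fun z => f (z0 + z * q)) M.
  move=> z /small/fd/derivable_cder[l Hl]; apply: (@cder_derivable _ _ _ (q * l)).
  move=> e e0; have [d d0 Hd] := Hl (e / cabs q) (divr_gt0 e0 (etrans (cabs_gt0 _) qn)).
  exists (d / cabs q); first by rewrite divr_gt0// cabs_gt0.
  move=> h; rewrite ltr_pdivlMr ?cabs_gt0// -cabsM => /Hd.
  have -> : e / cabs q * cabs (h * q) = e * cabs h.
    by rewrite cabsM [cabs h * _]mulrC mulrA mulfVK// cabs_eq0.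
  rewrite (_ : z0 + z * q + h * q = z0 + (z + h) * q); last by ring.
  by rewrite (_ : l * (h * q) = q * l * h)//; ring.
exists (fun k => c k / q ^+ k) => n h hr.
have hq : cabs (h / q) <= 1 / 2.
  by rewrite cabsM cabsV q0 ler_pdivrMr ?divr_gt0//; lra.
have := Hc n (h / q) hq; rewrite mulfVK// cabsM cabsV q0 invf_div mulrA [cabs h * 3]mulrC.
rewrite (eq_bigr (fun k : 'I_n => c k / q ^+ k * h ^+ k)) => // k _.
by rewrite expr_div_n; ring.
Qed.

(** If all coefficients vanish, the estimate has ratio [3 * |t| / r <= 1/2] for [|t| < r / 6], and
    letting n grow gives [f t = 0]. Otherwise the first nonzero coefficient leads. *)
Lemma holo_lead (f : Cx R -> Cx R) : (\forall t \near (0 : Cx R), derivable f t 1) ->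
  (\forall t \near (0 : Cx R), f t = 0) \/
  exists (a : nat) (c : Cx R) (K d : R), [/\ c != 0, 0 < d &
    forall t, cabs t < d -> cabs (f t - c * t ^+ a) <= K * cabs t ^+ a.+1].
Proof.
move=> /nbhs_CxP[d d0 Hd].
have f0 : derivable f 0 1 by apply: Hd; rewrite subrr cabs0.
have /derivable_cder[l /cder_continuous/Cx_continuousP/(_ 1 ltr01)[d' d'0 Hd']] := f0.
pose r := Num.min d d'; have r0 : 0 < r by rewrite lt_min d0.
pose M := 1 + cabs (f 0).
have [A A0 HA] := cauchy_taylor_disc.
have [z|z|c Hc] := HA f 0 M r r0.
- by rewrite lt_min => /andP[/Hd].
- rewrite lt_min => /andP[_ /Hd' H]; rewrite -(subrK (f 0) (f z)).
  by apply: le_trans (cabsD _ _) _; rewrite lerD2r ltW.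
have [c0|cn0] := pselect (forall k, c k = 0).
  left; apply/nbhs_CxP; exists (r / 6); first by rewrite divr_gt0.
  move=> t; rewrite subr0 => tr.
  apply/eqP; rewrite -cabs_eq0 eq_le cabs_ge0 andbT.
  apply: (@le_geom0 _ (A * M)) => n.
  have := Hc n t (ltW tr); rewrite add0r big1 ?subr0 => [|k _]; last by rewrite c0 mul0r.
  move=> H; apply: (le_trans H); rewrite -exprVn.
  have M0 : 0 <= A * M by rewrite mulr_ge0 ?ltW// ltr_pwDl// cabs_ge0.
  rewrite ler_wpM2l// lerXn2r ?nnegrE ?invr_ge0 ?divr_ge0 ?mulr_ge0 ?cabs_ge0 ?(ltW r0)//.
  by rewrite ler_pdivrMr//; lra.
right.
have ex : exists k, c k != 0.
  by apply: contrapT => H; apply: cn0 => k; apply/eqP/negPn/negP => ck; apply: H; exists k.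
case: (ex_minnP ex) => a ca amin.
exists a, (c a), (A * M * (3 / r) ^+ a.+1), (r / 6); split => //; first by rewrite divr_gt0.
move=> t tr; have := Hc a.+1 t (ltW tr); rewrite [0 + t]add0r big_ord_recr /= big1 ?[0 + _]add0r.
  move=> /le_trans; apply.
  by rewrite (_ : 3 * cabs t / r = 3 / r * cabs t) ?exprMn ?mulrA//; ring.
move=> k _; case: (eqVneq (c k) 0) => [->|/amin]; first by rewrite mul0r.
by rewrite leqNgt ltn_ord.
Qed.

(** The case [n = 1] of the expansion. The Lipschitz constant depends on [f] only through its bound
    [M], which makes it uniform in families. *)
Lemma cauchy_lip : exists2 A : R, 0 < A & forall (f : Cx R -> Cx R) (z0 : Cx R) (M r : R),
  0 < r ->
  (forall z : Cx R, cabs (z - z0) < r -> derivable f z 1) ->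
  (forall z : Cx R, cabs (z - z0) < r -> cabs (f z) <= M) ->
  forall h, cabs h <= r / 6 -> cabs (f (z0 + h) - f z0) <= A * M / r * cabs h.
Proof.
have [A A0 HA] := cauchy_taylor_disc; exists (3 * A); first by rewrite mulr_gt0.
move=> f z0 M r r0 fd fM h hr.
have [c Hc] := HA f z0 M r r0 fd fM.
have fc : f z0 = c 0%N.
  apply/eqP; rewrite -subr_eq0 -cabs_eq0 eq_le cabs_ge0 andbT.
  have r6 : cabs (0 : Cx R) <= r / 6 by rewrite cabs0 divr_ge0// ltW.
  have := Hc 1%N 0 r6; rewrite cabs0 big_ord_recl big_ord0 /= expr0 mulr1 !addr0.
  by rewrite mulr0 mul0r expr1 mulr0.
have := Hc 1%N h hr; rewrite big_ord_recl big_ord0 /= addr0 expr0 mulr1 -fc expr1.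
by rewrite (_ : A * M * _ = 3 * A * M / r * cabs h)//; ring.
Qed.

Lemma differentiable_C2_cont (F : C2 R -> Cx R) (z : C2 R) : differentiable F z ->
  forall e : R, 0 < e -> exists2 d : R, 0 < d &
    forall w, nrm2 (w - z) < d -> cabs (F w - F z) < e.
Proof.
move=> /differentiable_continuous Fc e e0.
have /= := Fc [set w | cabs (w - F z) < e].
by case/(_ _)/nbhs_C2P => [|d d0 Hd]; [apply/nbhs_CxP; exists e|exists d].
Qed.

(** [F] is restricted to the complex line through [z] and [w], where the one-variable estimate
    [cauchy_lip] applies with uniform constants. *)
Lemma holo_lipschitz (F : C2 R -> Cx R) (p : C2 R) :
  (\forall z \near p, differentiable F z) ->
  exists L d : R, [/\ 0 <= L, 0 < d & forall z w, nrm2 (z - p) < d -> nrm2 (w - p) < d ->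
    cabs (F z - F w) <= L * nrm2 (z - w)].
Proof.
move=> /nbhs_C2P[d d0 Hd].
have Fp : differentiable F p by apply: Hd; rewrite subrr /nrm2 cabs0 maxxx.
have [d' d'0 Hd'] := differentiable_C2_cont Fp ltr01.
pose r := Num.min d d'; have r0 : 0 < r by rewrite lt_min d0.
have [A A0 HA] := cauchy_lip.
pose M := 1 + cabs (F p).
have M0 : 0 <= M by rewrite addr_ge0// cabs_ge0.
(* On the line a disc of radius [r / 2] about [w] stays in the ball of radius [r], and
   [|z - w| < r / 12 = (r / 2) / 6] is within the range of [cauchy_lip]. *)
exists (A * M / (r / 2)), (r / 24); split.
- by rewrite divr_ge0// ?mulr_ge0// ?ltW// divr_gt0.
- by rewrite divr_gt0.
move=> z w zp wp.
have [zw|zw] := eqVneq (nrm2 (z - w)) 0.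
  by rewrite zw mulr0 (subr0_eq (nrm2_eq0 zw)) subrr cabs0.
have zw0 : 0 < nrm2 (z - w) by rewrite lt_neqAle eq_sym zw nrm2_ge0.
pose N : Cx R := ((nrm2 (z - w))%:C)%C.
have NE : cabs N = nrm2 (z - w) by rewrite cabs_real ger0_norm// nrm2_ge0.
have N0 : N != 0 by rewrite -cabs_gt0 NE.
pose v := N^-1 *: (z - w).
have v1 : nrm2 v = 1 by rewrite nrm2Z cabsV NE mulVf.
have small s : cabs (s - 0) < r / 2 -> nrm2 (w + s *: v - p) < r.
  rewrite subr0 => sr; rewrite addrAC.
  by apply: le_lt_trans (nrm2D _ _) _; rewrite nrm2Z v1; lra.
have r20 : 0 < r / 2 by rewrite divr_gt0.
have := HA (fun s => F (w + s *: v)) 0 M (r / 2) r20.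
have E : w + (0 + N) *: v = z by rewrite add0r /v scalerA divff// scale1r addrC subrK.
move=> /(_ _ _ N); rewrite E scale0r addr0 NE; apply.
- move=> s /small; rewrite lt_min => /andP[/Hd sd _].
  by apply: (@ball_comp F (fun s => w + s *: v)) => //; exact: derivable_line.
- move=> s /small; rewrite lt_min => /andP[_ /Hd' sd].
  rewrite -(subrK (F p) (F _)).
  by apply: le_trans (cabsD _ _) _; rewrite lerD2r ltW.
rewrite -(subrK p z) -addrA; apply: le_trans (nrm2D _ _) _.
by rewrite (nrm2C p w); lra.
Qed.

End CauchyEstimates.

(** * Holomorphic implicit functions *)

Section ImplicitFunction.
Variable R : realType.

Lemma C2_normE (z : C2 R) : `|z| = ((nrm2 z)%:C)%C.
Proof.
rewrite prod_normE !normE /nrm2 /Num.max ltcR /Order.max.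
by case: ifP.
Qed.

Lemma differentiable_eps (F : C2 R -> Cx R) (z : C2 R) : differentiable F z ->
  exists a b : Cx R, (forall v, 'D_v F z = a * v.1 + b * v.2) /\
  forall e : R, 0 < e -> exists2 d, 0 < d &
    forall h, nrm2 h < d -> cabs (F (z + h) - F z - (a * h.1 + b * h.2)) <= e * nrm2 h.
Proof.
move=> Fd; exists ('d F z (1, 0)), ('d F z (0, 1)).
have dE h : 'd F z h = 'd F z (1, 0) * h.1 + 'd F z (0, 1) * h.2.
  have {1}-> : h = h.1 *: ((1, 0) : C2 R) + h.2 *: ((0, 1) : C2 R).
    case: h => h1 h2 /=; congr pair => /=.
      by rewrite [RHS](_ : _ = h1 * 1 + h2 * 0)// mulr1 mulr0 addr0.
    by rewrite [RHS](_ : _ = h1 * 0 + h2 * 1)// mulr1 mulr0 add0r.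
  by rewrite linearD !linearZ /= ![_ *: _]mulrC.
split; first by move=> v; rewrite deriveE// dE.
move=> e e0; have /diff_locally := Fd.
move=> /eqaddoP => H.
have ec : 0 < (e%:C)%C :> R[i] by rewrite ltcE /= eqxx.
have /nbhs_C2P[d d0 Hd] := H _ ec.
exists d => // h hd; have := Hd h; rewrite subr0 => /(_ hd) /=.
rewrite normE C2_normE -rmorphM lecR -dE.
rewrite (_ : (_ - _) h = F (z + h) - F z - 'd F z h)//.
by rewrite -[LHS]/(F (h + z) - (F z + 'd F z h)) opprD addrA (addrC h).
Qed.

(** For the real and the imaginary parts, the intervals of radius [2 * C / 2 ^+ n] about the n-th
    term are nested; their common point is the limit. *)
Lemma geometric_limit (u : nat -> Cx R) (C : R) :
  (forall n, cabs (u n.+1 - u n) <= C / 2 ^+ n) ->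
  exists l, forall n, cabs (u n - l) <= 4 * C / 2 ^+ n.
Proof.
move=> uC.
have key (v : nat -> R) : (forall n, `|v n.+1 - v n| <= C / 2 ^+ n) ->
    exists l, forall n, `|v n - l| <= 2 * C / 2 ^+ n.
  move=> vC.
  pose F n := v n - 2 * C / 2 ^+ n; pose G n := v n + 2 * C / 2 ^+ n.
  have half n : 2 * C / 2 ^+ n.+1 = C / 2 ^+ n.
    by rewrite exprS; field; rewrite expf_neq0.
  have dbl n : 2 * C / 2 ^+ n = C / 2 ^+ n + C / 2 ^+ n by rewrite -mulrA mulr_natl mulr2n.
  have F1 n : F n <= F n.+1.
    by rewrite /F half dbl; have := vC n; rewrite ler_norml => /andP[? ?]; lra.
  have G1 n : G n.+1 <= G n.
    by rewrite /G half dbl; have := vC n; rewrite ler_norml => /andP[? ?]; lra.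
  have C0 n : 0 <= C / 2 ^+ n by apply: le_trans (vC n); exact: normr_ge0.
  have FG n : F n <= G n by rewrite /F /G dbl; have := C0 n; lra.
  have [l Hl] := nested_limit F1 G1 FG.
  by exists l => n; rewrite distrC ler_distl; exact: Hl.
have [n|a Ha] := key (fun n => complex.Re (u n)).
  by apply: le_trans (uC n); apply: le_trans (Re_le_cabs _); case: (u n) (u n.+1) => [? ?] [? ?].
have [n|b Hb] := key (fun n => complex.Im (u n)).
  by apply: le_trans (uC n); apply: le_trans (Im_le_cabs _); case: (u n) (u n.+1) => [? ?] [? ?].
exists (a +i* b)%C => n; apply: le_trans (cabs_le_ReIm _) _.
have := lerD (Ha n) (Hb n).
rewrite -mulrDl -mulrDl (_ : 2 + 2 = 4 :> R); last by ring.
by case: (u n) => [? ?].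
Qed.

(** Banach's fixed point theorem on a closed disc: the bound on the increments of the orbit of 0
    halves at each step. *)
Lemma contraction_fixed (k : Cx R -> Cx R) (r : R) : 0 < r ->
  (forall b, cabs b <= r -> cabs (k b) <= r) ->
  (forall b b', cabs b <= r -> cabs b' <= r -> cabs (k b - k b') <= 1/2 * cabs (b - b')) ->
  exists2 b, cabs b <= r & k b = b.
Proof.
move=> r0 kr kl; pose u n := iter n k 0.
have ur n : cabs (u n) <= r.
  by elim: n => [|n IH]; rewrite /u /= ?cabs0 ?(ltW r0)//; apply: kr.
have uC n : cabs (u n.+1 - u n) <= r / 2 ^+ n.
  elim: n => [|n IH]; first by rewrite expr0 divr1 /u /= subr0; exact: (ur 1%N).
  apply: le_trans (kl _ _ (ur n.+1) (ur n)) _.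
  rewrite (_ : r / 2 ^+ n.+1 = 1/2 * (r / 2 ^+ n)); first by rewrite ler_pM2l.
  by rewrite exprS invfM; ring.
have [b Hb] := geometric_limit uC.
have br : cabs b <= r.
  rewrite -subr_le0; apply: (@le_geom0 _ _ (4 * r)) => n.
  by have := Hb n; have := cabs_sub b (u n); have := ur n; rewrite (cabsC b); lra.
exists b => //; apply/eqP; rewrite -subr_eq0 -cabs_eq0 eq_le cabs_ge0 andbT.
apply: (@le_geom0 _ _ (8 * r)) => n.
rewrite (_ : k b - b = (k b - k (u n)) + (u n.+1 - b)); last by rewrite addrA subrK.
apply: le_trans (cabsD _ _) _.
have := kl _ _ br (ur n); have := Hb n; have := Hb n.+1; rewrite (cabsC b).
rewrite exprS invfM.
have -> : 8 * r / 2 ^+ n = 2 * (4 * r / 2 ^+ n) by ring.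
have : 0 <= 4 * r / 2 ^+ n by rewrite divr_ge0 ?mulr_ge0 ?exprn_ge0// ltW.
have -> : 4 * r * (2^-1 * (2 ^+ n)^-1) = 4 * r / 2 ^+ n / 2 by ring.
by lra.
Qed.

(** The contraction constant [1/2] bounds the partial derivative [Q] up to an error [1/4] of the
    expansion. This keeps [1 - Q] invertible in [fixed_point_derivable]. *)
Lemma fixed_slope (k : C2 R -> Cx R) (a b P Q : Cx R) (dl : R) : 0 < dl ->
  (forall e : R, 0 < e -> exists2 d, 0 < d &
    forall h, nrm2 h < d -> cabs (k ((a, b) + h) - k (a, b) - (P * h.1 + Q * h.2)) <= e * nrm2 h) ->
  (forall b', cabs (b' - b) <= dl -> cabs (k (a, b') - k (a, b)) <= 1/2 * cabs (b' - b)) ->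
  cabs Q <= 3/4.
Proof.
move=> dl0 PQ lipk; have [|d d0 Hd] := PQ (1/4); first by rewrite divr_gt0.
pose s := Num.min (d / 2) dl; have s0 : 0 < s by rewrite lt_min divr_gt0.
have sd : s < d by apply: (@le_lt_trans _ _ (d / 2)); [rewrite ge_min lexx|lra].
have cs : cabs ((s%:C)%C : Cx R) = s by rewrite cabs_real ger0_norm// ltW.
have ns : nrm2 ((0, (s%:C)%C) : C2 R) = s by rewrite /nrm2 /= cabs0 cs max_r// ltW.
pose b1 : Cx R := b + (s%:C)%C.
have b1E : b1 - b = (s%:C)%C by rewrite /b1 addrC addKr.
have b1s : cabs (b1 - b) <= dl by rewrite b1E cs ge_min lexx orbT.
have := Hd (0, (s%:C)%C); rewrite ns => /(_ sd) /=; rewrite mulr0 add0r.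
rewrite (_ : ((a, b) : C2 R) + _ = (a, b1)); last by congr pair; rewrite addr0.
have := lipk b1 b1s; rewrite b1E cs => h1 h2.
have := cabs_sub (Q * (s%:C)%C) (k (a, b1) - k (a, b)).
rewrite (cabsC (Q * _)) => h3; have : cabs (Q * (s%:C)%C) <= 3/4 * s by lra.
by rewrite cabsM cs ler_pM2r.
Qed.

(** Implicit differentiation of [k (a, phi a) = phi a] gives the derivative [P / (1 - Q)]. The
    Lipschitz bound on [phi] turns an error in the full increment into an error in [h]. *)
Lemma fixed_point_derivable (k : C2 R -> Cx R) (phi : Cx R -> Cx R) (a P Q : Cx R) (L dl : R) :
  0 < dl -> 0 <= L -> cabs Q <= 3/4 ->
  (forall e : R, 0 < e -> exists2 d, 0 < d & forall h, nrm2 h < d ->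
    cabs (k ((a, phi a) + h) - k (a, phi a) - (P * h.1 + Q * h.2)) <= e * nrm2 h) ->
  (forall h, cabs h < dl -> k (a + h, phi (a + h)) = phi (a + h) /\
    cabs (phi (a + h) - phi a) <= L * cabs h) ->
  derivable phi a 1.
Proof.
move=> dl0 L0 Qs PQ Hphi.
have Q1 : 1/4 <= cabs (1 - Q) by have := cabs_sub 1 Q; rewrite cabs1; lra.
have Qn : 1 - Q != 0 by rewrite -cabs_gt0; lra.
have kE0 : k (a, phi a) = phi a.
  by have := Hphi 0; rewrite cabs0 addr0 => /(_ dl0)[].
apply: (@cder_derivable _ _ _ (P / (1 - Q))) => ep ep0.
have L1 : 0 < L + 1 by lra.
(* [L + 1] pays for the norm of the increment [(h, D)], and 4 for the division by [1 - Q]. *)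
have [d d00 Hd] := PQ (ep / (4 * (L + 1))) (divr_gt0 ep0 (mulr_gt0 (ltr0Sn R 3) L1)).
exists (Num.min (d / (L + 1)) dl); first by rewrite lt_min divr_gt0.
move=> h; rewrite lt_min ltr_pdivlMr// => /andP[h1 /Hphi[kE Dh]].
pose D := phi (a + h) - phi a.
have nh : nrm2 ((h, D) : C2 R) <= (L + 1) * cabs h.
  rewrite nrm2_le /= mulrDl mul1r lerDr mulr_ge0 ?cabs_ge0//=.
  by apply: le_trans Dh _; rewrite lerDl cabs_ge0.
have := Hd (h, D) (le_lt_trans nh _); rewrite mulrC => /(_ h1).
rewrite (_ : ((a, phi a) : C2 R) + _ = (a + h, phi (a + h))); last first.
  by congr pair; rewrite /D addrC subrK.
rewrite kE kE0 /= -/D => HD2.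
rewrite (_ : D - P / (1 - Q) * h = (D - (P * h + Q * D)) / (1 - Q)); last by field.
rewrite cabsM cabsV ler_pdivrMr ?cabs_gt0//.
apply: le_trans HD2 _.
apply: (@le_trans _ _ (ep / (4 * (L + 1)) * ((L + 1) * cabs h))).
  by rewrite ler_wpM2l// divr_ge0 ?mulr_ge0 ?(ltW ep0) ?(ltW L1).
rewrite (_ : ep / _ * _ = ep * cabs h * (1/4)); last by field; rewrite gt_eqF.
by rewrite ler_wpM2l// mulr_ge0 ?cabs_ge0// ltW.
Qed.

(* [b |-> b - H (a, b) / D_2 H 0] is a contraction by the Cauchy estimate [cauchy_lip],
   being small on a disc of fixed radius. *)
Lemma implicit_function (H : C2 R -> Cx R) :
  (\forall z \near (0 : C2 R), differentiable H z) -> H 0 = 0 ->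
  'D_(0, 1) H 0 != 0 ->
  exists phi : Cx R -> Cx R, [/\ phi 0 = 0,
    \forall t \near (0 : Cx R), derivable phi t 1 &
    \forall t \near (0 : Cx R), H (t, phi t) = 0].
Proof.
move=> Hnear H0 Hb.
have /nbhs_C2P[d0 d00 Hd0] := Hnear.
have nrm20 : nrm2 (0 : C2 R) = 0 by rewrite /nrm2 cabs0 maxxx.
have HD z : nrm2 z < d0 -> differentiable H z by move=> zd; apply: Hd0; rewrite subr0.
have [al [be [HDv Heps]]] := differentiable_eps (HD 0 (eq_ind_r (fun x => x < d0) d00 nrm20)).
have {}Hb : be != 0 by move: Hb; rewrite HDv /= mulr0 add0r mulr1.
have [A A0 HA] := cauchy_lip R.
(* With [|k| <= 2 * e * rho] on a disc of radius [rho / 2], [cauchy_lip] then gives the Lipschitz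
   constant [4 * A * e = 1/2]. *)
pose e := 1 / (8 * A).
have e0 : 0 < e by rewrite divr_gt0// mulr_gt0.
pose k (z : C2 R) : Cx R := z.2 - H z / be.
have bep : 0 < cabs be by rewrite cabs_gt0.
have [d1 d10 Hd1] := Heps (e * cabs be) (mulr_gt0 e0 bep).
pose C := cabs (al / be).
have C0 : 0 <= C by exact: cabs_ge0.
pose rho := Num.min d0 d1; have rho0 : 0 < rho by rewrite lt_min d00.
have kb z : nrm2 z < rho -> cabs (k z) <= e * nrm2 z + C * cabs z.1.
  rewrite lt_min => /andP[_ /Hd1]; rewrite add0r H0 subr0 => Hz.
  rewrite (_ : k z = - ((H z - (al * z.1 + be * z.2)) / be) - al / be * z.1); last first.
    by rewrite /k; field.
  apply: le_trans (cabsB _ _) _; rewrite cabsN [X in _ + X]cabsM; apply: lerD => //.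
  rewrite cabsM cabsV ler_pdivrMr//; apply: le_trans Hz _.
  by rewrite mulrAC.
have kd z : nrm2 z < d0 -> differentiable k z.
  move=> zd; apply: differentiableB.
    by apply: linear_differentiable => ?; exact: cvg_snd.
  apply: (@differentiableM _ _ H (fun=> be^-1)); first exact: HD.
  exact: differentiable_cst.
have curve a b : derivable (fun s : Cx R => (a, s) : C2 R) b 1.
  rewrite (_ : (fun s => _) = (fun s : Cx R => (a, 0) + s *: ((0, 1) : C2 R))).
    exact: derivable_line.
  apply/funext => s; congr pair => /=.
    by rewrite [RHS](_ : _ = a + s * 0)// mulr0 addr0.
  by rewrite [RHS](_ : _ = 0 + s * 1)// mulr1 add0r.
(* The first entry gives [C * eta <= e * rho], hence [|k| <= 2 * e * rho]. The second gives
   [|k (a, 0)| <= rho / 48], so that the contraction maps the disc of radius [rho / 24] into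
   itself. *)
pose eta := Num.min (e * rho / (C + 1)) (rho / (48 * (e + C + 1))).
have eC : 0 < e + C + 1 by rewrite ltr_wpDl// addr_ge0// ltW.
have C1 : 0 < C + 1 by rewrite ltr_wpDl.
have eta0 : 0 < eta by rewrite lt_min !divr_gt0// mulr_gt0.
have [eta1 eta2 eta3] : [/\ C * eta <= e * rho, (e + C) * eta <= rho / 48 & eta <= rho / 48].
  have : eta <= e * rho / (C + 1) by rewrite ge_min lexx.
  have : eta <= rho / (48 * (e + C + 1)) by rewrite ge_min lexx orbT.
  rewrite ler_pdivlMr ?mulr_gt0// => h1; rewrite ler_pdivlMr ?ltr_wpDl// => h2.
  have := mulr_ge0 C0 (ltW eta0); have := mulr_gt0 e0 eta0.
  by split; lra.
have lipk a b b' : cabs a <= eta -> cabs b <= rho / 24 -> cabs b' <= rho / 24 ->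
    cabs (k (a, b') - k (a, b)) <= 1/2 * cabs (b' - b).
  move=> ha hb hb'.
  have r20 : 0 < rho / 2 by rewrite divr_gt0.
  have small s : cabs (s - b) < rho / 2 -> nrm2 ((a, s) : C2 R) < rho.
    move=> sb; rewrite nrm2_lt /=; apply/andP; split; first lra.
    by rewrite -(subrK b s); apply: le_lt_trans (cabsD _ _) _; lra.
  have := HA (fun s => k (a, s)) b (2 * e * rho) (rho / 2) r20.
  move=> /(_ _ _ (b' - b)); rewrite (_ : b + (b' - b) = b'); last by rewrite addrC subrK.
  have -> : A * (2 * e * rho) / (rho / 2) = 1/2 by rewrite /e; field; rewrite !gt_eqF.
  apply.
  - move=> s /small; rewrite lt_min => /andP[/kd sd _].
    exact: (@ball_comp _ k (fun s => (a, s)) s sd (curve a s)).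
  - move=> s /small sr; apply: le_trans (kb _ sr) _ => /=.
    have : e * nrm2 ((a, s) : C2 R) <= e * rho by rewrite ler_pM2l// ltW.
    have : C * cabs a <= C * eta by rewrite ler_wpM2l.
    by lra.
  - by apply: le_trans (cabsB _ _) _; lra.
have ka0 a : cabs a <= eta -> cabs (k (a, 0)) <= (e + C) * cabs a.
  move=> ha; have : nrm2 ((a, 0) : C2 R) = cabs a by rewrite /nrm2 /= cabs0 max_l ?cabs_ge0.
  move=> na; have := kb (a, 0); rewrite na /= -mulrDl; apply.
  by apply: le_lt_trans ha _; lra.
have /choice[phi Hphi] : forall a, exists b, cabs a <= eta -> cabs b <= rho / 24 /\ k (a, b) = b.
  move=> a; have [ha|na] := boolP (cabs a <= eta); last by exists 0.
  have r24 : 0 < rho / 24 by rewrite divr_gt0.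
  have [b hb|b b' hb hb'|b hb kbE] := contraction_fixed (k := fun b => k (a, b)) r24.
  - rewrite -(subrK (k (a, 0)) (k (a, b))); apply: le_trans (cabsD _ _) _.
    have := lipk a 0 b ha; rewrite cabs0 subr0 => /(_ (ltW r24) hb).
    have := ka0 a ha; have : (e + C) * cabs a <= (e + C) * eta.
      by rewrite ler_wpM2l// addr_ge0// ltW.
    by lra.
  - exact: lipk.
  - by exists b.
have phi_uniq a b : cabs a <= eta -> cabs b <= rho / 24 -> k (a, b) = b -> phi a = b.
  move=> ha hb kE; have [p1 p2] := Hphi a ha.
  have := lipk a b (phi a) ha hb p1; rewrite kE p2 => h.
  apply/eqP; rewrite -subr_eq0 -cabs_eq0 eq_le cabs_ge0 andbT; lra.
have phi_le a : cabs a <= eta -> cabs (phi a) <= 2 * (e + C) * cabs a.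
  move=> ha; have [p1 p2] := Hphi a ha.
  have := lipk a 0 (phi a) ha; rewrite p2 cabs0 subr0 divr_ge0 ?(ltW rho0)// => /(_ isT p1).
  by have := ka0 a ha; have := cabs_sub (phi a) (k (a, 0)); lra.
have [|L [d2 [L0 d20 HL]]] := @holo_lipschitz R k 0.
  apply/nbhs_C2P; exists d0; first exact: d00.
  by move=> z; rewrite subr0; exact: kd.
pose q := 1 + 2 * (e + C).
have q1 : 1 <= q by rewrite lerDl mulr_ge0// addr_ge0// ltW.
have q0 : 0 < q by apply: lt_le_trans q1.
pose eta' := Num.min eta (d2 / q).
have eta'0 : 0 < eta' by rewrite lt_min eta0 divr_gt0.
have eta'P a : cabs a < eta' -> cabs a < eta /\ cabs a * q < d2.
  by rewrite lt_min ltr_pdivlMr// => /andP.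
have phi_q a a' : cabs a < eta' -> cabs a' < eta' -> nrm2 ((a', phi a) - 0 : C2 R) < d2.
  move=> /eta'P[/ltW ha ha2] /eta'P[ha' ha'2].
  rewrite subr0 nrm2_lt /=; apply/andP; split.
    by apply: le_lt_trans ha'2; rewrite ler_peMr ?cabs_ge0.
  apply: le_lt_trans (phi_le _ ha) _; apply: le_lt_trans ha2.
  by rewrite mulrC ler_wpM2l ?cabs_ge0// /q; lra.
(* Changing the first argument of [k] costs [L * |a - a'|], changing the second at most half of the
   difference to be estimated; that half is absorbed. *)
have phi_lip a a' : cabs a < eta' -> cabs a' < eta' -> cabs (phi a - phi a') <= 2 * L * cabs (a - a').
  move=> ha ha'.
  have [ea ea'] : cabs a <= eta /\ cabs a' <= eta.
    by have [/ltW ? _] := eta'P _ ha; have [/ltW ? _] := eta'P _ ha'.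
  have [p1 p2] := Hphi a ea; have [p1' p2'] := Hphi a' ea'.
  have := lipk a' (phi a') (phi a) ea' p1' p1.
  have := HL (a, phi a) (a', phi a) (phi_q _ _ ha ha) (phi_q _ _ ha ha').
  have -> : nrm2 (((a, phi a) : C2 R) - (a', phi a)) = cabs (a - a').
    by rewrite /nrm2 /= subrr cabs0 max_l// cabs_ge0.
  have := cabsD (k (a, phi a) - k (a', phi a)) (k (a', phi a) - k (a', phi a')).
  by rewrite addrA subrK p2 p2'; lra.
exists phi; split.
- apply: phi_uniq; rewrite ?cabs0 ?(ltW eta0) ?divr_ge0 ?(ltW rho0)//.
  by rewrite /k /= -[(0, 0)]/(0 : C2 R) H0 mul0r subr0.
- apply/nbhs_CxP; exists eta' => // a0; rewrite subr0 => ha0.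
  have [ea0 _] := eta'P _ ha0.
  have [pa0 ka0E] := Hphi a0 (ltW ea0).
  have pa0s : cabs (phi a0) < rho / 24.
    apply: le_lt_trans (phi_le _ (ltW ea0)) _; have eC' : 0 < e + C by rewrite ltr_wpDr.
    have : (e + C) * cabs a0 < (e + C) * eta by rewrite ltr_pM2l.
    by lra.
  have [|P [Q [_ PQ]]] := @differentiable_eps k (a0, phi a0).
    apply: kd; rewrite nrm2_lt /=.
    have : rho <= d0 by rewrite ge_min lexx.
    by move=> ?; apply/andP; split; lra.
  have Qs : cabs Q <= 3/4.
    have dl0 : 0 < rho / 24 - cabs (phi a0) by rewrite subr_gt0.
    apply: (fixed_slope dl0 PQ) => b' hb'; apply: (lipk _ _ _ (ltW ea0) pa0).
    by rewrite -(subrK (phi a0) b'); apply: le_trans (cabsD _ _) _; rewrite -lerBrDr.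
  have dl0 : 0 < eta' - cabs a0 by rewrite subr_gt0.
  have L2 : 0 <= 2 * L by rewrite mulr_ge0.
  apply: (fixed_point_derivable dl0 L2 Qs PQ) => h hh.
  have ha : cabs (a0 + h) < eta'.
    by rewrite addrC; apply: le_lt_trans (cabsD _ _) _; rewrite -ltrBrDr.
  split; first by have [/ltW/Hphi[]] := eta'P _ ha.
  by have := phi_lip _ _ ha ha0; rewrite (_ : a0 + h - a0 = h)// addrC addKr.
- apply/nbhs_CxP; exists eta => // a; rewrite subr0 => /ltW/Hphi[_ kE].
  apply/eqP; have : H (a, phi a) / be = 0.
    by move: kE; rewrite /k /= => /eqP; rewrite subr_eq addrC -subr_eq subrr eq_sym => /eqP.
  by move/eqP; rewrite mulf_eq0 invr_eq0 (negbTE Hb) orbF.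
Qed.

End ImplicitFunction.

(** * Taylor expansion of smooth functions *)

Section RealCalculus.
Variable R : realType.
Implicit Types (f g : R4 R -> R) (U : set (R4 R)).

Lemma is_derive_line f (y v : R4 R) (s : R) : derivable f (y + s *: v) v ->
  is_derive s 1 (fun s => f (y + s *: v)) ('D_v f (y + s *: v)).
Proof.
move=> fd.
have E : (fun h : R => h^-1 *: (((fun s => f (y + s *: v)) \o shift s) (h *: (1 : R)) - f (y + s *: v)))
    = (fun h : R => h^-1 *: ((f \o shift (y + s *: v)) (h *: v) - f (y + s *: v))).
  apply/funext => h /=; congr (_ *: (f _ - _)).
  by rewrite [h *: 1]mulr1 scalerDl addrCA.
by split; rewrite /derivable /derive E.
Qed.

Lemma mvt_line f (y v : R4 R) (h : R) :
  (forall s : R, `|s| <= `|h| -> derivable f (y + s *: v) v) ->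
  exists2 t : R, `|t| <= `|h| & f (y + h *: v) - f y = h * 'D_v f (y + t *: v).
Proof.
move=> fd.
have D (s : R) : `|s| <= `|h| -> is_derive s 1 (fun s => f (y + s *: v)) ('D_v f (y + s *: v)).
  by move=> /fd; exact: is_derive_line.
have f0 : f y = f (y + 0 *: v) by rewrite scale0r addr0.
have [h0|/ltW h0] := leP 0 h.
  have [||t] := @MVT_segment R (fun s => f (y + s *: v)) (fun s => 'D_v f (y + s *: v)) 0 h h0.
  - move=> x; rewrite in_itv/= => /andP[x0 xh]; apply: D.
    by rewrite (ger0_norm (ltW x0)) (ger0_norm h0) ltW.
  - apply: derivable_within_continuous => x; rewrite in_itv/= => /andP[x0 xh].
    by have [|] := D x; rewrite ?ger0_norm.
  - rewrite in_itv/= => /andP[t0 th] E; exists t; first by rewrite !ger0_norm.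
    by rewrite f0 E subr0 mulrC.
have [||t] := @MVT_segment R (fun s => f (y + s *: v)) (fun s => 'D_v f (y + s *: v)) h 0 h0.
- move=> x; rewrite in_itv/= => /andP[x0 xh]; apply: D.
  by rewrite (ler0_norm (ltW xh)) (ler0_norm h0) lerN2 ltW.
- apply: derivable_within_continuous => x; rewrite in_itv/= => /andP[x0 xh].
  by have [|] := D x; rewrite ?ler0_norm ?lerN2.
- rewrite in_itv/= => /andP[t0 th] E; exists t; first by rewrite !ler0_norm ?lerN2.
  by rewrite f0 -opprB E sub0r mulrN opprK mulrC.
Qed.

Lemma derivable_eps f x v : derivable f x v -> forall e : R, 0 < e -> exists2 d : R, 0 < d &
  forall h : R, `|h| < d -> `|f (x + h *: v) - f x - h * 'D_v f x| <= e * `|h|.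
Proof.
move=> fd e e0.
have : (fun h : R => h^-1 *: (f (h *: v + x) - f x)) @ 0^' --> 'D_v f x by exact: fd.
move=> /cvgrPdist_le /(_ e e0) /nbhs_ballP[d d0 Hd]; exists d => // h hd.
have [->|hn0] := eqVneq h 0; first by rewrite scale0r addr0 subrr mul0r subrr normr0 mulr0.
have := Hd h; rewrite /ball/= sub0r normrN => /(_ hd hn0) H.
rewrite (_ : _ - _ - _ = - h * ('D_v f x - h^-1 * (f (h *: v + x) - f x))).
  by rewrite normrM normrN mulrC ler_wpM2r.
by rewrite (addrC x); field.
Qed.

Lemma R4_continuousP f x : {for x, continuous f} <->
  forall e : R, 0 < e -> exists2 d : R, 0 < d & forall y, `|y - x| < d -> `|f y - f x| < e.
Proof.
split=> [fc e e0|H].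
  have /cvgrPdist_lt/(_ e e0)/nbhs_R4P[d d0 Hd] := fc.
  by exists d => // y /Hd; rewrite distrC.
apply/cvgrPdist_lt => e e0; have [d d0 Hd] := H e e0.
by apply/nbhs_R4P; exists d => // y /Hd; rewrite distrC.
Qed.

Lemma norm_lin_le (u v : R4 R) (s t h : R) : `|s| <= h -> `|t| <= h ->
  `|s *: u + t *: v| <= h * (`|u| + `|v|).
Proof.
move=> sh th; apply: le_trans (ler_normD _ _) _; rewrite !normrZ mulrDr.
by apply: lerD; rewrite ler_wpM2r.
Qed.

(** In [deriveDv], [p], [q], [w] are the values at [x + h (u + v)], [x + h u], [x]; [A], [B], [C]
    are the derivatives at [x] along [u + v], [u], [v], and [C'] is that along [v] at an
    intermediate point. *)
Lemma increment_arith (A B C C' p q w h e : R) : 0 < h ->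
  `|p - w - h * A| <= e / 3 * h -> `|q - w - h * B| <= e / 3 * h ->
  p - q = h * C' -> `|C' - C| < e / 3 -> `|A - (B + C)| <= e.
Proof.
move=> h0 k1 k2 E k3; rewrite -(ler_pM2l h0).
have : `|h * (C' - C)| <= h * (e / 3) by rewrite normrM (ger0_norm (ltW h0)) ler_pM2l// ltW.
have -> : h * `|A - (B + C)| = `|h * (A - (B + C))| by rewrite normrM (ger0_norm (ltW h0)).
move: k1 k2 {k3}; rewrite !ler_norml => /andP[? ?] /andP[? ?] /andP[? ?].
by apply/andP; split; lra.
Qed.

(** Existence of directional derivatives does not make them additive. The increment along [u + v] is
    split into a step along [u] and one along [v]; continuity of ['D_v f] moves the second back to
    [x]. *)
Lemma deriveDv f U x (u v : R4 R) : open U -> U x ->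
  (forall y w, U y -> derivable f y w) -> {for x, continuous ('D_v f)} ->
  'D_(u + v) f x = 'D_u f x + 'D_v f x.
Proof.
move=> Uo Ux fd fc; apply/eqP; rewrite -subr_eq0 -normr_le0; apply/ler_addgt0Pl => e e0; rewrite addr0.
have e3 : 0 < e / 3 by rewrite divr_gt0.
have [d1 d10 H1] := derivable_eps (fd x (u + v) Ux) e3.
have [d2 d20 H2] := derivable_eps (fd x u Ux) e3.
have /R4_continuousP/(_ _ e3)[d3 d30 H3] := fc.
have /nbhs_R4P[d4 d40 H4] : nbhs x U by exact: open_nbhs_nbhs.
pose N := `|u| + `|v| + 1; have N0 : 0 < N by rewrite ltr_wpDl// addr_ge0.
pose h := Num.min (Num.min (d1 / 2) (d2 / 2)) (Num.min (d3 / (2 * N)) (d4 / (2 * N))).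
have h0 : 0 < h by rewrite !lt_min !divr_gt0 ?mulr_gt0.
have : [/\ h <= d1 / 2, h <= d2 / 2, h <= d3 / (2 * N) & h <= d4 / (2 * N)].
  by rewrite !ge_min !lexx !orbT.
rewrite !ler_pdivlMr ?mulr_gt0// => -[h1 h2 h3 h4].
have habs : `|h| = h by rewrite ger0_norm// ltW.
have hN : 0 < h * N by rewrite mulr_gt0.
have hN3 : h * N <= d3 by move: hN h3; clear; lra.
have near_x (s t : R) : `|s| <= h -> `|t| <= h -> `|x + s *: u + t *: v - x| < h * N.
  move=> sh th; rewrite (_ : _ - x = s *: u + t *: v); last by rewrite -[x + _ + _]addrA [x + _]addrC addrK.
  apply: le_lt_trans (norm_lin_le u v sh th) _.
  by rewrite ltr_pM2l// /N ltrDl.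
have [|t th] := @mvt_line f (x + h *: u) v h.
  move=> s sh; apply: fd; apply: H4; apply: lt_le_trans (near_x h s _ _) _; rewrite ?habs//.
    by rewrite -habs.
  by lra.
rewrite habs in th.
have hd1 : `|h| < d1 by rewrite habs; lra.
have hd2 : `|h| < d2 by rewrite habs; lra.
have k1 := H1 h hd1; have k2 := H2 h hd2; rewrite habs in k1 k2.
have k3 : `|'D_v f (x + h *: u + t *: v) - 'D_v f x| < e / 3.
  by apply: H3; apply: (lt_le_trans (near_x h t _ th)); [rewrite habs|exact: hN3].
have -> : x + h *: u + h *: v = x + h *: (u + v) by rewrite scalerDr addrA.
move=> E; exact: (increment_arith h0 k1 k2 E k3).
Qed.

Lemma scale_arith (A B p w h c e : R) : 0 < h ->
  `|p - w - h * A| <= e / 2 * h -> `|p - w - h * c * B| <= e / 2 * h ->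
  `|A - c * B| <= e.
Proof.
move=> h0 k1 k2; rewrite -(ler_pM2l h0).
have -> : h * `|A - c * B| = `|h * (A - c * B)| by rewrite normrM (ger0_norm (ltW h0)).
move: k1 k2; rewrite !ler_norml => /andP[? ?] /andP[? ?].
by apply/andP; split; lra.
Qed.

Lemma deriveZv f x v (c : R) : derivable f x v -> derivable f x (c *: v) -> 'D_(c *: v) f x = c * 'D_v f x.
Proof.
move=> d1 d2.
have [->|c0] := eqVneq c 0; first by rewrite scale0r derive0 mul0r.
apply/eqP; rewrite -subr_eq0 -normr_le0; apply/ler_addgt0Pl => e e0; rewrite addr0.
have e3 : 0 < e / 2 by rewrite divr_gt0.
have cp : 0 < `|c| by rewrite normr_gt0.
have [k1 k10 H1] := derivable_eps d2 e3.
have [k2 k20 H2] := derivable_eps d1 (divr_gt0 e3 cp).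
pose h := Num.min (k1 / 2) (k2 / (2 * `|c|)).
have h0 : 0 < h by rewrite lt_min !divr_gt0 ?mulr_gt0.
have : [/\ h <= k1 / 2 & h <= k2 / (2 * `|c|)] by rewrite !ge_min !lexx !orbT.
rewrite !ler_pdivlMr ?mulr_gt0// => -[h1 h2].
have habs : `|h| = h by rewrite ger0_norm// ltW.
have hc : `|h * c| = h * `|c| by rewrite normrM habs.
have hcp : 0 < h * `|c| by rewrite mulr_gt0.
have hd1 : `|h| < k1 by rewrite habs; lra.
have hd2 : `|h * c| < k2 by rewrite hc; lra.
have m1 := H1 h hd1; have m2 := H2 (h * c) hd2; rewrite habs in m1; rewrite hc in m2.
rewrite scalerA in m1.
move: m1 m2; rewrite (_ : e / 2 / `|c| * (h * `|c|) = e / 2 * h); last first.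
  by field; rewrite gt_eqF.
by move=> m1 m2; exact: (scale_arith h0 m1 m2).
Qed.

(** This symmetry of the mixed second difference is what exchanges the two directions in
    [schwarz]. *)
Lemma second_difference_sym (a b c d : R) : a - b - (c - d) = a - c - (b - d).
Proof. by ring. Qed.

Lemma schwarz f U x (u v : R4 R) : open U -> U x ->
  (forall y w, U y -> derivable f y w) ->
  (forall y w, U y -> derivable ('D_u f) y w) ->
  (forall y w, U y -> derivable ('D_v f) y w) ->
  {for x, continuous ('D_u ('D_v f))} -> {for x, continuous ('D_v ('D_u f))} ->
  'D_u ('D_v f) x = 'D_v ('D_u f) x.
Proof.
move=> Uo Ux fd fud fvd c1 c2; apply/eqP; rewrite -subr_eq0 -normr_le0; apply/ler_addgt0Pl => e e0; rewrite addr0.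
have e2 : 0 < e / 2 by rewrite divr_gt0.
have /R4_continuousP/(_ _ e2)[d1 d10 H1] := c1.
have /R4_continuousP/(_ _ e2)[d2 d20 H2] := c2.
have /nbhs_R4P[d4 d40 H4] : nbhs x U by exact: open_nbhs_nbhs.
pose N := `|u| + `|v| + 1; have N0 : 0 < N by rewrite ltr_wpDl// addr_ge0.
pose h := Num.min (d1 / N) (Num.min (d2 / N) (d4 / N)).
have h0 : 0 < h by rewrite !lt_min !divr_gt0.
have : [/\ h <= d1 / N, h <= d2 / N & h <= d4 / N].
  by rewrite !ge_min !lexx !orbT.
rewrite !ler_pdivlMr// => -[h1 h2 h4].
have habs : `|h| = h by rewrite ger0_norm// ltW.
have hh : `|h| <= h by rewrite habs.
have near_x (s t : R) : `|s| <= h -> `|t| <= h -> `|x + s *: u + t *: v - x| < h * N.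
  move=> sh th; rewrite (_ : _ - x = s *: u + t *: v); last by rewrite -[x + _ + _]addrA [x + _]addrC addrK.
  apply: le_lt_trans (norm_lin_le u v sh th) _.
  by rewrite ltr_pM2l// /N ltrDl.
have inU (s t : R) : `|s| <= h -> `|t| <= h -> U (x + s *: u + t *: v).
  by move=> sh th; apply: H4; apply: lt_le_trans (near_x _ _ sh th) _.
have zero_h : `|0 : R| <= h by rewrite normr0 ltW.
(* the mixed second difference, expanded with the mean value theorem in one
   direction and then in the other *)
have key (p q : R4 R) : (forall s t : R, `|s| <= h -> `|t| <= h -> U (x + s *: p + t *: q)) ->
    (forall y w, U y -> derivable ('D_p f) y w) ->
    exists s t : R, [/\ `|s| <= h, `|t| <= h &
    f (x + h *: p + h *: q) - f (x + h *: p) - (f (x + h *: q) - f x)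
    = h * (h * 'D_q ('D_p f) (x + s *: p + t *: q))].
  move=> inpq fpd.
  pose phi (s : R) := f ((x + h *: q) + s *: p) - f (x + s *: p).
  pose dphi (s : R) := 'D_p f ((x + h *: q) + s *: p) - 'D_p f (x + s *: p).
  have phid (s : R) : `|s| <= h -> is_derive s 1 phi (dphi s).
    move=> sh; apply: is_deriveB; apply: is_derive_line; apply: fd.
      by rewrite addrAC; exact: inpq.
    by have := inpq s 0 sh zero_h; rewrite scale0r addr0.
  have [s] : exists2 s : R, s \in `[0, h]%R & phi h - phi 0 = dphi s * (h - 0).
    apply: MVT_segment; first exact: ltW.
      by move=> s; rewrite in_itv/= => /andP[/ltW ? /ltW ?]; apply: phid; rewrite ger0_norm.
    apply: derivable_within_continuous => s; rewrite in_itv/= => /andP[? ?].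
    by have [|] := phid s; rewrite ?ger0_norm.
  rewrite in_itv/= => /andP[s0 sh] Es.
  have sh' : `|s| <= h by rewrite ger0_norm.
  have [t' th'|t th Et] := @mvt_line ('D_p f) (x + s *: p) q h.
    by apply: fpd; apply: inpq => //; rewrite -habs.
  exists s, t; split => //; first by rewrite -habs.
  have <- : phi h - phi 0 = f (x + h *: p + h *: q) - f (x + h *: p) - (f (x + h *: q) - f x).
    by rewrite /phi !scale0r !addr0 (addrAC x (h *: q)).
  by rewrite Es subr0 mulrC /dphi (addrAC x (h *: q)) Et.
have [s [t [sh th E1]]] := key u v inU fud.
have [t' [s' [th' sh' E2]]] := key v u (fun s t sh th => eq_ind_r U (inU t s th sh) (addrAC x _ _)) fvd.
have k1 : `|'D_u ('D_v f) (x + s' *: u + t' *: v) - 'D_u ('D_v f) x| < e / 2.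
  by apply: H1; apply: lt_le_trans (near_x _ _ sh' th') _.
have k2 : `|'D_v ('D_u f) (x + s *: u + t *: v) - 'D_v ('D_u f) x| < e / 2.
  by apply: H2; apply: lt_le_trans (near_x _ _ sh th) _.
have E : 'D_u ('D_v f) (x + s' *: u + t' *: v) = 'D_v ('D_u f) (x + s *: u + t *: v).
  have : h * (h * 'D_u ('D_v f) (x + s' *: u + t' *: v)) = h * (h * 'D_v ('D_u f) (x + s *: u + t *: v)).
    rewrite (addrAC x (t' *: v)) (addrAC x (h *: v)) in E2.
    by apply: (etrans (esym E2)); apply: etrans E1; exact: second_difference_sym.
  by move=> /(mulfI (lt0r_neq0 h0)) /(mulfI (lt0r_neq0 h0)).
rewrite E in k1; move: k1 k2; clear.
generalize ('D_v ('D_u f) (x + s *: u + t *: v)) ('D_u ('D_v f) x) ('D_v ('D_u f) x) => a b c.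
by rewrite !ltr_norml ler_norml => /andP[? ?] /andP[? ?]; apply/andP; split; lra.
Qed.

End RealCalculus.

(** * Smooth functions and Wirtinger derivatives *)

Section Smooth.
Variable R : realType.
Variable U : set (R4 R).
Hypothesis Uo : open U.
Implicit Types (f g : R4 R -> R) (G H : R4 R -> R[i]).

Lemma smooth_derivable f x v : smooth_on f U -> U x -> derivable f x v.
Proof. by move=> /(_ [::])[_]; apply. Qed.

Lemma smooth_D f v : smooth_on f U -> smooth_on ('D_v f) U.
Proof.
move=> fs vs; have E : Defs.iterD (rcons vs v) f = Defs.iterD vs ('D_v f) by exact: foldr_rcons.
by have := fs (rcons vs v); rewrite E.
Qed.

Lemma smooth_continuous f x : smooth_on f U -> U x -> {for x, continuous f}.
Proof. by move=> /(_ [::])[+ _]; apply. Qed.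

Lemma near_open x (P : R4 R -> Prop) : U x -> (forall y, U y -> P y) -> \forall y \near x, P y.
Proof.
move=> Ux H; have : nbhs x U by exact: open_nbhs_nbhs.
by apply: filterS.
Qed.

Lemma derive_ext f g x v : U x -> (forall y, U y -> f y = g y) -> 'D_v f x = 'D_v g x.
Proof. by move=> Ux fg; apply: near_eq_derive; exact: near_open. Qed.

Lemma smooth_lin f g a b : smooth_on f U -> smooth_on g U ->
  smooth_on (fun x => a * f x + b * g x) U.
Proof.
move=> fs gs.
have E vs x : U x -> Defs.iterD vs (fun x => a * f x + b * g x) x = a * Defs.iterD vs f x + b * Defs.iterD vs g x.
  elim: vs x => [//|v vs IH] x Ux /=.
  rewrite (derive_ext v Ux IH).
  rewrite (@deriveD _ _ _ (fun x => a * Defs.iterD vs f x) (fun x => b * Defs.iterD vs g x)).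
  - rewrite (@deriveZ _ _ _ (Defs.iterD vs f) a); last by have [_] := fs vs; apply.
    by rewrite (@deriveZ _ _ _ (Defs.iterD vs g) b)//; have [_] := gs vs; apply.
  - by apply: (@derivableZ _ _ _ (Defs.iterD vs f)); have [_] := fs vs; apply.
  - by apply: (@derivableZ _ _ _ (Defs.iterD vs g)); have [_] := gs vs; apply.
move=> vs; split=> [x Ux|x v Ux].
  have fc : {for x, continuous (Defs.iterD vs f)} by have [+ _] := fs vs; apply.
  have gc : {for x, continuous (Defs.iterD vs g)} by have [+ _] := gs vs; apply.
  have lc : {for x, continuous (fun x => a * Defs.iterD vs f x + b * Defs.iterD vs g x)}.
    apply: (@continuousD _ _ _ (fun x => a * Defs.iterD vs f x) (fun x => b * Defs.iterD vs g x)).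
      by apply: (@continuousM _ _ (fun=> a)) => //; exact: cst_continuous.
    by apply: (@continuousM _ _ (fun=> b)) => //; exact: cst_continuous.
  apply: (cvg_trans _ (_ : (fun x => a * Defs.iterD vs f x + b * Defs.iterD vs g x) @ x --> _)).
    by apply: near_eq_cvg; apply: near_open => // y Uy; rewrite E.
  by rewrite E//; exact: lc.
apply: (near_eq_derivable (f := fun x => a * Defs.iterD vs f x + b * Defs.iterD vs g x)).
  by apply: near_open => // y Uy; rewrite E.
apply: (@derivableD _ _ _ (fun x => a * Defs.iterD vs f x) (fun x => b * Defs.iterD vs g x)).
  by apply: (@derivableZ _ _ _ (Defs.iterD vs f)); have [_] := fs vs; apply.
by apply: (@derivableZ _ _ _ (Defs.iterD vs g)); have [_] := gs vs; apply.
Qed.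

Lemma derive_lin f g a b v x : smooth_on f U -> smooth_on g U -> U x ->
  'D_v (fun x => a * f x + b * g x) x = a * 'D_v f x + b * 'D_v g x.
Proof.
move=> fs gs Ux.
have df : derivable f x v by exact: smooth_derivable.
have dg : derivable g x v by exact: smooth_derivable.
rewrite (@deriveD _ _ _ (fun x => a * f x) (fun x => b * g x)).
- by rewrite (@deriveZ _ _ _ f a _ _ df) (@deriveZ _ _ _ g b _ _ dg).
- exact: (@derivableZ _ _ _ f).
- exact: (@derivableZ _ _ _ g).
Qed.

Lemma smooth_schwarz f u v x : smooth_on f U -> U x -> 'D_u ('D_v f) x = 'D_v ('D_u f) x.
Proof.
move=> fs Ux; apply: (schwarz Uo Ux) => [y w Uy|y w Uy|y w Uy||].
- exact: smooth_derivable.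
- exact: (@smooth_derivable ('D_u f) y w (smooth_D u fs) Uy).
- exact: (@smooth_derivable ('D_v f) y w (smooth_D v fs) Uy).
- exact: (@smooth_continuous ('D_u ('D_v f)) x (smooth_D u (smooth_D v fs)) Ux).
- exact: (@smooth_continuous ('D_v ('D_u f)) x (smooth_D v (smooth_D u fs)) Ux).
Qed.

Lemma smooth_Dv f x (v : R4 R) : smooth_on f U -> U x ->
  'D_v f x = v.1.1 * 'D_(@ex1 R) f x + v.1.2 * 'D_(@ey1 R) f x
    + v.2.1 * 'D_(@ex2 R) f x + v.2.2 * 'D_(@ey2 R) f x.
Proof.
move=> fs Ux.
have D (u w : R4 R) : 'D_(u + w) f x = 'D_u f x + 'D_w f x.
  have fd y z : U y -> derivable f y z by move=> Uy; exact: smooth_derivable.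
  have fc := @smooth_continuous ('D_w f) x (smooth_D w fs) Ux.
  exact: (@deriveDv R f U x u w Uo Ux fd fc).
have Z (c : R) (w : R4 R) : 'D_(c *: w) f x = c * 'D_w f x.
  by apply: deriveZv; exact: smooth_derivable.
have {1}-> : v = v.1.1 *: @ex1 R + v.1.2 *: @ey1 R + v.2.1 *: @ex2 R + v.2.2 *: @ey2 R.
  case: v => [[a b] [c d]]; rewrite /ex1 /ey1 /ex2 /ey2 /=.
  rewrite [RHS](_ : _ = ((a * 1 + b * 0 + c * 0 + d * 0, a * 0 + b * 1 + c * 0 + d * 0),
                         (a * 0 + b * 0 + c * 1 + d * 0, a * 0 + b * 0 + c * 0 + d * 1)))//.
  by rewrite !mulr0 !mulr1 !addr0 !add0r.
by rewrite !D !Z.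
Qed.

Definition csmooth G : Prop :=
  smooth_on (fun x => complex.Re (G x)) U /\ smooth_on (fun x => complex.Im (G x)) U.

(* [s = -1] gives d/dz and [s = 1] gives d/dzbar. *)
Definition wirt (s : R) (u v : R4 R) (G : R4 R -> R[i]) : R4 R -> R[i] :=
  fun x => (cD u G x + (s%:C)%C * 'i%C * cD v G x) / 2%:R.

Lemma Re_wirtx s u v G x : complex.Re (wirt s u v G x) =
  1/2 * 'D_u (fun y => complex.Re (G y)) x + - s / 2 * 'D_v (fun y => complex.Im (G y)) x.
Proof.
rewrite /wirt /cD.
set a := 'D_u _ x; set b := 'D_u _ x; set c := 'D_v _ x; set d := 'D_v _ x.
by clearbody a b c d => /=; field.
Qed.

Lemma Re_wirt s u v G : (fun x => complex.Re (wirt s u v G x)) =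
  (fun x => 1/2 * 'D_u (fun y => complex.Re (G y)) x
            + - s / 2 * 'D_v (fun y => complex.Im (G y)) x).
Proof.
by apply/funext => x; exact: Re_wirtx.
Qed.

Lemma Im_wirtx s u v G x : complex.Im (wirt s u v G x) =
  1/2 * 'D_u (fun y => complex.Im (G y)) x + s / 2 * 'D_v (fun y => complex.Re (G y)) x.
Proof.
rewrite /wirt /cD.
set a := 'D_u _ x; set b := 'D_u _ x; set c := 'D_v _ x; set d := 'D_v _ x.
by clearbody a b c d => /=; field.
Qed.

Lemma Im_wirt s u v G : (fun x => complex.Im (wirt s u v G x)) =
  (fun x => 1/2 * 'D_u (fun y => complex.Im (G y)) x
            + s / 2 * 'D_v (fun y => complex.Re (G y)) x).
Proof.
by apply/funext => x; exact: Im_wirtx.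
Qed.

Lemma csmooth_wirt s u v G : csmooth G -> csmooth (wirt s u v G).
Proof.
move=> [g1 g2]; split.
  by rewrite Re_wirt; exact: (smooth_lin _ _ (smooth_D u g1) (smooth_D v g2)).
by rewrite Im_wirt; exact: (smooth_lin _ _ (smooth_D u g2) (smooth_D v g1)).
Qed.

Lemma wirt_ext s u v G H x : U x -> (forall y, U y -> G y = H y) ->
  wirt s u v G x = wirt s u v H x.
Proof.
move=> Ux GH; rewrite /wirt /cD.
rewrite (derive_ext u Ux (fun y Uy => congr1 (@complex.Re R) (GH y Uy))).
rewrite (derive_ext u Ux (fun y Uy => congr1 (@complex.Im R) (GH y Uy))).
rewrite (derive_ext v Ux (fun y Uy => congr1 (@complex.Re R) (GH y Uy))).
by rewrite (derive_ext v Ux (fun y Uy => congr1 (@complex.Im R) (GH y Uy))).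
Qed.

Lemma eqc (z w : R[i]) : complex.Re z = complex.Re w -> complex.Im z = complex.Im w -> z = w.
Proof. by case: z w => [a b] [c d] /= -> ->. Qed.

(** The real part of the commutation of two Wirtinger operators, with [r] and [m] the real and
    imaginary parts. The imaginary part is the same identity with [r] and [m] exchanged and [s], [t]
    negated. The derivation is kept abstract, leaving only its linearity and commutation. *)
Lemma first_order_comm (D : R4 R -> (R4 R -> R) -> R4 R -> R) (S : (R4 R -> R) -> Prop)
    (u v p q x : R4 R) (s t : R) (r m : R4 R -> R) :
  (forall w f, S f -> S (D w f)) ->
  (forall f g a b w, S f -> S g ->
     D w (fun y => a * f y + b * g y) x = a * D w f x + b * D w g x) ->
  (forall w z f, S f -> D w (D z f) x = D z (D w f) x) ->
  S r -> S m ->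
  1/2 * D u (fun y => 1/2 * D p r y + - t / 2 * D q m y) x
    + - s / 2 * D v (fun y => 1/2 * D p m y + t / 2 * D q r y) x
  = 1/2 * D p (fun y => 1/2 * D u r y + - s / 2 * D v m y) x
    + - t / 2 * D q (fun y => 1/2 * D u m y + s / 2 * D v r y) x.
Proof.
move=> SD L C Sr Sm.
rewrite !L; try exact: SD.
by rewrite (C u p r Sr) (C u q m Sm) (C v p m Sm) (C v q r Sr); field.
Qed.

Lemma derive2_congr (u v x : R4 R) (a b : R) (f f' g g' : R4 R -> R) : f = f' -> g = g' ->
  a * 'D_u f x + b * 'D_v g x = a * 'D_u f' x + b * 'D_v g' x.
Proof. by move=> -> ->. Qed.

Lemma wirt_comm s u v t p q G x : csmooth G -> U x ->
  wirt s u v (wirt t p q G) x = wirt t p q (wirt s u v G) x.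
Proof.
move=> [g1 g2] Ux.
pose D (w : R4 R) f : R4 R -> R := 'D_w f; pose S f := smooth_on f U.
have SD w f : S f -> S (D w f) by exact: smooth_D.
have L f g a b w : S f -> S g -> D w (fun y => a * f y + b * g y) x = a * D w f x + b * D w g x.
  by move=> fs gs; exact: derive_lin.
have C w z f : S f -> D w (D z f) x = D z (D w f) x.
  by move=> fs; exact: smooth_schwarz.
have E1 := first_order_comm u v p q s t SD L C g1 g2.
have E2 := first_order_comm u v p q (- s) (- t) SD L C g2 g1.
rewrite !opprK in E2.
apply: eqc.
  exact: (etrans (etrans (Re_wirtx s u v _ x) (derive2_congr u v x (1/2) (- s / 2)
     (Re_wirt t p q G) (Im_wirt t p q G))) (etrans E1 (esym (etrans (Re_wirtx t p q _ x)
     (derive2_congr p q x (1/2) (- t / 2) (Re_wirt s u v G) (Im_wirt s u v G)))))).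
exact: (etrans (etrans (Im_wirtx s u v _ x) (derive2_congr u v x (1/2) (s / 2)
   (Im_wirt t p q G) (Re_wirt t p q G))) (etrans E2 (esym (etrans (Im_wirtx t p q _ x)
   (derive2_congr p q x (1/2) (t / 2) (Im_wirt s u v G) (Re_wirt s u v G)))))).
Qed.

End Smooth.

(** * Jets and Taylor's formula at the origin *)

Section Jets.
Variable R : realType.
Local Notation jet := (nat -> nat -> nat -> nat -> C2 R -> R[i]).

(* [G a1 a2 b1 b2] plays the role of the Wirtinger derivative of order (a1, a2; b1, b2)
   of [G 0 0 0 0]; the second clause is the chain rule along the ray through [z]. *)
Definition is_jet (G : jet) (d : R) : Prop :=
  (forall a1 a2 b1 b2, exists M e : R, 0 < e /\
     forall z, nrm2 z < e -> cabs (G a1 a2 b1 b2 z) <= M) /\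
  (forall a1 a2 b1 b2 z (s : R), nrm2 z < d -> 0 <= s <= 1 ->
    rder (fun t : R => G a1 a2 b1 b2 ((t%:C)%C *: z)) s
      (z.1 * G a1.+1 a2 b1 b2 ((s%:C)%C *: z) + z.2 * G a1 a2.+1 b1 b2 ((s%:C)%C *: z)
       + conjc z.1 * G a1 a2 b1.+1 b2 ((s%:C)%C *: z)
       + conjc z.2 * G a1 a2 b1 b2.+1 ((s%:C)%C *: z))).

Lemma rder_bound (F f : R -> R[i]) (K : R) :
  (forall s : R, 0 <= s <= 1 -> rder F s (f s)) ->
  (forall s : R, 0 <= s <= 1 -> cabs (f s) <= K) -> cabs (F 1 - F 0) <= 2 * K.
Proof.
move=> Fd fK; apply: le_trans (cabs_le_ReIm _) _.
have h1 : `|complex.Re (F 1) - complex.Re (F 0)| <= K * (1 - 0).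
  apply: (@derive_bound _ (fun s => complex.Re (F s)) (fun s => complex.Re (f s)) 0 1 K) => //.
    by move=> s /Fd[].
  by move=> s /fK; apply: le_trans; exact: Re_le_cabs.
have h2 : `|complex.Im (F 1) - complex.Im (F 0)| <= K * (1 - 0).
  apply: (@derive_bound _ (fun s => complex.Im (F s)) (fun s => complex.Im (f s)) 0 1 K) => //.
    by move=> s /Fd[].
  by move=> s /fK; apply: le_trans; exact: Im_le_cabs.
by move: h1 h2; case: (F 1) (F 0) => [a b] [c d] /=; lra.
Qed.

(** Induction on [K]: along the ray through [z] the derivative is a sum of four products of a
    coordinate of [z], or its conjugate, with a member of the next order, which is flat to one order
    less. The mean value bound then recovers the lost power of [|z|]. *)
Lemma jet_flat (G : jet) (d : R) (K : nat) : 0 < d -> is_jet G d -> forall a1 a2 b1 b2,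
  (forall i j k l, (i + j + k + l < K)%N -> G (a1 + i)%N (a2 + j)%N (b1 + k)%N (b2 + l)%N 0 = 0) ->
  exists C e : R, [/\ 0 <= C, 0 < e & forall z, nrm2 z < e -> cabs (G a1 a2 b1 b2 z) <= C * nrm2 z ^+ K].
Proof.
move=> d0 [Gb Gd]; elim: K => [|K IH] a1 a2 b1 b2 H0.
  have [M [e [e0 HM]]] := Gb a1 a2 b1 b2; exists M, e; split => //.
    apply: le_trans (HM 0 _); rewrite ?cabs_ge0//.
    by rewrite /nrm2 cabs0 maxxx.
  by move=> z /HM; rewrite expr0 mulr1.
have [|C1 [e1 [C10 e10 H1]]] := IH a1.+1 a2 b1 b2.
  by move=> i j k l ijk; rewrite addSnnS; apply: H0; rewrite !addSn.
have [|C2 [e2 [C20 e20 H2]]] := IH a1 a2.+1 b1 b2.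
  by move=> i j k l ijk; rewrite addSnnS; apply: H0; rewrite addnS !addSn.
have [|C3 [e3 [C30 e30 H3]]] := IH a1 a2 b1.+1 b2.
  by move=> i j k l ijk; rewrite addSnnS; apply: H0; rewrite addnS !addSn.
have [|C4 [e4 [C40 e40 H4]]] := IH a1 a2 b1 b2.+1.
  by move=> i j k l ijk; rewrite addSnnS; apply: H0; rewrite addnS.
exists (2 * (C1 + C2 + C3 + C4)), (Num.min d (Num.min (Num.min e1 e2) (Num.min e3 e4))); split.
- by rewrite mulr_ge0// !addr_ge0.
- by rewrite !lt_min d0 e10 e20 e30.
move=> z; rewrite !lt_min => /andP[zd /andP[/andP[z1 z2] /andP[z3 z4]]].
have G0 : G a1 a2 b1 b2 0 = 0 by have := H0 0%N 0%N 0%N 0%N; rewrite !addn0; apply.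
have := rder_bound (F := fun t => G a1 a2 b1 b2 ((t%:C)%C *: z))
  (K := (C1 + C2 + C3 + C4) * nrm2 z ^+ K.+1) (fun s => Gd a1 a2 b1 b2 z s zd).
rewrite scale0r G0 subr0 scale1r mulrA; apply=> s s01.
have sz : nrm2 ((s%:C)%C *: z) <= nrm2 z.
  rewrite nrm2Z cabs_real; move: s01 => /andP[s0 s1]; rewrite ger0_norm//.
  by rewrite ler_piMl// nrm2_ge0.
have T (c : R[i]) (A C e : R) g : 0 <= C -> cabs c <= nrm2 z -> nrm2 z < e ->
   (forall w, nrm2 w < e -> cabs (g w : R[i]) <= C * nrm2 w ^+ K) ->
   cabs (c * g ((s%:C)%C *: z)) <= C * nrm2 z ^+ K.+1.
  move=> C0 cz ze Hg; rewrite cabsM exprS mulrCA; apply: ler_pM; rewrite ?cabs_ge0//.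
  apply: le_trans (Hg _ (le_lt_trans sz ze)) _; rewrite ler_wpM2l//.
  by rewrite lerXn2r ?nnegrE ?nrm2_ge0.
rewrite !mulrDl.
apply: le_trans (cabsD _ _) _; apply: lerD; first (apply: le_trans (cabsD _ _) _;
  apply: lerD; first (apply: le_trans (cabsD _ _) _; apply: lerD)).
- exact: (T _ 0 _ _ _ C10 (nrm2_1 z) z1 H1).
- exact: (T _ 0 _ _ _ C20 (nrm2_2 z) z2 H2).
- by apply: (T _ 0 _ _ _ C30 _ z3 H3); rewrite cabs_conj nrm2_1.
- by apply: (T _ 0 _ _ _ C40 _ z4 H4); rewrite cabs_conj nrm2_2.
Qed.

Lemma jet_sub (G H : jet) d : is_jet G d -> is_jet H d ->
  is_jet (fun a1 a2 b1 b2 z => G a1 a2 b1 b2 z - H a1 a2 b1 b2 z) d.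
Proof.
move=> [Gb Gd] [Hb Hd]; split=> [a1 a2 b1 b2|a1 a2 b1 b2 z s zd s01].
  have [M [e [e0 HM]]] := Gb a1 a2 b1 b2; have [N [f [f0 HN]]] := Hb a1 a2 b1 b2.
  exists (M + N), (Num.min e f); split; first by rewrite lt_min e0.
  by move=> z; rewrite lt_min => /andP[/HM ? /HN ?]; apply: le_trans (cabsB _ _) _; apply: lerD.
have h1 := Gd a1 a2 b1 b2 z s zd s01; have h2 := rderM (-1) (Hd a1 a2 b1 b2 z s zd s01).
have := rderD h1 h2.
under eq_fun do rewrite mulN1r.
by congr (rder _ _ _); ring.
Qed.

Lemma jet0 d : is_jet (fun _ _ _ _ _ => 0) d.
Proof.
split=> [*|*]; first by exists 0, 1; split => // z _; rewrite cabs0.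
by rewrite !mulr0 !addr0; split; exact: is_derive_cst.
Qed.

Lemma jet_lin (c : R[i]) (G H : jet) d : is_jet G d -> is_jet H d ->
  is_jet (fun a1 a2 b1 b2 z => c * G a1 a2 b1 b2 z + H a1 a2 b1 b2 z) d.
Proof.
move=> [Gb Gd] [Hb Hd]; split=> [a1 a2 b1 b2|a1 a2 b1 b2 z s zd s01].
  have [M [e [e0 HM]]] := Gb a1 a2 b1 b2; have [N [f [f0 HN]]] := Hb a1 a2 b1 b2.
  exists (cabs c * M + N), (Num.min e f); split; first by rewrite lt_min e0.
  move=> z; rewrite lt_min => /andP[/HM ? /HN ?]; apply: le_trans (cabsD _ _) _.
  by apply: lerD => //; rewrite cabsM ler_wpM2l// cabs_ge0.
have h1 := rderM c (Gd a1 a2 b1 b2 z s zd s01); have h2 := Hd a1 a2 b1 b2 z s zd s01.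
have := rderD h1 h2.
by congr (rder _ _ _); ring.
Qed.

Lemma jet_sum (n : nat) (c : 'I_n -> R[i]) (G : 'I_n -> jet) d : (forall i, is_jet (G i) d) ->
  is_jet (fun a1 a2 b1 b2 z => \sum_i c i * G i a1 a2 b1 b2 z) d.
Proof.
elim: n c G => [|n IH] c G Gj.
  rewrite (_ : (fun a1 a2 b1 b2 z => _) = (fun _ _ _ _ _ => 0)); first exact: jet0.
  by do 5!apply/funext => ?; rewrite big_ord0.
rewrite (_ : (fun a1 a2 b1 b2 z => _) = (fun a1 a2 b1 b2 z => c ord0 * G ord0 a1 a2 b1 b2 z +
   \sum_(i < n) c (lift ord0 i) * G (lift ord0 i) a1 a2 b1 b2 z)).
  by apply: jet_lin => //; exact: (IH (fun i => c (lift ord0 i)) (fun i => G (lift ord0 i))).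
by do 5!apply/funext => ?; rewrite big_ord_recl.
Qed.

Lemma rder_mul (F G : R -> R[i]) x l m : rder F x l -> rder G x m ->
  rder (fun t => F t * G t) x (l * G x + F x * m).
Proof.
move=> [f1 f2] [g1 g2]; split.
  have h := is_deriveB (is_deriveM f1 g1) (is_deriveM f2 g2).
  rewrite (_ : complex.Re _ = complex.Re (F x) *: complex.Re m + complex.Re (G x) *: complex.Re l -
     (complex.Im (F x) *: complex.Im m + complex.Im (G x) *: complex.Im l)).
    by rewrite (_ : (fun t => _) = (fun t => complex.Re (F t) * complex.Re (G t) -
       complex.Im (F t) * complex.Im (G t)))//; apply/funext => t; case: (F t) (G t) => [? ?] [? ?].
  case: (F x) (G x) l m {f1 f2 g1 g2 h} => [a b] [c d] [e f] [g h] /=.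
  by rewrite /GRing.scale/=; ring.
have h := is_deriveD (is_deriveM f1 g2) (is_deriveM f2 g1).
rewrite (_ : complex.Im _ = complex.Re (F x) *: complex.Im m + complex.Im (G x) *: complex.Re l +
   (complex.Im (F x) *: complex.Re m + complex.Re (G x) *: complex.Im l)).
  by rewrite (_ : (fun t => _) = (fun t => complex.Re (F t) * complex.Im (G t) +
     complex.Im (F t) * complex.Re (G t)))//; apply/funext => t; case: (F t) (G t) => [? ?] [? ?].
case: (F x) (G x) l m {f1 f2 g1 g2 h} => [a b] [c d] [e f] [g h] /=.
by rewrite /GRing.scale/=; ring.
Qed.

(** The a-th derivative of [z ^+ n]. For [a > n] the falling factorial is 0, so the truncated
    exponent is harmless. *)
Definition fpow (n a : nat) (z : R[i]) : R[i] := (n ^_ a)%:R * z ^+ (n - a).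

Lemma rder_expr (z : R[i]) n (s : R) :
  rder (fun t : R => ((t%:C)%C * z) ^+ n) s (n%:R * z * ((s%:C)%C * z) ^+ n.-1).
Proof.
have lin : rder (fun t : R => (t%:C)%C * z) s z.
  case: z => a b; split => /=.
    by under eq_fun do rewrite mul0r subr0; rewrite -[X in is_derive _ _ _ X]mulr1;
      under eq_fun do rewrite mulrC; exact: (@is_deriveZ _ _ _ _ a _ _ _ (is_derive_id _ _)).
  by under eq_fun do rewrite mul0r addr0; rewrite -[X in is_derive _ _ _ X]mulr1;
      under eq_fun do rewrite mulrC; exact: (@is_deriveZ _ _ _ _ b _ _ _ (is_derive_id _ _)).
elim: n => [|n IH].
  by rewrite !mul0r; split; exact: is_derive_cst.
have := rder_mul lin IH.
under eq_fun do rewrite -exprS.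
congr (rder _ _ _); rewrite /=; case: n {IH} => [|n]; first by rewrite expr0; ring.
by rewrite /= !exprS !mulrS; ring.
Qed.

Lemma rder_fpow (n a : nat) (z : R[i]) (s : R) :
  rder (fun t : R => fpow n a ((t%:C)%C * z)) s (z * fpow n a.+1 ((s%:C)%C * z)).
Proof.
have := rderM ((n ^_ a)%:R) (rder_expr z (n - a) s).
rewrite -/(fpow n a _); congr (rder _ _ _).
rewrite /fpow ffactnSr natrM subnS; ring.
Qed.

Lemma fpow0 n a : fpow n a 0 = (if n == a then a`!%:R else 0).
Proof.
rewrite /fpow; case: (ltngtP n a) => na.
- by rewrite ffact_small// mul0r.
- by rewrite expr0n subn_eq0 leqNgt na mulr0.
- by rewrite na subnn ffactnn expr0 mulr1.
Qed.

Lemma fpow_bound n a (z : R[i]) : cabs z <= 1 -> cabs (fpow n a z) <= (n ^_ a)%:R.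
Proof.
move=> z1; rewrite /fpow cabsM cabsX.
have -> : cabs ((n ^_ a)%:R : R[i]) = (n ^_ a)%:R.
  by rewrite -[(n ^_ a)%:R in LHS](rmorph_nat (real_complex R)) cabs_real ger0_norm.
by rewrite ler_piMr// exprn_ile1// cabs_ge0.
Qed.

(** All Wirtinger derivatives of a monomial in z and its conjugate, the conjugates being treated as
    independent variables. *)
Definition monomial_jet (m1 m2 n1 n2 : nat) : jet := fun a1 a2 b1 b2 z =>
  fpow m1 a1 z.1 * fpow m2 a2 z.2 * fpow n1 b1 (conjc z.1) * fpow n2 b2 (conjc z.2).

Lemma monomial_is_jet m1 m2 n1 n2 d : is_jet (monomial_jet m1 m2 n1 n2) d.
Proof.
split=> [a1 a2 b1 b2|a1 a2 b1 b2 z s _ _].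
  exists ((m1 ^_ a1)%:R * (m2 ^_ a2)%:R * (n1 ^_ b1)%:R * (n2 ^_ b2)%:R), 1; split => // z.
  rewrite nrm2_lt => /andP[/ltW z1 /ltW z2]; rewrite /monomial_jet 3!cabsM.
  have B n a w : cabs w <= 1 -> 0 <= cabs (fpow n a w) <= (n ^_ a)%:R.
    by move=> w1; rewrite cabs_ge0 fpow_bound.
  have M (x x' y y' : R) : 0 <= x <= x' -> 0 <= y <= y' -> 0 <= x * y <= x' * y'.
    by move=> /andP[h1 h2] /andP[h3 h4]; rewrite mulr_ge0//= ler_pM.
  have zc1 : cabs (conjc z.1) <= 1 by rewrite cabs_conj.
  have zc2 : cabs (conjc z.2) <= 1 by rewrite cabs_conj.
  by have /andP[] := M _ _ _ _ (M _ _ _ _ (M _ _ _ _ (B m1 a1 _ z1) (B m2 a2 _ z2))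
    (B n1 b1 _ zc1)) (B n2 b2 _ zc2).
have cj (t : R) (w : R[i]) : conjc ((t%:C)%C * w) = (t%:C)%C * conjc w.
  by case: w => a b; rewrite /GRing.mul/=; congr Complex; ring.
have H1 := rder_fpow m1 a1 z.1 s; have H2 := rder_fpow m2 a2 z.2 s.
have H3 := rder_fpow n1 b1 (conjc z.1) s; have H4 := rder_fpow n2 b2 (conjc z.2) s.
have := rder_mul (rder_mul (rder_mul H1 H2) H3) H4.
rewrite /monomial_jet /= -!cj; congr (rder _ _ _); first by apply/funext => t; rewrite !cj.
by ring.
Qed.

End Jets.

Section SmoothJet.
Variable R : realType.
Variable U : set (R4 R).
Hypothesis Uo : open U.
Hypothesis U0 : U 0.
Variable F : C2 R -> R.
Hypothesis Fs : smooth_on (realify F) U.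
Local Notation csmooth := (csmooth U).

Local Notation W1 := (wirt (-1) (@ex1 R) (@ey1 R)).
Local Notation W2 := (wirt (-1) (@ex2 R) (@ey2 R)).
Local Notation W3 := (wirt 1 (@ex1 R) (@ey1 R)).
Local Notation W4 := (wirt 1 (@ex2 R) (@ey2 R)).

(** The derivations come in the order of [taylor_coef]. [wder2], [wder3] and [wder4] bring a new
    derivation to its place by commutation, as the chain rule of [is_jet] requires. *)
Definition wder (a1 a2 b1 b2 : nat) : R4 R -> R[i] :=
  iter a1 W1 (iter a2 W2 (iter b1 W3 (iter b2 W4 (fun x => ((realify F x)%:C)%C)))).

Lemma iter_wirt_ext n s u v G H x : U x -> (forall y, U y -> G y = H y) ->
  iter n (wirt s u v) G x = iter n (wirt s u v) H x.
Proof.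
move=> Ux GH; elim: n x Ux => [|n IH] x Ux /=; first exact: GH.
exact: (wirt_ext Uo s u v Ux IH).
Qed.

Lemma csmooth_iter n s u v G : csmooth G -> csmooth (iter n (wirt s u v) G).
Proof. by move=> Gs; elim: n => [//|n IH] /=; exact: csmooth_wirt. Qed.

Lemma wirt_iter_comm n s u v t p q G x : csmooth G -> U x ->
  wirt s u v (iter n (wirt t p q) G) x = iter n (wirt t p q) (wirt s u v G) x.
Proof.
move=> Gs; elim: n x => [//|n IH] x Ux /=.
rewrite (wirt_comm Uo _ _ _ _ _ _ (csmooth_iter n t p q Gs) Ux).
exact: (wirt_ext Uo t p q Ux IH).
Qed.

Lemma csmooth_base : csmooth (fun x => ((realify F x)%:C)%C).
Proof.
split; first exact: Fs.
have := @smooth_lin _ _ Uo (realify F) (realify F) 1 (-1) Fs Fs.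
by rewrite (_ : (fun x => _) = (fun x => complex.Im ((realify F x)%:C)%C))//;
  apply/funext => x /=; rewrite mul1r mulN1r subrr.
Qed.

Lemma csmooth_wder a1 a2 b1 b2 : csmooth (wder a1 a2 b1 b2).
Proof. by do 4!apply: csmooth_iter; exact: csmooth_base. Qed.

Lemma wder2 a1 a2 b1 b2 x : U x -> W2 (wder a1 a2 b1 b2) x = wder a1 a2.+1 b1 b2 x.
Proof.
move=> Ux; have S : csmooth (iter a2 W2 (iter b1 W3 (iter b2 W4 (fun x => ((realify F x)%:C)%C)))).
  exact: (csmooth_iter _ _ _ _ (csmooth_iter _ _ _ _ (csmooth_iter _ _ _ _ csmooth_base))).
exact: (wirt_iter_comm a1 _ _ _ _ _ _ S Ux).
Qed.

Lemma wder3 a1 a2 b1 b2 x : U x -> W3 (wder a1 a2 b1 b2) x = wder a1 a2 b1.+1 b2 x.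
Proof.
move=> Ux; have S1 := csmooth_iter b1 1 (@ex1 R) (@ey1 R) (csmooth_iter b2 1 (@ex2 R) (@ey2 R) csmooth_base).
have S2 := csmooth_iter a2 (-1) (@ex2 R) (@ey2 R) S1.
apply: etrans (wirt_iter_comm a1 _ _ _ _ _ _ S2 Ux) _.
apply: (iter_wirt_ext _ _ _ _ Ux) => y Uy.
exact: (wirt_iter_comm a2 _ _ _ _ _ _ S1 Uy).
Qed.

Lemma wder4 a1 a2 b1 b2 x : U x -> W4 (wder a1 a2 b1 b2) x = wder a1 a2 b1 b2.+1 x.
Proof.
move=> Ux; have S0 := csmooth_iter b2 1 (@ex2 R) (@ey2 R) csmooth_base.
have S1 := csmooth_iter b1 1 (@ex1 R) (@ey1 R) S0.
have S2 := csmooth_iter a2 (-1) (@ex2 R) (@ey2 R) S1.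
apply: etrans (wirt_iter_comm a1 _ _ _ _ _ _ S2 Ux) _.
apply: (iter_wirt_ext _ _ _ _ Ux) => y Uy.
apply: etrans (wirt_iter_comm a2 _ _ _ _ _ _ S1 Uy) _.
apply: (iter_wirt_ext _ _ _ _ Uy) => w Uw.
exact: (wirt_iter_comm b1 _ _ _ _ _ _ S0 Uw).
Qed.

Lemma cD_wirt G x (z : C2 R) : csmooth G -> U x ->
  cD (ofC2 z) G x = z.1 * W1 G x + z.2 * W2 G x + conjc z.1 * W3 G x + conjc z.2 * W4 G x.
Proof.
move=> [g1 g2] Ux; rewrite /wirt /cD (smooth_Dv Uo (ofC2 z) g1 Ux) (smooth_Dv Uo (ofC2 z) g2 Ux).
move: ('D_(@ex1 R) _ x) ('D_(@ey1 R) _ x) ('D_(@ex2 R) _ x) ('D_(@ey2 R) _ x)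
  ('D_(@ex1 R) _ x) ('D_(@ey1 R) _ x) ('D_(@ex2 R) _ x) ('D_(@ey2 R) _ x).
case: z => [[z1 z2] [z3 z4]] a b c d e f g h.
by rewrite /ofC2 /=; apply: eqc => /=; field.
Qed.

Lemma wder_continuous_bound a1 a2 b1 b2 : exists M e : R, 0 < e /\
  forall z, nrm2 z < e -> cabs (wder a1 a2 b1 b2 (ofC2 z)) <= M.
Proof.
have := csmooth_wder a1 a2 b1 b2; move: (wder a1 a2 b1 b2) => G [g1 g2].
have /R4_continuousP/(_ 1 ltr01)[d d0 Hd] := smooth_continuous g1 U0.
have /R4_continuousP/(_ 1 ltr01)[e e0 He] := smooth_continuous g2 U0.
exists (`|complex.Re (G 0)| + 1 + (`|complex.Im (G 0)| + 1)), (Num.min d e).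
split; first by rewrite lt_min d0.
move=> z; rewrite lt_min => /andP[zd ze].
apply: le_trans (cabs_le_ReIm _) _; apply: lerD.
  have := Hd (ofC2 z); rewrite subr0 => /(_ (le_lt_trans (nrm_ofC2_le z) zd)) h.
  rewrite -(subrK (complex.Re (G 0)) (complex.Re (G (ofC2 z)))) addrC.
  by apply: le_trans (ler_normD _ _) _; rewrite lerD2l ltW.
have := He (ofC2 z); rewrite subr0 => /(_ (le_lt_trans (nrm_ofC2_le z) ze)) h.
rewrite -(subrK (complex.Im (G 0)) (complex.Im (G (ofC2 z)))) addrC.
by apply: le_trans (ler_normD _ _) _; rewrite lerD2l ltW.
Qed.

Lemma rder_ray G (v : R4 R) (s : R) : csmooth G -> U (s *: v) ->
  rder (fun t => G (t *: v)) s (cD v G (s *: v)).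
Proof.
move=> [g1 g2] Us.
have E : s *: v = 0 + s *: v by rewrite add0r.
have d1 : derivable (fun x => complex.Re (G x)) (0 + s *: v) v.
  by rewrite -E; exact: (@smooth_derivable _ _ (fun x => complex.Re (G x)) _ v g1 Us).
have d2 : derivable (fun x => complex.Im (G x)) (0 + s *: v) v.
  by rewrite -E; exact: (@smooth_derivable _ _ (fun x => complex.Im (G x)) _ v g2 Us).
have h1 := is_derive_line d1; have h2 := is_derive_line d2.
have E' : (fun t : R => (0 : R4 R) + t *: v) = (fun t : R => t *: v).
  by apply/funext => t; rewrite add0r.
rewrite /rder /cD E.
by split; [move: h1|move: h2];
   [rewrite (_ : (fun t : R => complex.Re (G (0 + t *: v))) = (fun t => complex.Re (G (t *: v))))//;
    apply/funext => t; rewrite add0r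
   |rewrite (_ : (fun t : R => complex.Im (G (0 + t *: v))) = (fun t => complex.Im (G (t *: v))))//;
    apply/funext => t; rewrite add0r].
Qed.

Lemma wder_is_jet : exists2 d : R, 0 < d &
  is_jet (fun a1 a2 b1 b2 z => wder a1 a2 b1 b2 (ofC2 z)) d.
Proof.
have /nbhs_R4P[d d0 Hd] : nbhs (0 : R4 R) U by exact: open_nbhs_nbhs.
exists d => //; split=> [|a1 a2 b1 b2 z s zd /andP[s0 s1]]; first exact: wder_continuous_bound.
have oZ (t : R) : ofC2 ((t%:C)%C *: z) = t *: ofC2 z.
  by case: z {zd} => [[a b] [c e]]; rewrite /ofC2 /= !mul0r !subr0 !addr0.
have Us : U (s *: ofC2 z).
  apply: Hd; rewrite subr0 normrZ ger0_norm//; apply: le_lt_trans zd.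
  apply: le_trans (nrm_ofC2_le z); rewrite ler_piMl//.
have Ws := csmooth_wder a1 a2 b1 b2.
have := rder_ray Ws Us; rewrite (cD_wirt z Ws Us) wder2// wder3// wder4// oZ.
by rewrite (_ : (fun t : R => wder a1 a2 b1 b2 (t *: ofC2 z)) =
   (fun t : R => wder a1 a2 b1 b2 (ofC2 ((t%:C)%C *: z))))//; apply/funext => t; rewrite oZ.
Qed.

Lemma dzE (u v : R4 R) (G : R4 R -> R[i]) : dz u v G = wirt (-1) u v G.
Proof.
apply/funext => x; rewrite /dz /wirt; move: (cD u G x) (cD v G x) => a b.
by congr (_ / _); rewrite rmorphN rmorph1 mulN1r mulNr.
Qed.

Lemma dzbE (u v : R4 R) (G : R4 R -> R[i]) : dzb u v G = wirt 1 u v G.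
Proof.
apply/funext => x; rewrite /dzb /wirt; move: (cD u G x) (cD v G x) => a b.
by rewrite rmorph1 mul1r.
Qed.

Lemma taylor_coefE a1 a2 b1 b2 : wder a1 a2 b1 b2 0 =
  taylor_coef F (a1, a2) (b1, b2) * (a1`! * a2`! * b1`! * b2`!)%N%:R.
Proof.
rewrite /taylor_coef mulfVK; last by rewrite pnatr_eq0 -lt0n !muln_gt0 !fact_gt0.
rewrite /wder /=.
have -> : dz (@ex1 R) (@ey1 R) = W1 by apply/funext => G; exact: dzE.
have -> : dz (@ex2 R) (@ey2 R) = W2 by apply/funext => G; exact: dzE.
have -> : dzb (@ex1 R) (@ey1 R) = W3 by apply/funext => G; exact: dzbE.
by have -> : dzb (@ex2 R) (@ey2 R) = W4 by apply/funext => G; exact: dzbE.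
Qed.

Definition taylor_poly (K : nat) (z : C2 R) : R[i] :=
  \sum_(a1 < K) \sum_(a2 < K) \sum_(b1 < K) \sum_(b2 < K)
    taylor_coef F (nat_of_ord a1, nat_of_ord a2) (nat_of_ord b1, nat_of_ord b2)
      * z.1 ^+ a1 * z.2 ^+ a2 * (conjc z.1) ^+ b1 * (conjc z.2) ^+ b2.

(** At 0, differentiating [a] times leaves only the monomial of exponent exactly [a]. *)
Lemma pick_fpow (K a : nat) (f : 'I_K -> R[i]) (g : nat -> R[i]) : (a < K)%N ->
  (forall i : 'I_K, f i = g i) ->
  \sum_(m < K) f m * fpow m a 0 = g a * a`!%:R.
Proof.
move=> aK fg; rewrite (bigD1 (Ordinal aK))//= big1 ?addr0 => [|i ia].
  by rewrite fpow0 eqxx fg.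
rewrite fpow0; case: eqP => [ea|]; last by rewrite mulr0.
by move: ia; rewrite -val_eqE /= ea eqxx.
Qed.

(** The jets of [F] and of its Taylor polynomial agree at 0 in all orders below [K], so [jet_flat]
    applies to their difference. The polynomial truncates each exponent separately and so also has
    terms of total degree at least [K], which do not affect these orders. *)
Theorem taylor_expansion (K : nat) : exists C e : R, [/\ 0 <= C, 0 < e & forall z, nrm2 z < e ->
  cabs (((F z)%:C)%C - taylor_poly K z) <= C * nrm2 z ^+ K].
Proof.
have [d d0 J] := wder_is_jet.
(* The factors [1 *] give each nested sum the shape of [jet_sum]. *)
pose P a1 a2 b1 b2 z := \sum_(m1 < K) 1 * \sum_(m2 < K) 1 * \sum_(n1 < K) 1 * \sum_(n2 < K)
   taylor_coef F (nat_of_ord m1, nat_of_ord m2) (nat_of_ord n1, nat_of_ord n2) *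
   @monomial_jet R m1 m2 n1 n2 a1 a2 b1 b2 z.
have PJ : is_jet P d.
  apply: (@jet_sum R K (fun=> 1) (fun m1 a1 a2 b1 b2 z => \sum_(m2 < K) 1 * \sum_(n1 < K) 1 *
   \sum_(n2 < K) taylor_coef F (nat_of_ord m1, nat_of_ord m2) (nat_of_ord n1, nat_of_ord n2) *
   @monomial_jet R m1 m2 n1 n2 a1 a2 b1 b2 z)) => m1.
  apply: (@jet_sum R K (fun=> 1) (fun m2 a1 a2 b1 b2 z => \sum_(n1 < K) 1 *
   \sum_(n2 < K) taylor_coef F (nat_of_ord m1, nat_of_ord m2) (nat_of_ord n1, nat_of_ord n2) *
   @monomial_jet R m1 m2 n1 n2 a1 a2 b1 b2 z)) => m2.
  apply: (@jet_sum R K (fun=> 1) (fun n1 a1 a2 b1 b2 z =>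
   \sum_(n2 < K) taylor_coef F (nat_of_ord m1, nat_of_ord m2) (nat_of_ord n1, nat_of_ord n2) *
   @monomial_jet R m1 m2 n1 n2 a1 a2 b1 b2 z)) => n1.
  apply: (@jet_sum R K (fun n2 => taylor_coef F (nat_of_ord m1, nat_of_ord m2) (nat_of_ord n1, nat_of_ord n2))
     (fun n2 a1 a2 b1 b2 z => @monomial_jet R m1 m2 n1 n2 a1 a2 b1 b2 z)) => n2.
  exact: monomial_is_jet.
have [|C [e [C0 e0 He]]] := @jet_flat R _ d K d0 (jet_sub J PJ) 0%N 0%N 0%N 0%N.
  move=> i j k l ijk; rewrite !add0n.
  have o0 : ofC2 (0 : C2 R) = 0 by [].
  rewrite o0 taylor_coefE; apply/eqP; rewrite subr_eq0; apply/eqP.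
  have [iK jK kK lK] : [/\ (i < K)%N, (j < K)%N, (k < K)%N & (l < K)%N].
    split; apply: leq_ltn_trans ijk.
    - by rewrite -!addnA leq_addr.
    - by rewrite [(i + j)%N]addnC -!addnA leq_addr.
    - by rewrite [(i + j + k)%N]addnC -!addnA leq_addr.
    - by rewrite leq_addl.
  pose t a b c d' := taylor_coef F (a, b) (c, d').
  rewrite /P.
  transitivity (\sum_(m1 < K) (t m1 j k l * j`!%:R * k`!%:R * l`!%:R) * fpow m1 i (0 : R[i])); last first.
    apply: eq_bigr => m1 _; rewrite mul1r.
    transitivity (\sum_(m2 < K) (t m1 m2 k l * fpow m1 i (0 : R[i]) * k`!%:R * l`!%:R) * fpow m2 j (0 : R[i])).
      rewrite (@pick_fpow K j _ (fun m2 => t m1 m2 k l * fpow m1 i (0 : R[i]) * k`!%:R * l`!%:R))//.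
      by ring.
    apply: eq_bigr => m2 _; rewrite mul1r.
    transitivity (\sum_(n1 < K) (t m1 m2 n1 l * fpow m1 i (0 : R[i]) * fpow m2 j (0 : R[i]) * l`!%:R) * fpow n1 k (0 : R[i])).
      rewrite (@pick_fpow K k _ (fun n1 => t m1 m2 n1 l * fpow m1 i (0 : R[i]) * fpow m2 j (0 : R[i]) * l`!%:R))//.
      by ring.
    apply: eq_bigr => n1 _; rewrite mul1r.
    transitivity (\sum_(n2 < K) (t m1 m2 n1 n2 * fpow m1 i (0 : R[i]) * fpow m2 j (0 : R[i]) * fpow n1 k (0 : R[i])) * fpow n2 l (0 : R[i])).
      rewrite (@pick_fpow K l _ (fun n2 => t m1 m2 n1 n2 * fpow m1 i (0 : R[i]) * fpow m2 j (0 : R[i]) * fpow n1 k (0 : R[i])))//.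
      by ring.
    apply: eq_bigr => n2 _; rewrite /monomial_jet /= oppr0 -/(0 : R[i]).
    by rewrite -![Complex 0 0]/(0 : R[i]) /t !mulrA.
  rewrite (@pick_fpow K i _ (fun m1 => t m1 j k l * j`!%:R * k`!%:R * l`!%:R))//.
  by rewrite !natrM /t; ring.
exists C, e; split => // z /He; rewrite /wder /= /realify /= ofC2K.
congr (cabs (_ - _) <= _); rewrite /P /taylor_poly.
apply: eq_bigr => m1 _; rewrite mul1r; apply: eq_bigr => m2 _; rewrite mul1r.
apply: eq_bigr => n1 _; rewrite mul1r; apply: eq_bigr => n2 _.
by rewrite /monomial_jet /fpow !ffactn0 !subn0 !mul1r !mulrA.
Qed.

End SmoothJet.

(** * Comparison of defining functions *)

Section Comparison.
Variable R : realType.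

Lemma open_toC2 (W : set (C2 R)) : open W -> open (@toC2 R @^-1` W).
Proof.
rewrite !openE => Wo x /Wo /nbhs_C2P[d d0 Hd].
apply/nbhs_R4P; exists (d / 2); first by rewrite divr_gt0.
move=> y yx; apply: Hd; rewrite -toC2B; apply: le_lt_trans (nrm2_toC2_le _) _.
by rewrite mulrC -ltr_pdivlMr.
Qed.

Lemma comp_le (x : R4 R) : [/\ `|x.1.1| <= `|x|, `|x.1.2| <= `|x|, `|x.2.1| <= `|x| & `|x.2.2| <= `|x| ].
Proof. by rewrite -nrm_R4E /nrm_R4 !le_max !lexx /= !orbT. Qed.

(** The mean value theorem on the segment from [y] to [z]: the derivative along [z - y] is a
    combination of the four partial derivatives, which continuity bounds near [x]. *)
Lemma smooth_lipschitz (U : set (R4 R)) (f : R4 R -> R) (x : R4 R) :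
  open U -> U x -> smooth_on f U ->
  exists L d : R, [/\ 0 <= L, 0 < d & forall y z, `|y - x| < d -> `|z - x| < d ->
    `|f z - f y| <= L * `|z - y|].
Proof.
move=> Uo Ux fs.
have B (v : R4 R) : exists M e : R, [/\ 0 <= M, 0 < e & forall y, `|y - x| < e -> `|'D_v f y| <= M].
  have /R4_continuousP/(_ 1 ltr01)[e e0 He] := @smooth_continuous _ _ ('D_v f) x (smooth_D v fs) Ux.
  exists (1 + `|'D_v f x|), e; split; [by rewrite addr_ge0|by []|move=> y /He /ltW h].
  rewrite -(subrK ('D_v f x) ('D_v f y)); apply: le_trans (ler_normD _ _) _.
  by rewrite lerD2r.
have [M1 [e1 [M10 e10 H1]]] := B (@ex1 R).
have [M2 [e2 [M20 e20 H2]]] := B (@ey1 R).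
have [M3 [e3 [M30 e30 H3]]] := B (@ex2 R).
have [M4 [e4 [M40 e40 H4]]] := B (@ey2 R).
have /nbhs_R4P[d d0 Hd] : nbhs x U by exact: open_nbhs_nbhs.
pose e := Num.min d (Num.min (Num.min e1 e2) (Num.min e3 e4)).
have e0 : 0 < e by rewrite !lt_min d0 e10 e20 e30.
(* The points used are within [e / 3 + 2 * e / 3] of [x], as [|z - y| < 2 * e / 3]. *)
exists (M1 + M2 + M3 + M4), (e / 3); split; [by rewrite !addr_ge0|by rewrite divr_gt0|].
move=> y z yx zx; pose v := z - y.
have near t : `|t| <= `|1 : R| -> `|y + t *: v - x| < e.
  rewrite normr1 => t1; rewrite (_ : y + t *: v - x = (y - x) + t *: v); last by rewrite addrAC.
  apply: le_lt_trans (ler_normD _ _) _; rewrite normrZ.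
  have : `|t| * `|v| <= `|v| by rewrite ler_piMl.
  have : `|v| <= `|z - x| + `|y - x|.
    rewrite /v (_ : z - y = (z - x) - (y - x)); first exact: ler_normB.
    by rewrite opprB addrA subrK.
  by move: yx zx; clear; move: `|_| `|_| `|_| => a b c; lra.
have inU t : `|t| <= `|1 : R| -> U (y + t *: v).
  by move=> /near; rewrite lt_min => /andP[/Hd].
have [|t t1 E] := @mvt_line _ f y v 1.
  by move=> s /inU Us; exact: (@smooth_derivable _ _ f _ v fs Us).
rewrite scale1r mul1r (_ : y + v = z) in E; last by rewrite /v addrC subrK.
rewrite E (smooth_Dv Uo v fs (inU _ t1)).
have := near _ t1; rewrite !lt_min => /andP[_ /andP[/andP[/H1 h1 /H2 h2] /andP[/H3 h3 /H4 h4]]].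
have [c1 c2 c3 c4] := comp_le v; rewrite -/v.
have T (a b M N : R) : `|a| <= N -> `|b| <= M -> `|a * b| <= M * N.
  by move=> h k; rewrite normrM mulrC ler_pM.
rewrite (_ : (M1 + M2 + M3 + M4) * `|v| = M1 * `|v| + M2 * `|v| + M3 * `|v| + M4 * `|v|);
  last by rewrite !mulrDl.
apply: le_trans (ler_normD _ _) _; apply: lerD; last exact: (T _ _ _ _ c4 h4).
apply: le_trans (ler_normD _ _) _; apply: lerD; last exact: (T _ _ _ _ c3 h3).
apply: le_trans (ler_normD _ _) _.
by apply: lerD; [exact: (T _ _ _ _ c1 h1)|exact: (T _ _ _ _ c2 h2)].
Qed.

Lemma differentiable_fst (z : C2 R) : differentiable (fst : C2 R -> Cx R) z.
Proof. by apply: linear_differentiable => ?; exact: cvg_fst. Qed.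

Lemma differentiable_snd (z : C2 R) : differentiable (snd : C2 R -> Cx R) z.
Proof. by apply: linear_differentiable => ?; exact: cvg_snd. Qed.

Lemma holo2_lipschitz (T : C2 R -> C2 R) (p : C2 R) :
  (\forall z \near p, differentiable T z) ->
  exists L d : R, [/\ 0 <= L, 0 < d & forall z w, nrm2 (z - p) < d -> nrm2 (w - p) < d ->
    nrm2 (T z - T w) <= L * nrm2 (z - w)].
Proof.
move=> Td.
have d1 : \forall z \near p, differentiable (fun z => (T z).1 : Cx R) z.
  by apply: filterS Td => z Tz; exact: (differentiable_comp Tz (differentiable_fst (T z))).
have d2 : \forall z \near p, differentiable (fun z => (T z).2 : Cx R) z.
  by apply: filterS Td => z Tz; exact: (differentiable_comp Tz (differentiable_snd (T z))).
have [L1 [e1 [L10 e10 H1]]] := holo_lipschitz d1.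
have [L2 [e2 [L20 e20 H2]]] := holo_lipschitz d2.
exists (L1 + L2), (Num.min e1 e2); split; [by rewrite addr_ge0|by rewrite lt_min e10|].
move=> z w; rewrite !lt_min => /andP[z1 z2] /andP[w1 w2].
rewrite nrm2_le /= mulrDl; apply/andP; split.
  by apply: le_trans (H1 z w z1 w1) _; rewrite lerDl mulr_ge0// nrm2_ge0.
by apply: le_trans (H2 z w z2 w2) _; rewrite lerDr mulr_ge0// nrm2_ge0.
Qed.

(** The step [- 2 * a / D0] is twice that of Newton's method. A slope [D] with [D / D0 > 1/2]
    therefore carries the value from [a] past 0. *)
Lemma sign_change (a D D0 : R) : D0 != 0 -> `|D - D0| < `|D0| / 2 ->
  Num.min a (a + - 2 * a / D0 * D) <= 0 <= Num.max a (a + - 2 * a / D0 * D).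
Proof.
move=> Dn h; have -> : a + - 2 * a / D0 * D = a * (1 - 2 * (D / D0)) by ring.
have K : 1/2 < D / D0.
  have : `|D / D0 - 1| < 1/2.
    rewrite -(ltr_pM2r (_ : 0 < `|D0|)) ?normr_gt0// -normrM mulrBl mulfVK// [1 * D0]mul1r.
    by apply: lt_le_trans h _; rewrite mulrC div1r.
  by rewrite ltr_norml => /andP[? ?]; lra.
rewrite ge_min le_max; case: (leP a 0) => a0 /=.
  by rewrite mulr_le0 ?orbT//; lra.
by rewrite (ltW a0) /= andbT mulr_ge0_le0 ?(ltW a0)//; lra.
Qed.

(* [y'] comes from the intermediate value theorem on the segment from [y] to
   [y - (2 f y / D_v f x) v], where [f] changes sign. *)
Lemma zero_along (U : set (R4 R)) (f : R4 R -> R) (x v : R4 R) : open U -> U x ->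
  smooth_on f U -> f x = 0 -> 'D_v f x != 0 -> forall e : R, 0 < e ->
  exists C d : R, [/\ 0 <= C, 0 < d & forall y, `|y - x| < d ->
    exists y', [/\ `|y' - x| < e, f y' = 0 & `|y' - y| <= C * `|f y|]].
Proof.
move=> Uo Ux fs fx0 Dn e e0.
set D0 := 'D_v f x in Dn.
have Dp : 0 < `|D0| by rewrite normr_gt0.
have D2 : 0 < `|D0| / 2 by rewrite divr_gt0.
have /R4_continuousP/(_ _ D2)[d1 d10 H1] := @smooth_continuous _ _ ('D_v f) x (smooth_D v fs) Ux.
have /nbhs_R4P[d2 d20 H2] : nbhs x U by exact: open_nbhs_nbhs.
pose k := Num.min (Num.min d1 d2) e.
have k0 : 0 < k by rewrite !lt_min d10 d20.
(* The displacement [- (2 f y / D0) v] has length [C * |f y|]. *)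
pose C := 2 * `|v| / `|D0|.
have C0 : 0 <= C by rewrite divr_ge0 ?mulr_ge0.
have kC : 0 < k / (2 * (C + 1)) by rewrite divr_gt0// mulr_gt0// ltr_wpDl.
have /R4_continuousP/(_ _ kC)[d3 d30 H3] := @smooth_continuous _ _ f x fs Ux.
exists C, (Num.min (k / 2) d3); split => //; first by rewrite lt_min divr_gt0.
move=> y; rewrite lt_min => /andP[yk y3].
have fy : C * `|f y| < k / 2.
  have := H3 y y3; rewrite fx0 subr0 ltr_pdivlMr; last by rewrite mulr_gt0// ltr_wpDl.
  by have := normr_ge0 (f y); move: k0 C0; clear; move: `|_| => a ? ? ? ?; lra.
pose s0 := - 2 * f y / D0.
have s0v : `|s0 *: v| = C * `|f y|.
  by rewrite normrZ /s0 !normrM normrN normrV ?unitfE// normr_nat /C; ring.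
have near t : `|t| <= `|s0| -> `|y + t *: v - x| < k.
  move=> ts; rewrite (_ : y + t *: v - x = (y - x) + t *: v); last by rewrite addrAC.
  apply: le_lt_trans (ler_normD _ _) _; rewrite normrZ.
  have : `|t| * `|v| <= C * `|f y| by rewrite -s0v normrZ ler_wpM2r.
  by move: yk fy; clear; move: `|_ - _| (_ * `|_|) => a b; lra.
have inU t : `|t| <= `|s0| -> U (y + t *: v).
  by move=> /near; rewrite !lt_min => /andP[/andP[_ /H2]].
have [|t ts E] := @mvt_line _ f y v s0.
  by move=> s /inU Us; exact: (@smooth_derivable _ _ f _ v fs Us).
have Dt : `|'D_v f (y + t *: v) - D0| < `|D0| / 2.
  by apply: H1; have := near _ ts; rewrite !lt_min => /andP[/andP[]].
pose w := s0 *: v.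
have wt (t0 : R) : t0 *: w = (t0 * s0) *: v by rewrite scalerA.
have psid (t0 : R) : 0 <= t0 <= 1 -> is_derive t0 1 (fun t0 => f (y + t0 *: w)) ('D_w f (y + t0 *: w)).
  move=> /andP[t00 t01]; apply: is_derive_line.
  apply: (@smooth_derivable _ _ f _ w fs); rewrite wt; apply: inU.
  by rewrite normrM ger0_norm// ler_piMl.
have sgn : Num.min (f (y + 0 *: w)) (f (y + 1 *: w)) <= 0 <= Num.max (f (y + 0 *: w)) (f (y + 1 *: w)).
  rewrite scale0r addr0 scale1r (_ : f (y + w) = f y + s0 * 'D_v f (y + t *: v)); last first.
    by rewrite -E [RHS]addrC subrK.
  exact: (sign_change _ Dn Dt).
have cont : {within `[0, 1], continuous (fun t0 : R => f (y + t0 *: w))}.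
  apply: derivable_within_continuous => t0; rewrite in_itv/= => h.
  by have [] := psid t0 h.
have [t0] := IVT ler01 cont sgn; rewrite in_itv/= => /andP[t00 t01] ft0.
have tw : `|t0 *: w| <= C * `|f y|.
  by rewrite normrZ ger0_norm// s0v ler_piMl// mulr_ge0.
exists (y + t0 *: w); split => //.
  have : `|t0 * s0| <= `|s0| by rewrite normrM ger0_norm// ler_piMl.
  by rewrite wt => /near; rewrite !lt_min => /andP[_].
by rewrite (_ : _ - y = t0 *: w)// addrC addKr.
Qed.

(** A zero [z'] of [rho1] at distance [O(|rho1 z|)] from [z] is sent by [T] into [S2], where [rho2]
    vanishes; [rho2] and [T] are Lipschitz. The map [T] is a change of coordinates or its inverse in
    the applications. *)
Lemma defining_compare (S1 S2 : set (C2 R)) (q1 q2 : C2 R) (rho1 rho2 : C2 R -> R)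
    (T : C2 R -> C2 R) :
  local_defining_function S1 q1 rho1 -> S1 q1 ->
  local_defining_function S2 q2 rho2 -> T q1 = q2 ->
  (\forall z \near q1, differentiable T z) ->
  (\forall z \near q1, S1 z -> S2 (T z)) ->
  exists C d : R, [/\ 0 <= C, 0 < d &
    forall z, nrm2 (z - q1) < d -> `|rho2 (T z)| <= C * `|rho1 z|].
Proof.
move=> [W1 [W1o W1q s1 Z1 G1]] Sq [W2 [W2o W2q s2 Z2 G2]] Tq Td /nbhs_C2P[e1 e10 H1].
have [v Dv] := G1 q1 Sq W1q.
have rho1q : rho1 q1 = 0.
  by have : (S1 `&` W1) q1 by []; rewrite Z1 => -[].
pose x1 := ofC2 q1; pose x2 := ofC2 q2.
have [L2 [d2 [L20 d20 HL2]]] := @smooth_lipschitz _ (realify rho2) x2 (open_toC2 W2o) (eq_ind_r W2 W2q (ofC2K q2)) s2.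
have [LT [dT [LT0 dT0 HLT]]] := holo2_lipschitz Td.
have /nbhs_C2P[e2 e20 H2] : nbhs q2 W2 by exact: open_nbhs_nbhs.
have /nbhs_C2P[e3 e30 H3] : nbhs q1 W1 by exact: open_nbhs_nbhs.
pose m := Num.min d2 e2 / (LT + 1).
have LT1 : 0 < LT + 1 by rewrite ltr_wpDl.
have m0 : 0 < m by rewrite divr_gt0// lt_min d20.
pose k := Num.min (Num.min e1 dT) (Num.min e3 m).
have k0 : 0 < k by rewrite !lt_min e10 dT0 e30.
have f0 : realify rho1 x1 = 0 by rewrite /realify /= ofC2K.
have [C [d [C0 d0 Hz]]] := @zero_along _ (realify rho1) x1 v (open_toC2 W1o)
  (eq_ind_r W1 W1q (ofC2K q1)) s1 f0 Dv _ (divr_gt0 k0 (ltr0Sn R 1)).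
exists (L2 * (LT * (2 * C))), (Num.min d k); split; first by rewrite !mulr_ge0.
  by rewrite lt_min d0.
move=> z; rewrite lt_min => /andP[zd zk].
have ofB (a b : C2 R) : ofC2 a - ofC2 b = ofC2 (a - b) by case: a b => [[? ?] [? ?]] [[? ?] [? ?]].
have [|y' [y'k y'0 y'z]] := Hz (ofC2 z).
  by rewrite ofB; apply: le_lt_trans (nrm_ofC2_le _) zd.
pose z' := toC2 y'.
have z'k : nrm2 (z' - q1) < k.
  have -> : z' - q1 = toC2 (y' - x1) by rewrite toC2B ofC2K.
  by apply: le_lt_trans (nrm2_toC2_le _) _; rewrite mulrC -ltr_pdivlMr.
have z'z : nrm2 (z' - z) <= 2 * C * `|rho1 z|.
  have -> : z' - z = toC2 (y' - ofC2 z) by rewrite toC2B ofC2K.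
  apply: le_trans (nrm2_toC2_le _) _; rewrite -mulrA ler_pM2l//.
  by move: y'z; rewrite /realify /= ofC2K.
move: (zk) (z'k); rewrite !lt_min => /andP[/andP[ze1 zT] /andP[ze3 zm]] /andP[/andP[z'e1 z'T] /andP[z'e3 z'm]].
have Tnear w : nrm2 (w - q1) < dT -> nrm2 (w - q1) < m -> nrm2 (T w - q2) < Num.min d2 e2.
  move=> wT wm; rewrite -Tq; apply: le_lt_trans (HLT w q1 wT _) _.
    by rewrite subrr /nrm2 cabs0 maxxx.
  move: wm; rewrite /m ltr_pdivlMr// mulrC => h; apply: le_lt_trans h.
  by rewrite ler_wpM2r ?nrm2_ge0// lerDl.
have Sz' : S1 z'.
  have : (S1 `&` W1) z' by rewrite Z1; split; [exact: H3|].
  by case.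
have r2z' : rho2 (T z') = 0.
  have : (S2 `&` W2) (T z').
    split; first exact: H1.
    by apply: H2; have := Tnear z' z'T z'm; rewrite lt_min => /andP[].
  by rewrite Z2 => -[].
have := HL2 (ofC2 (T z')) (ofC2 (T z)).
rewrite /realify /= !ofC2K r2z' subr0 !ofB => H.
have Tnear2 w : nrm2 (w - q1) < dT -> nrm2 (w - q1) < m -> `|ofC2 (T w - q2)| < d2.
  move=> wT wm; apply: le_lt_trans (nrm_ofC2_le _) _.
  by have := Tnear w wT wm; rewrite lt_min => /andP[].
apply: le_trans (H _ _) _; [exact: Tnear2|exact: Tnear2|].
rewrite -!mulrA ler_wpM2l//; apply: le_trans (nrm_ofC2_le _) _.
apply: le_trans (HLT z z' zT z'T) _; rewrite ler_wpM2l// nrm2C.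
by rewrite mulrA.
Qed.

End Comparison.

(** * Faces of the Newton polyhedron *)

Section RayOrders.
Variable R : realType.
Implicit Types (f g : R -> R[i]).

(** Big-O of [s ^+ n] as [s] tends to 0 from the right, for functions restricted to a ray. *)
Definition ob f (n : nat) : Prop :=
  exists K d : R, 0 < d /\ forall s, 0 < s < d -> cabs (f s) <= K * s ^+ n.

Lemma ob_ge0 f n : ob f n -> exists K d : R, [/\ 0 <= K, 0 < d, d <= 1 &
  forall s, 0 < s < d -> cabs (f s) <= K * s ^+ n].
Proof.
move=> [K [d [d0 H]]]; exists `|K|, (Num.min d 1); split => //.
- by rewrite lt_min d0 ltr01.
- by rewrite ge_min lexx orbT.
move=> s /andP[s0]; rewrite lt_min => /andP[sd _].
apply: le_trans (H s _) _; first by rewrite s0.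
by rewrite ler_wpM2r ?exprn_ge0 ?(ltW s0)// ler_norm.
Qed.

Lemma ob0 n : ob (fun=> 0) n.
Proof. by exists 0, 1; split => // s _; rewrite cabs0 mul0r. Qed.

Lemma obD f g n : ob f n -> ob g n -> ob (fun s => f s + g s) n.
Proof.
move=> [K [d [d0 H]]] [L [e [e0 H']]]; exists (K + L), (Num.min d e); split.
  by rewrite lt_min d0.
move=> s /andP[s0]; rewrite lt_min => /andP[sd se].
apply: le_trans (cabsD _ _) _; rewrite mulrDl.
by apply: lerD; [apply: H|apply: H']; rewrite s0.
Qed.

Lemma obM f g m n : ob f m -> ob g n -> ob (fun s => f s * g s) (m + n).
Proof.
move=> /ob_ge0[K [d [K0 d0 _ H]]] /ob_ge0[L [e [L0 e0 _ H']]].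
exists (K * L), (Num.min d e); split; first by rewrite lt_min d0.
move=> s /andP[s0]; rewrite lt_min => /andP[sd se].
rewrite cabsM exprD mulrACA; apply: ler_pM; rewrite ?cabs_ge0//.
  by apply: H; rewrite s0.
by apply: H'; rewrite s0.
Qed.

Lemma ob_weaken f m n : (n <= m)%N -> ob f m -> ob f n.
Proof.
move=> nm /ob_ge0[K [d [K0 d0 d1 H]]]; exists K, d; split => // s /andP[s0 sd].
apply: le_trans (H s _) _; first by rewrite s0.
by rewrite ler_wpM2l// ler_wiXn2l// ?(ltW s0)// (le_trans (ltW sd)).
Qed.

Lemma ob_cst (c : R[i]) : ob (fun=> c) 0.
Proof. by exists (cabs c), 1; split => // s _; rewrite expr0 mulr1. Qed.

Lemma ob_mon n : ob (fun s => (s%:C)%C ^+ n) n.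
Proof.
exists 1, 1; split => // s /andP[s0 _].
by rewrite cabsX cabs_real ger0_norm ?mul1r// ltW.
Qed.

Lemma obZ (c : R[i]) f n : ob f n -> ob (fun s => c * f s) n.
Proof. by move=> H; exact: (obM (ob_cst c) H). Qed.

Lemma eq_ob f g n : (forall s, f s = g s) -> ob f n -> ob g n.
Proof. by move=> fg [K [d [d0 H]]]; exists K, d; split => // s /H; rewrite fg. Qed.

Lemma ob_sum (K : nat) (f : 'I_K -> R -> R[i]) n : (forall i, ob (f i) n) ->
  ob (fun s => \sum_i f i s) n.
Proof.
elim: K f => [|K IH] f Hf.
  by apply: (eq_ob _ (ob0 n)) => s; rewrite big_ord0.
apply: (eq_ob (f := fun s => f ord0 s + \sum_(i < K) f (lift ord0 i) s)).
  by move=> s; rewrite big_ord_recl.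
by apply: obD => //; exact: (IH (fun i => f (lift ord0 i))).
Qed.

(** [A = 0] is allowed: products of leading terms are taken before it is known whether the total
    coefficient vanishes. *)
Definition lead f (A : R[i]) (n : nat) : Prop := ob (fun s => f s - A * (s%:C)%C ^+ n) n.+1.

Lemma lead_ob f A n : lead f A n -> ob f n.
Proof.
move=> H; apply: (eq_ob (f := fun s => (f s - A * (s%:C)%C ^+ n) + A * (s%:C)%C ^+ n)).
  by move=> s; rewrite subrK.
by apply: obD; [exact: ob_weaken H|apply: obZ; exact: ob_mon].
Qed.

Lemma leadM f g A B m n : lead f A m -> lead g B n -> lead (fun s => f s * g s) (A * B) (m + n).
Proof.
move=> fA gB; have f_ob := lead_ob fA.
apply: (eq_ob (f := fun s => f s * (g s - B * (s%:C)%C ^+ n) +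
                     B * ((s%:C)%C ^+ n * (f s - A * (s%:C)%C ^+ m)))).
  by move=> s; rewrite exprD; ring.
apply: obD; first by rewrite -addnS; exact: obM.
by apply: obZ; rewrite addnC -addnS; apply: obM => //; exact: ob_mon.
Qed.

Lemma lead1 : lead (fun=> 1) 1 0.
Proof. by apply: (eq_ob _ (ob0 1)) => s; rewrite expr0 mulr1 subrr. Qed.

Lemma leadX f A n k : lead f A n -> lead (fun s => f s ^+ k) (A ^+ k) (n * k).
Proof.
move=> fA; elim: k => [|k IH]; first by rewrite muln0; exact: lead1.
by rewrite mulnS exprS; apply: (eq_ob _ (leadM fA IH)) => s; rewrite exprS.
Qed.

Lemma leadZ c f A n : lead f A n -> lead (fun s => c * f s) (c * A) n.
Proof.
by move=> H; apply: (eq_ob _ (obZ c H)) => s; rewrite mulrBr mulrA.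
Qed.

Lemma lead_conj f A n : lead f A n -> lead (fun s => conjc (f s)) (conjc A) n.
Proof.
move=> [K [d [d0 H]]]; exists K, d; split => // s /H.
rewrite -cabs_conj rmorphB rmorphM rmorphXn /=.
by rewrite oppr0.
Qed.

Lemma ob_lead_absurd (B : R[i]) l : ob (fun s => B * (s%:C)%C ^+ l) l.+1 -> B = 0.
Proof.
move=> /ob_ge0[K [d [K0 d0 d1 H]]]; apply/eqP; rewrite -cabs_eq0 eq_le cabs_ge0 andbT.
rewrite leNgt; apply/negP => B0.
pose s := Num.min (d / 2) (cabs B / (2 * (K + 1))).
have K1 : 0 < K + 1 by rewrite ltr_wpDl.
have s0 : 0 < s by rewrite lt_min !divr_gt0// mulr_gt0.
have sd : s < d by apply: (@le_lt_trans _ _ (d / 2)); [rewrite ge_min lexx|lra].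
have := H s; rewrite s0 sd cabsM cabsX cabs_real ger0_norm ?(ltW s0)// => /(_ isT).
rewrite exprS mulrA ler_pM2r ?exprn_gt0//.
have : s <= cabs B / (2 * (K + 1)) by rewrite ge_min lexx orbT.
rewrite ler_pdivlMr ?mulr_gt0//.
have : 0 <= K * s by rewrite mulr_ge0// ltW.
by move: B0 s0; clear; lra.
Qed.

End RayOrders.

Section NewtonFace.
Variable R : realType.
Variable F : C2 R -> R.

Definition weight (a1 a2 : nat) (p : R * R) : R := a1%:R * p.1 + a2%:R * p.2.

Definition nz (a b : nat * nat) : Prop := taylor_coef F a b != 0.

Lemma NP_elim (p : R * R) : newton_polyhedron F p ->
  exists (n : nat) (w : 'I_n -> R) (q : 'I_n -> R * R) (a b : 'I_n -> nat * nat),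
  [/\ forall i, 0 <= w i, \sum_(i < n) w i = 1,
      forall i, nz (a i) (b i) /\ ((((a i).1 + (b i).1)%N)%:R <= (q i).1 /\ (((a i).2 + (b i).2)%N)%:R <= (q i).2) &
      p = (\sum_(i < n) w i * (q i).1, \sum_(i < n) w i * (q i).2)].
Proof.
move=> [n [w [q [w0 w1 Hq ->]]]].
have /choice[ab Hab] : forall i, exists ab : (nat * nat) * (nat * nat), nz ab.1 ab.2 /\
   ((((ab.1).1 + (ab.2).1)%N)%:R <= (q i).1 /\ (((ab.1).2 + (ab.2).2)%N)%:R <= (q i).2).
  by move=> i; have [v [a [b [nzab ->]]] [/= h1 h2]] := Hq i; exists (a, b).
by exists n, w, q, (fun i => (ab i).1), (fun i => (ab i).2).
Qed.

Lemma NP_orthant a b (p : R * R) : nz a b -> (((a.1 + b.1)%N)%:R <= p.1) ->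
  (((a.2 + b.2)%N)%:R <= p.2) -> newton_polyhedron F p.
Proof.
move=> ab h1 h2; exists 1%N, (fun=> 1), (fun=> p); split.
- by [].
- by rewrite big_ord1.
- by move=> _; exists (((a.1 + b.1)%N)%:R, ((a.2 + b.2)%N)%:R); [exists a, b|split].
- by rewrite !big_ord1 !mul1r -surjective_pairing.
Qed.

Lemma NP_exp a b : nz a b -> newton_polyhedron F (((a.1 + b.1)%N)%:R, ((a.2 + b.2)%N)%:R).
Proof. by move=> ab; exact: NP_orthant ab _ _. Qed.

Lemma weight_convex a1 a2 n (w : 'I_n -> R) (q : 'I_n -> R * R) :
  weight a1 a2 (\sum_(i < n) w i * (q i).1, \sum_(i < n) w i * (q i).2) =
  \sum_(i < n) w i * weight a1 a2 (q i).
Proof.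
rewrite /weight /= !mulr_sumr -big_split /=; apply: eq_bigr => i _; ring.
Qed.

Section Face.
Variables (a1 a2 l : nat).
Hypothesis a1p : (0 < a1)%N.
Hypothesis a2p : (0 < a2)%N.
Hypothesis lmin : forall a b, nz a b -> (l <= a1 * (a.1 + b.1) + a2 * (a.2 + b.2))%N.
Hypothesis lex : exists a b, nz a b /\ (a1 * (a.1 + b.1) + a2 * (a.2 + b.2) = l)%N.

Lemma weight_nat x y : weight a1 a2 (x%:R, y%:R) = (a1 * x + a2 * y)%N%:R.
Proof. by rewrite /weight /= natrD !natrM. Qed.

Lemma weight_mono p q : p.1 <= q.1 -> p.2 <= q.2 -> weight a1 a2 p <= weight a1 a2 q.
Proof. by move=> h1 h2; apply: lerD; rewrite ler_wpM2l. Qed.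

Lemma NP_weight_ge p : newton_polyhedron F p -> l%:R <= weight a1 a2 p.
Proof.
move=> /NP_elim[n [w [q [a [b [w0 w1 Hq ->]]]]]]; rewrite weight_convex.
have -> : l%:R = \sum_(i < n) w i * l%:R by rewrite -mulr_suml w1 mul1r.
apply: ler_sum => i _; rewrite ler_wpM2l//.
have [nzi [h1 h2]] := Hq i.
apply: le_trans (weight_mono (p := (((a i).1 + (b i).1)%N%:R, ((a i).2 + (b i).2)%N%:R)) h1 h2).
by rewrite weight_nat ler_nat; exact: lmin.
Qed.

(** Written exactly as the set in [N_nondegenerate], whose equation then holds by reflexivity. *)
Definition face : set (R * R) := [set xi | newton_polyhedron F xi /\
  (a1%:R : R) * xi.1 + (a2%:R : R) * xi.2 = l%:R].

(** The abscissas of the exponents on the supporting line. They are natural numbers at most [l], so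
    a least and a greatest one exist and are the ends of the face. *)
Definition on_line (x : nat) : bool :=
  `[< exists a b, nz a b /\ (a1 * (a.1 + b.1) + a2 * (a.2 + b.2) = l)%N /\ (a.1 + b.1)%N = x >].

Lemma on_line_ex : exists x, on_line x.
Proof. by have [a [b [h1 h2]]] := lex; exists (a.1 + b.1)%N; apply/asboolP; exists a, b. Qed.

Lemma on_line_le x : on_line x -> (x <= l)%N.
Proof.
move=> /asboolP[a [b [_ [<- <-]]]]; apply: leq_trans (leq_addr _ _).
by rewrite leq_pmull.
Qed.

Lemma on_line_NP x : on_line x -> newton_polyhedron F (x%:R, (l%:R - a1%:R * x%:R) / a2%:R).
Proof.
move=> /asboolP[a [b [h1 [h2 h3]]]].
have := NP_exp h1; rewrite h3; congr newton_polyhedron; congr pair.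
have a20 : (a2%:R : R) != 0 by rewrite pnatr_eq0 -lt0n.
have E : l%:R = a1%:R * x%:R + a2%:R * (a.2 + b.2)%N%:R :> R by rewrite -h2 h3 natrD !natrM.
by apply: (mulIf a20); rewrite mulfVK// E; ring.
Qed.

(** In a convex combination of weight [l], only points of weight exactly [l] have a positive
    coefficient. Since [a1] and [a2] are positive, such a point cannot lie strictly beyond the
    exponent below it, which is then on the line. So the face is the segment between the extreme
    exponents. *)
Lemma face_char : exists x0 x1 : nat, [/\ on_line x0, on_line x1, (x0 <= x1)%N & forall p, face p <->
  (x0%:R <= p.1 <= x1%:R) /\ p.2 = (l%:R - a1%:R * p.1) / a2%:R].
Proof.
have a10 : (0 : R) < a1%:R by rewrite ltr0n.
have a20 : (0 : R) < a2%:R by rewrite ltr0n.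
case: (ex_minnP on_line_ex) => x0 x0l x0min.
case: (ex_maxnP on_line_ex on_line_le) => x1 x1l x1max.
exists x0, x1; split => //; first exact: x0min.
move=> p; split.
  move=> [pNP wp]; split; last first.
    by apply: (mulIf (lt0r_neq0 a20)); rewrite mulfVK ?lt0r_neq0// -wp; ring.
  have [n [w [q [a [b [w0 w1 Hq pE]]]]]] := NP_elim pNP.
  have W i : l%:R <= weight a1 a2 (q i).
    have [nzi [h1 h2]] := Hq i.
    apply: le_trans (weight_mono (p := (((a i).1 + (b i).1)%N%:R, ((a i).2 + (b i).2)%N%:R)) h1 h2).
    by rewrite weight_nat ler_nat; exact: lmin.
  have Z i : w i * (weight a1 a2 (q i) - l%:R) = 0.
    have S : \sum_(i < n) w i * (weight a1 a2 (q i) - l%:R) = 0.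
      under eq_bigr do rewrite mulrBr.
      rewrite sumrB -mulr_suml w1 mul1r -weight_convex -pE.
      by rewrite -/(weight a1 a2 p) in wp; rewrite /weight in wp *; rewrite wp subrr.
    have := psumr_eq0P (P := predT) (F := fun i => w i * (weight a1 a2 (q i) - l%:R)).
    apply => // j _; rewrite mulr_ge0// subr_ge0//.
  have B i : w i * x0%:R <= w i * (q i).1 <= w i * x1%:R.
    have /eqP := Z i; rewrite mulf_eq0 => /orP[/eqP->|]; first by rewrite !mul0r lexx.
    rewrite subr_eq0 => /eqP wq.
    have [nzi [h1 h2]] := Hq i.
    set x := ((a i).1 + (b i).1)%N in h1; set y := ((a i).2 + (b i).2)%N in h2.
    have le1 : l%:R <= (a1 * x + a2 * y)%N%:R :> R by rewrite ler_nat; exact: lmin.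
    have qx : (q i).1 = x%:R.
      apply/eqP; rewrite eq_le h1 andbT.
      rewrite -(ler_pM2l a10).
      have : a2%:R * y%:R <= a2%:R * (q i).2 by rewrite ler_pM2l.
      move: wq le1; rewrite /weight natrD !natrM; lra.
    have lx : on_line x.
      apply/asboolP; exists (a i), (b i); split => //; split => //.
      apply/eqP; rewrite eqn_leq; apply/andP; split; last exact: lmin.
      rewrite -(ler_nat R) -wq /weight natrD !natrM qx lerD2l ler_pM2l//.
    rewrite qx; apply/andP; split; rewrite ler_wpM2l// ler_nat; [exact: x0min|exact: x1max].
  rewrite pE /=; apply/andP; split.
    rewrite (_ : x0%:R = \sum_(i < n) w i * x0%:R); last by rewrite -mulr_suml w1 mul1r.
    by apply: ler_sum => i _; have /andP[] := B i.
  rewrite (_ : x1%:R = \sum_(i < n) w i * x1%:R); last by rewrite -mulr_suml w1 mul1r.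
    by apply: ler_sum => i _; have /andP[] := B i.
move=> [/andP[p0 p1] p2].
have wp : a1%:R * p.1 + a2%:R * p.2 = l%:R.
  by rewrite p2 mulrC; field; rewrite lt0r_neq0.
split => //.
have [x01|] := eqVneq x0 x1.
  have <- : (x0%:R, (l%:R - a1%:R * x0%:R) / a2%:R) = p; last exact: on_line_NP.
  have e : p.1 = x0%:R by apply/eqP; rewrite eq_le p0 x01 p1.
  by rewrite -e -p2 -surjective_pairing.
rewrite neq_ltn => /orP[x01|]; last by rewrite ltnNge (x0min _ x1l).
have [n0 [w0 [q0 [w00 w01 Hq0 e0]]]] := on_line_NP x0l.
pose E i : R * R := if i == ord0 :> 'I_2 then (x0%:R, (l%:R - a1%:R * x0%:R) / a2%:R)
   else (x1%:R, (l%:R - a1%:R * x1%:R) / a2%:R).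
have x10 : (0 : R) < x1%:R - x0%:R by rewrite subr_gt0 ltr_nat.
pose W i : R := if i == ord0 :> 'I_2 then (x1%:R - p.1) / (x1%:R - x0%:R) else (p.1 - x0%:R) / (x1%:R - x0%:R).
exists 2%N, W, E; split.
- have h0 : 0 <= (x1%:R - p.1) / (x1%:R - x0%:R).
    by apply: divr_ge0; [rewrite subr_ge0|exact: ltW].
  have h1 : 0 <= (p.1 - x0%:R) / (x1%:R - x0%:R).
    by apply: divr_ge0; [rewrite subr_ge0|exact: ltW].
  by move=> i; rewrite /W; case: ifP.
- by rewrite 2!big_ord_recl big_ord0 /W /= addr0 -mulrDl addrA subrK divff// lt0r_neq0.
- move=> i; rewrite /E; case: ifP => _.
    move/asboolP: x0l => [a [b [h1 [h2 h3]]]]; exists (((a.1 + b.1)%N)%:R, ((a.2 + b.2)%N)%:R); first by exists a, b.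
    split => /=; rewrite ?h3//.
    have : l%:R = a1%:R * x0%:R + a2%:R * (a.2 + b.2)%N%:R :> R by rewrite -h2 h3 natrD !natrM.
    by rewrite ler_pdivlMr// => ->; lra.
  move/asboolP: x1l => [a [b [h1 [h2 h3]]]]; exists (((a.1 + b.1)%N)%:R, ((a.2 + b.2)%N)%:R); first by exists a, b.
  split => /=; rewrite ?h3//.
  have : l%:R = a1%:R * x1%:R + a2%:R * (a.2 + b.2)%N%:R :> R by rewrite -h2 h3 natrD !natrM.
  by rewrite ler_pdivlMr// => ->; lra.
rewrite !big_ord_recl !big_ord0 /W /E /= !addr0.
rewrite [p]surjective_pairing p2; congr pair; field; rewrite ?lt0r_neq0//.
Qed.

(** The face is the continuous image of an interval, by the description in [face_char]; [(a1, a2)]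
    is the normal vector of its supporting line. *)
Lemma face_compact : compact_face (newton_polyhedron F) face.
Proof.
have [x0 [x1 [x0l x1l x01 fP]]] := face_char.
have a10 : (0 : R) < a1%:R by rewrite ltr0n.
split.
- exists (x0%:R, (l%:R - a1%:R * x0%:R) / a2%:R); apply/fP => /=; split => //.
  by rewrite lexx ler_nat.
- have -> : face = (fun x : R => (x, (l%:R - a1%:R * x) / a2%:R)) @` [set` `[x0%:R : R, x1%:R]%R].
    apply/seteqP; split => [p /fP[h1 h2]|p [x]].
      by exists p.1; [rewrite /= in_itv|rewrite -h2 -surjective_pairing].
    by rewrite /= in_itv/= => h <-; apply/fP.
  apply: continuous_compact; last exact: segment_compact.
  apply: continuous_subspaceT => x.
  have h1 : (fun y : R => y) @ x --> x by exact: cvg_id.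
  have h2 : (fun y : R => (l%:R - a1%:R * y) / a2%:R) @ x --> (l%:R - a1%:R * x) / a2%:R.
    apply: cvgM; last exact: cvg_cst.
    apply: cvgB; first exact: cvg_cst.
    by apply: cvgM; [exact: cvg_cst|exact: cvg_id].
  exact: (cvg_pair h1 h2).
exists (a1%:R, a2%:R), l%:R; split.
  by apply/eqP => -[/eqP]; rewrite gt_eqF.
by split => // xi /NP_weight_ge.
Qed.

(** As [a1] and [a2] are at least 1, coordinates on the face are at most [l]; so [l.+1] is an
    admissible truncation for [F_face]. *)
Lemma face_bound xi : face xi -> xi.1 < l.+1%:R /\ xi.2 < l.+1%:R.
Proof.
move=> [xNP wx].
have [n [w [q [a [b [w0 w1 Hq pE]]]]]] := NP_elim xNP.
have p1 : 0 <= xi.1.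
  by rewrite pE /= sumr_ge0// => i _; rewrite mulr_ge0//; have [_ [h _]] := Hq i; exact: le_trans h.
have p2 : 0 <= xi.2.
  by rewrite pE /= sumr_ge0// => i _; rewrite mulr_ge0//; have [_ [_ h]] := Hq i; exact: le_trans h.
have h1 : xi.1 <= a1%:R * xi.1 by rewrite ler_peMl// ler1n.
have h2 : xi.2 <= a2%:R * xi.2 by rewrite ler_peMl// ler1n.
rewrite -natr1; split; lra.
Qed.

End Face.
End NewtonFace.

(** * Nondegeneracy and the order along a curve *)

Section Core.
Variable R : realType.

Definition hlead (f : Cx R -> Cx R) (c : Cx R) (a : nat) : Prop :=
  exists K d : R, 0 < d /\ forall t, cabs t < d -> cabs (f t - c * t ^+ a) <= K * cabs t ^+ a.+1.

Lemma ray_lt (s t d : R) : 0 < s -> s * (t + 1) < d -> s * t < d.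
Proof. by move=> s0; rewrite mulrDr mulr1 => h; apply: lt_trans h; rewrite ltrDl. Qed.

Lemma hlead_ray f c a t0 : hlead f c a ->
  lead (fun s => f ((s%:C)%C * t0)) (c * t0 ^+ a) a.
Proof.
move=> [K [d [d0 H]]]; exists (K * cabs t0 ^+ a.+1), (d / (cabs t0 + 1)).
have t1 : 0 < cabs t0 + 1 by rewrite ltr_wpDl// cabs_ge0.
split; first by rewrite divr_gt0.
move=> s /andP[s0]; rewrite ltr_pdivlMr// => sd.
have st : cabs ((s%:C)%C * t0) = s * cabs t0 by rewrite cabsM cabs_real ger0_norm// ltW.
have := H ((s%:C)%C * t0); rewrite st => /(_ _)H'.
have {}H' := H' (ray_lt s0 sd).
rewrite (_ : c * t0 ^+ a * (s%:C)%C ^+ a = c * ((s%:C)%C * t0) ^+ a).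
  by apply: le_trans H' _; rewrite exprMn mulrA mulrAC.
by rewrite exprMn; ring.
Qed.

Variable U : set (R4 R).
Hypothesis Uo : open U.
Hypothesis U0 : U 0.
Variable F : C2 R -> R.
Hypothesis Fs : smooth_on (realify F) U.
Hypothesis Fnd : N_nondegenerate F.

(* Evaluated on a ray [s t0] where the face polynomial does not vanish, the function has
   order exactly [l]. *)
Lemma face_order (eta1 eta2 : Cx R -> Cx R) (c1 c2 : Cx R) (a1 a2 l N : nat) :
  (0 < a1)%N -> (0 < a2)%N -> c1 != 0 -> c2 != 0 ->
  hlead eta1 c1 a1 -> hlead eta2 c2 a2 ->
  (forall a b, nz F a b -> (l <= a1 * (a.1 + b.1) + a2 * (a.2 + b.2))%N) ->
  (exists a b, nz F a b /\ (a1 * (a.1 + b.1) + a2 * (a.2 + b.2) = l)%N) ->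
  (exists K d : R, 0 < d /\ forall t, cabs t < d -> `|F (eta1 t, eta2 t)| <= K * cabs t ^+ N) ->
  (N <= l)%N.
Proof.
move=> a1p a2p c10 c20 e1 e2 lmin lex [KN [dN [dN0 HN]]].
pose kappa := face F a1 a2 l.
have nd := Fnd (face_compact a1p a2p lmin lex) (c := (c1, c2)) (a := (a1, a2)) c10 c20
  (erefl kappa) (face_bound a1p a2p).
have {nd} [t0 Ht0] : exists t0 : Cx R, F_face F kappa l.+1 (c1 * t0 ^+ a1, c2 * t0 ^+ a2) != 0.
  apply: contrapT => H; apply: nd; apply/nbhs_CxP; exists 1 => // t _; apply/eqP/negPn/negP => Ht.
  by apply: H; exists t.
pose A1 := c1 * t0 ^+ a1; pose A2 := c2 * t0 ^+ a2.
pose f1 (s : R) := eta1 ((s%:C)%C * t0); pose f2 (s : R) := eta2 ((s%:C)%C * t0).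
have L1 : lead f1 A1 a1 := hlead_ray t0 e1.
have L2 : lead f2 A2 a2 := hlead_ray t0 e2.
have obF : ob (fun s => ((F (f1 s, f2 s))%:C)%C) N.
  exists (KN * cabs t0 ^+ N), (dN / (cabs t0 + 1)).
  have t1 : 0 < cabs t0 + 1 by rewrite ltr_wpDl// cabs_ge0.
  split; first by rewrite divr_gt0.
  move=> s /andP[s0]; rewrite ltr_pdivlMr// => sd.
  have st : cabs ((s%:C)%C * t0) = s * cabs t0 by rewrite cabsM cabs_real ger0_norm// ltW.
  rewrite cabs_real; apply: le_trans (HN _ _) _.
    by rewrite st; exact: (ray_lt s0 sd).
  by rewrite st exprMn mulrA mulrAC.
(* If [l < N], [F] is [O(s ^+ l.+1)] on the ray. Removing the Taylor remainder and the terms of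
   weight above [l], which have that order too, leaves a nonzero multiple of [s ^+ l]. *)
rewrite leqNgt; apply/negP => lN.
have obF' := ob_weaken lN obF.
(* Both components are [O(s)] because [a1] and [a2] are positive, so truncation at [l.+1] costs
   [O(s ^+ l.+1)]. *)
have obT : ob (fun s => ((F (f1 s, f2 s))%:C)%C - taylor_poly F l.+1 (f1 s, f2 s)) l.+1.
  have [C [e [C0 e0 HC]]] := taylor_expansion Uo U0 Fs l.+1.
  have [K1 [d1 [K10 d10 _ H1]]] := ob_ge0 (ob_weaken a1p (lead_ob L1)).
  have [K2 [d2 [K20 d20 _ H2]]] := ob_ge0 (ob_weaken a2p (lead_ob L2)).
  pose B := K1 + K2 + 1.
  have B0 : 0 < B by rewrite ltr_wpDl// addr_ge0.
  exists (C * B ^+ l.+1), (Num.min (e / B) (Num.min d1 d2)); split.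
    by rewrite !lt_min divr_gt0// d10.
  move=> s /andP[s0]; rewrite !lt_min ltr_pdivlMr// => /andP[se /andP[sd1 sd2]].
  have nf : nrm2 ((f1 s, f2 s) : C2 R) <= B * s.
    have h1 : cabs (f1 s) <= K1 * s by have := H1 s; rewrite s0 sd1 expr1; apply.
    have h2 : cabs (f2 s) <= K2 * s by have := H2 s; rewrite s0 sd2 expr1; apply.
    have := mulr_ge0 K10 (ltW s0); have := mulr_ge0 K20 (ltW s0).
    by move=> ? ?; rewrite nrm2_le /=; apply/andP; split; rewrite /B; lra.
  apply: le_trans (HC _ _) _; first by apply: le_lt_trans nf _; rewrite mulrC.
  rewrite -mulrA ler_wpM2l// -exprMn lerXn2r// nnegrE ?nrm2_ge0//.
  by rewrite mulr_ge0 ?ltW.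
have obP : ob (fun s => taylor_poly F l.+1 (f1 s, f2 s) - F_face F kappa l.+1 (A1, A2) * (s%:C)%C ^+ l) l.+1.
  pose term (i j k m : nat) (s : R) : R[i] :=
    taylor_coef F (i, j) (k, m) * f1 s ^+ i * f2 s ^+ j * (conjc (f1 s)) ^+ k * (conjc (f2 s)) ^+ m
    - (if `[< kappa (((i + k)%N)%:R, ((j + m)%N)%:R) >]
       then taylor_coef F (i, j) (k, m) * A1 ^+ i * A2 ^+ j * (conjc A1) ^+ k * (conjc A2) ^+ m
       else 0) * (s%:C)%C ^+ l.
  apply: (eq_ob (f := fun s => \sum_(i < l.+1) \sum_(j < l.+1) \sum_(k < l.+1) \sum_(m < l.+1) term i j k m s)).
    move=> s; rewrite /taylor_poly /F_face mulr_suml -sumrB; apply: eq_bigr => i _.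
    rewrite mulr_suml -sumrB; apply: eq_bigr => j _.
    rewrite mulr_suml -sumrB; apply: eq_bigr => k _.
    by rewrite mulr_suml -sumrB; apply: eq_bigr => m _.
  apply: (@ob_sum _ _ (fun (i : 'I_l.+1) s => \sum_(j < l.+1) \sum_(k < l.+1) \sum_(m < l.+1) term i j k m s)) => i.
  apply: (@ob_sum _ _ (fun (j : 'I_l.+1) s => \sum_(k < l.+1) \sum_(m < l.+1) term i j k m s)) => j.
  apply: (@ob_sum _ _ (fun (k : 'I_l.+1) s => \sum_(m < l.+1) term i j k m s)) => k.
  apply: (@ob_sum _ _ (fun (m : 'I_l.+1) s => term i j k m s)) => m.
  rewrite /term; move: (nat_of_ord i) (nat_of_ord j) (nat_of_ord k) (nat_of_ord m) => {i j k m} i j k m.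
  have [c0|cn0] := eqVneq (taylor_coef F (i, j) (k, m)) 0.
    by apply: (eq_ob _ (ob0 _ _)) => s; rewrite c0 !mul0r if_same mul0r subrr.
  have LT := leadM (leadM (leadM (leadZ (taylor_coef F (i, j) (k, m)) (leadX i L1)) (leadX j L2))
    (leadX k (lead_conj L1))) (leadX m (lead_conj L2)).
  have wE : (a1 * i + a2 * j + a1 * k + a2 * m = a1 * (i + k) + a2 * (j + m))%N.
    by rewrite !mulnDr addnACA !addnA.
  rewrite wE in LT.
  have lw := lmin (i, j) (k, m) cn0; rewrite /= in lw.
  (* On the face the monomial has weight exactly [l] and its leading term is the one in [F_face];
     off the face its weight is larger and all of it is negligible. *)
  case: asboolP => [[_ kE]|nk].
    have wl : (a1 * (i + k) + a2 * (j + m) = l)%N.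
      by apply/eqP; rewrite -(eqr_nat R) [X in X == _]natrD !natrM; apply/eqP.
    rewrite wl in LT.
    exact: LT.
  have lw' : (l < a1 * (i + k) + a2 * (j + m))%N.
    rewrite ltn_neqAle lw andbT; apply/eqP => wl; apply: nk; split; first exact: (NP_exp cn0).
    by rewrite wl [in RHS]natrD !natrM.
  apply: (eq_ob _ (ob_weaken lw' (lead_ob LT))) => s.
  by rewrite mul0r subr0.
have obS : ob (fun s => F_face F kappa l.+1 (A1, A2) * (s%:C)%C ^+ l) l.+1.
  apply: (eq_ob _ (obD (obD obF' (obZ (-1) obT)) (obZ (-1) obP))) => s /=.
  by rewrite !mulN1r; ring.
by move/eqP: Ht0; apply; exact: (ob_lead_absurd obS).
Qed.

(** [l] is the least weight of an exponent, attained since weights are natural numbers. The Taylor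
    terms [p1, p2] and [r1, r2] lie on the two axes, where the weight is a multiple of [a1] or of
    [a2] alone. *)
Lemma core_order (p1 p2 r1 r2 : nat * nat) :
  nz F p1 p2 -> (p1.2 + p2.2 = 0)%N -> nz F r1 r2 -> (r1.1 + r2.1 = 0)%N ->
  forall (eta1 eta2 : Cx R -> Cx R) (c1 c2 : Cx R) (a1 a2 N : nat),
  (0 < a1)%N -> (0 < a2)%N -> c1 != 0 -> c2 != 0 ->
  hlead eta1 c1 a1 -> hlead eta2 c2 a2 ->
  (exists K d : R, 0 < d /\ forall t, cabs t < d -> `|F (eta1 t, eta2 t)| <= K * cabs t ^+ N) ->
  (N <= a1 * (p1.1 + p2.1))%N /\ (N <= a2 * (r1.2 + r2.2))%N.
Proof.
move=> nzp p0 nzr r0 eta1 eta2 c1 c2 a1 a2 N a1p a2p c10 c20 e1 e2 HN.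
pose P m : bool := `[< exists a b, nz F a b /\ (a1 * (a.1 + b.1) + a2 * (a.2 + b.2) = m)%N >].
have exP : exists m, P m.
  by exists (a1 * (p1.1 + p2.1) + a2 * (p1.2 + p2.2))%N; apply/asboolP; exists p1, p2.
case: (ex_minnP exP) => l /asboolP lex lmin.
have lmin' a b : nz F a b -> (l <= a1 * (a.1 + b.1) + a2 * (a.2 + b.2))%N.
  by move=> ab; apply: lmin; apply/asboolP; exists a, b.
have Nl := face_order a1p a2p c10 c20 e1 e2 lmin' lex HN.
split; apply: leq_trans Nl _.
  by have := lmin' _ _ nzp; rewrite p0 muln0 addn0.
by have := lmin' _ _ nzr; rewrite r0 muln0 add0n.
Qed.

End Core.

(** * Orders of curves *)

Section Orders.
Variable R : realType.
Implicit Types (nf : Cx R -> R).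

Definition bO nf (n : nat) : Prop :=
  exists K d : R, 0 < d /\ forall t, cabs t < d -> nf t <= K * cabs t ^+ n.

Lemma bigO_powP nf n : bigO_pow nf n <-> bO nf n.
Proof.
split=> [[K /nbhs_CxP[d d0 H]]|[K [d [d0 H]]]].
  by exists K, d; split => // t td; apply: H; rewrite subr0.
by exists K; apply/nbhs_CxP; exists d => // t; rewrite subr0; exact: H.
Qed.

Lemma near0P (P : Cx R -> Prop) : (\forall t \near (0 : Cx R), P t) <->
  exists2 d : R, 0 < d & forall t, cabs t < d -> P t.
Proof.
split=> [/nbhs_CxP[d d0 H]|[d d0 H]].
  by exists d => // t td; apply: H; rewrite subr0.
by apply/nbhs_CxP; exists d => // t; rewrite subr0; exact: H.
Qed.

Lemma bO_nneg nf n : bO nf n -> exists K d : R, [/\ 0 <= K, 0 < d, d <= 1 &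
  forall t, cabs t < d -> nf t <= K * cabs t ^+ n].
Proof.
move=> [K [d [d0 H]]]; exists `|K|, (Num.min d 1); split => //.
- by rewrite lt_min d0 ltr01.
- by rewrite ge_min lexx orbT.
move=> t; rewrite lt_min => /andP[/H h _]; apply: le_trans h _.
by rewrite ler_wpM2r ?exprn_ge0 ?cabs_ge0// ler_norm.
Qed.

Lemma bO_weaken nf m n : (n <= m)%N -> bO nf m -> bO nf n.
Proof.
move=> nm /bO_nneg[K [d [K0 d0 d1 H]]]; exists K, d; split => // t td.
apply: le_trans (H t td) _; rewrite ler_wpM2l// ler_wiXn2l ?cabs_ge0//.
by apply: ltW; apply: lt_le_trans d1.
Qed.

Lemma bO_le nf nf' n : bO nf' n -> (exists C d : R, [/\ 0 <= C, 0 < d &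
  forall t, cabs t < d -> nf t <= C * nf' t]) -> bO nf n.
Proof.
move=> [K [d [d0 H]]] [C [e [C0 e0 H']]]; exists (C * K), (Num.min d e); split.
  by rewrite lt_min d0.
move=> t; rewrite lt_min => /andP[td te]; apply: le_trans (H' t te) _.
by rewrite -mulrA ler_wpM2l// H.
Qed.

Lemma bO_lower nf (C : R) a n : 0 < C -> (exists2 d : R, 0 < d &
  forall t, cabs t < d -> C * cabs t ^+ a <= nf t) -> bO nf n -> (n <= a)%N.
Proof.
move=> C0 [d d0 H] nfn; rewrite leqNgt; apply/negP => an.
have [K [e [K0 e0 _ H']]] := bO_nneg (bO_weaken an nfn).
pose s := Num.min (Num.min (d / 2) (e / 2)) (C / (2 * (K + 1))).
have K1 : 0 < K + 1 by rewrite ltr_wpDl.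
have s0 : 0 < s by rewrite !lt_min !divr_gt0// mulr_gt0.
have : [/\ s <= d / 2, s <= e / 2 & s <= C / (2 * (K + 1))] by rewrite !ge_min !lexx !orbT.
rewrite !ler_pdivlMr ?mulr_gt0// => -[s1 s2 s3].
have cs : cabs ((s%:C)%C : Cx R) = s by rewrite cabs_real ger0_norm// ltW.
have h1 := H (s%:C)%C; have h2 := H' (s%:C)%C; rewrite cs in h1 h2.
have := le_trans (h1 (ltac:(lra))) (h2 (ltac:(lra))).
rewrite exprS mulrA ler_pM2r ?exprn_gt0// => h.
have Ks : 0 <= K * s by rewrite mulr_ge0// ltW.
by lra.
Qed.

Lemma ord0_exact nf a : (forall n, bO nf n <-> (n <= a)%N) -> Defs.ord0 nf = (a%:R)%:E.
Proof.
move=> H; apply/eqP; rewrite eq_le; apply/andP; split.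
  apply: ge_ereal_sup => _ [n /= /bigO_powP/H na <-].
  by rewrite lee_fin ler_nat.
by apply: ereal_sup_ubound; exists a => //=; apply/bigO_powP/H.
Qed.

Lemma ord0_infty nf : (forall n, bO nf n) -> Defs.ord0 nf = +oo%E.
Proof.
move=> H; apply/eqyP => A A0.
have [n An] : exists n : nat, A <= n%:R.
  by exists (Num.truncn A).+1; rewrite ltW// truncnS_gt.
apply: (@le_trans _ _ (n%:R)%:E); first by rewrite lee_fin.
by apply: ereal_sup_ubound; exists n => //=; apply/bigO_powP.
Qed.

Lemma ord0_ge nf n : bO nf n -> ((n%:R)%:E <= Defs.ord0 nf)%E.
Proof. by move=> H; apply: ereal_sup_ubound; exists n => //=; apply/bigO_powP. Qed.

Lemma ord0_le nf (B : R) : (forall n, bO nf n -> n%:R <= B) -> (Defs.ord0 nf <= B%:E)%E.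
Proof.
by move=> H; apply: ge_ereal_sup => _ [n /= /bigO_powP/H nB <-]; rewrite lee_fin.
Qed.

(** The two-sided comparison determines [ord_curve], and its lower half is what limits the orders of
    the components after a change of coordinates. *)
Definition curve_order (g : Cx R -> C2 R) (p : C2 R) (a : nat) : Prop :=
  exists C K d : R, [/\ 0 < C, 0 <= K, 0 < d & forall t, cabs t < d ->
    C * cabs t ^+ a <= nrm2 (g t - p) <= K * cabs t ^+ a].

Lemma curve_order_bO g p a n : curve_order g p a -> bO (fun t => nrm2 (g t - p)) n <-> (n <= a)%N.
Proof.
move=> [C [K [d [C0 K0 d0 H]]]]; split.
  by apply: (bO_lower C0); exists d => // t /H/andP[].
by move=> na; apply: (bO_weaken na); exists K, d; split => // t /H/andP[].
Qed.

Lemma curve_order_ord g p a : curve_order g p a -> ord_curve p g = (a%:R)%:E.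
Proof. by move=> H; apply: ord0_exact => n; exact: curve_order_bO. Qed.

Lemma hlead_lower f c a : c != 0 -> hlead f c a -> exists2 d : R, 0 < d &
  forall t : Cx R, cabs t < d -> cabs c / 2 * cabs t ^+ a <= cabs (f t).
Proof.
rewrite -cabs_gt0 => c0 [K [d [d0 H]]].
exists (Num.min d (cabs c / (2 * (`|K| + 1)))).
  by rewrite lt_min d0 divr_gt0// mulr_gt0// ltr_wpDl.
move=> t; rewrite lt_min ltr_pdivlMr ?mulr_gt0 ?ltr_wpDl// => /andP[td tK].
have := H t td; have := cabs_sub (c * t ^+ a) (c * t ^+ a - f t).
rewrite (_ : c * t ^+ a - (c * t ^+ a - f t) = f t); last by ring.
rewrite (cabsC (c * t ^+ a)) cabsM cabsX exprS.
have : K * (cabs t * cabs t ^+ a) <= cabs c / 2 * cabs t ^+ a.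
  rewrite mulrA ler_wpM2r ?exprn_ge0 ?cabs_ge0//.
  have : K * cabs t <= `|K| * cabs t by rewrite ler_wpM2r ?cabs_ge0// ler_norm.
  by have := cabs_ge0 t; lra.
by lra.
Qed.

Lemma hlead_upper f c a : hlead f c a -> bO (fun t : Cx R => cabs (f t)) a.
Proof.
move=> [K [d [d0 H]]]; exists (`|K| + cabs c), (Num.min d 1); split.
  by rewrite lt_min d0 ltr01.
move=> t; rewrite lt_min => /andP[td t1].
rewrite -(subrK (c * t ^+ a) (f t)); apply: le_trans (cabsD _ _) _.
rewrite mulrDl cabsM cabsX lerD2r; apply: le_trans (H t td) _.
rewrite exprS mulrA ler_wpM2r ?exprn_ge0 ?cabs_ge0//.
apply: (@le_trans _ _ (`|K| * cabs t)); first by rewrite ler_wpM2r ?cabs_ge0// ler_norm.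
by rewrite ler_piMr// ltW.
Qed.

Lemma holo_hlead (f : Cx R -> Cx R) : (\forall t \near (0 : Cx R), derivable f t 1) -> f 0 = 0 ->
  (\forall t \near (0 : Cx R), f t = 0) \/
  exists (a : nat) (c : Cx R), [/\ (0 < a)%N, c != 0 & hlead f c a].
Proof.
move=> fd f0; have [?|[a [c [K [d [c0 d0 H]]]]]] := holo_lead fd; first by left.
right; exists a, c; split => //; last by exists K, d.
case: a H => // H; have := H 0; rewrite f0 sub0r cabs0 expr0 mulr1 cabsN expr1 mulr0 => /(_ d0).
by rewrite le_eqVlt ltNge cabs_ge0 orbF cabs_eq0 (negbTE c0).
Qed.

Lemma derivable_comp1 (g : Cx R -> C2 R) (t : Cx R) : derivable g t 1 ->
  derivable (fun s => (g s).1 : Cx R) t 1 /\ derivable (fun s => (g s).2 : Cx R) t 1.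
Proof.
have f1 (z : C2 R) : differentiable (fst : C2 R -> Cx R) z.
  by apply: linear_differentiable => ?; exact: cvg_fst.
have f2 (z : C2 R) : differentiable (snd : C2 R -> Cx R) z.
  by apply: linear_differentiable => ?; exact: cvg_snd.
by move=> gd; split; [exact: (ball_comp (f1 (g t)) gd)|exact: (ball_comp (f2 (g t)) gd)].
Qed.

Lemma derivable_diff1 (g : Cx R -> Cx R) (t : Cx R) : derivable g t 1 -> differentiable g t.
Proof. by move=> /derivable1_diffP. Qed.

Lemma diff1_derivable (g : Cx R -> C2 R) (t : Cx R) : differentiable g t -> derivable g t 1.
Proof. by move=> /derivable1_diffP. Qed.

Lemma derivable_pair (g1 g2 : Cx R -> Cx R) (t : Cx R) : derivable g1 t 1 -> derivable g2 t 1 ->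
  derivable (fun s => (g1 s, g2 s) : C2 R) t 1.
Proof.
move=> h1 h2; have d1 := derivable_diff1 h1; have d2 := derivable_diff1 h2.
have d3 : differentiable (fun s => (g1 s, g2 s) : C2 R) t := differentiable_pair d1 d2.
exact: (diff1_derivable d3).
Qed.

Lemma cder_shift (f : Cx R -> Cx R) (c t : Cx R) : derivable f t 1 -> derivable (fun s => f s - c) t 1.
Proof.
move=> fd; have h : derivable (fun _ : Cx R => c) t (1 : Cx R) by exact: derivable_cst.
exact: (derivableB fd h).
Qed.

(** The component with the smaller leading exponent decides; one that vanishes identically is [O] of
    any power. Both cannot vanish, since [g] is not constant. *)
Lemma Gamma_order (g : Cx R -> C2 R) p : Gamma p g ->
  exists2 a, (0 < a)%N & curve_order g p a.
Proof.
move=> [g0 /near0P[d d0 gd] gn].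
pose f1 t : Cx R := (g t).1 - p.1; pose f2 t : Cx R := (g t).2 - p.2.
have f1d : \forall t \near (0 : Cx R), derivable f1 t 1.
  by apply/near0P; exists d => // t /gd/derivable_comp1[h _]; exact: cder_shift.
have f2d : \forall t \near (0 : Cx R), derivable f2 t 1.
  by apply/near0P; exists d => // t /gd/derivable_comp1[_ h]; exact: cder_shift.
have f10 : f1 0 = 0 by rewrite /f1 g0 subrr.
have f20 : f2 0 = 0 by rewrite /f2 g0 subrr.
have nE t : nrm2 (g t - p) = Num.max (cabs (f1 t)) (cabs (f2 t)) by [].
have one (f h : Cx R -> Cx R) (a : nat) c : c != 0 -> hlead f c a -> bO (fun t => cabs (h t)) a ->
    (forall t, nrm2 (g t - p) = Num.max (cabs (f t)) (cabs (h t))) -> curve_order g p a.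
  move=> c0 fl /bO_nneg[K2 [e2 [K20 e20 _ H2]]] E.
  have [e1 e10 H1] := hlead_lower c0 fl.
  have [K3 [e3 [K30 e30 _ H3]]] := bO_nneg (hlead_upper fl).
  exists (cabs c / 2), (K2 + K3), (Num.min e1 (Num.min e2 e3)); split.
  - by rewrite divr_gt0// cabs_gt0.
  - by rewrite addr_ge0.
  - by rewrite !lt_min e10 e20.
  move=> t; rewrite !lt_min => /andP[t1 /andP[t2 t3]]; rewrite E le_max H1//= ge_max mulrDl.
  apply/andP; split.
    by apply: le_trans (H3 t t3) _; rewrite lerDr mulr_ge0 ?exprn_ge0 ?cabs_ge0.
  by apply: le_trans (H2 t t2) _; rewrite lerDl mulr_ge0 ?exprn_ge0 ?cabs_ge0.
have zero_bO (h : Cx R -> Cx R) a : (\forall t \near (0 : Cx R), h t = 0) -> bO (fun t => cabs (h t)) a.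
  by move=> /near0P[e e0 H]; exists 0, e; split => // t /H ->; rewrite cabs0 mul0r.
have [z1|[a1 [c1 [a10 c10 l1]]]] := holo_hlead f1d f10; have [z2|[a2 [c2 [a20 c20 l2]]]] := holo_hlead f2d f20.
- exfalso; apply: gn; move: z1 z2 => /near0P[e1 e10 H1] /near0P[e2 e20 H2].
  apply/near0P; exists (Num.min e1 e2); first by rewrite lt_min e10.
  move=> t; rewrite lt_min => /andP[/H1/eqP + /H2/eqP]; rewrite !subr_eq0 => /eqP h1 /eqP h2.
  by rewrite [g t]surjective_pairing h1 h2 -surjective_pairing.
- exists a2 => //; apply: (one f2 f1 a2 c2) => //; first exact: zero_bO.
  by move=> t; rewrite nE maxC.
- by exists a1 => //; apply: (one f1 f2 a1 c1) => //; exact: zero_bO.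
- have [le12|/ltnW le21] := leqP a1 a2.
    by exists a1 => //; apply: (one f1 f2 a1 c1) => //; exact: (bO_weaken le12 (hlead_upper l2)).
  exists a2 => //; apply: (one f2 f1 a2 c2) => //; first exact: (bO_weaken le21 (hlead_upper l1)).
  by move=> t; rewrite nE maxC.
Qed.

End Orders.

(** * Changes of coordinates *)

Section Coordinates.
Variable R : realType.

Lemma nrm20 : nrm2 (0 : C2 R) = 0.
Proof. by rewrite /nrm2 cabs0 maxxx. Qed.

Lemma holo_coord_inv (p : C2 R) (Phi : C2 R -> C2 R) (U : set (C2 R)) : holo_coord p Phi U ->
  exists Psi : C2 R -> C2 R,
  [/\ Psi 0 = p, (Phi @` U) 0, forall w, (Phi @` U) w -> differentiable Psi w,
      forall w, (Phi @` U) w -> U (Psi w) /\ Phi (Psi w) = w & forall z, U z -> Psi (Phi z) = z].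
Proof.
move=> [[Uo Up] Phip Pd Vo [Psi [Psid PsiK]]]; exists Psi; split => //.
- by rewrite -Phip PsiK.
- by exists p.
- by move=> w [z Uz <-]; rewrite PsiK.
Qed.

Lemma near_in_open (W : set (C2 R)) (q : C2 R) (P : C2 R -> Prop) : open W -> W q ->
  (forall z, W z -> P z) -> \forall z \near q, P z.
Proof.
move=> Wo Wq H; have : nbhs q W by exact: open_nbhs_nbhs.
by apply: filterS.
Qed.

Lemma comp_curve (T : C2 R -> C2 R) (g : Cx R -> C2 R) (t : Cx R) :
  differentiable T (g t) -> derivable g t 1 -> derivable (T \o g) t 1.
Proof.
move=> Td /derivable1_diffP gd; apply/derivable1_diffP.
exact: differentiable_comp.
Qed.

Lemma lt_double_slope (L s : R) : 0 <= L -> 0 < s -> L * s < s * (2 * (L + 1)).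
Proof. by move=> L0 s0; rewrite mulrC ltr_pM2l//; lra. Qed.

Lemma lt_of_double_le (s d : R) : 0 < s -> s * 2 <= d -> s < d.
Proof. by move=> ? ?; lra. Qed.

Section Fixed.
Variables (M : set (C2 R)) (p : C2 R) (r : C2 R -> R).
Variables (Phi Psi : C2 R -> C2 R) (U : set (C2 R)) (rho : C2 R -> R).
Hypothesis Mp : M p.
Hypothesis rdef : local_defining_function M p r.
Hypothesis hc : holo_coord p Phi U.
Hypothesis rhodef : local_defining_function (Phi @` (M `&` U)) 0 rho.
Hypothesis Psi0 : Psi 0 = p.
Hypothesis V0 : (Phi @` U) 0.
Hypothesis Psid : forall w, (Phi @` U) w -> differentiable Psi w.
Hypothesis PsiU : forall w, (Phi @` U) w -> U (Psi w) /\ Phi (Psi w) = w.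
Hypothesis PsiK : forall z, U z -> Psi (Phi z) = z.

Let Uo : open U. Proof. by case: hc => [[]]. Qed.
Let Up : U p. Proof. by case: hc => [[]]. Qed.
Let Phip : Phi p = 0. Proof. by case: hc. Qed.
Let Phid z : U z -> differentiable Phi z. Proof. by case: hc => _ _ + _ _; apply. Qed.
Let Vo : open (Phi @` U). Proof. by case: hc. Qed.

Lemma coord_image0 : (Phi @` (M `&` U)) 0. Proof. by exists p. Qed.

Lemma compare_fwd : exists C d : R, [/\ 0 <= C, 0 < d &
  forall z, nrm2 (z - p) < d -> `|rho (Phi z)| <= C * `|r z|].
Proof.
have h1 : \forall z \near p, differentiable Phi z := near_in_open Uo Up Phid.
have h2 : \forall z \near p, M z -> (Phi @` (M `&` U)) (Phi z).
  by apply: (near_in_open Uo Up) => z Uz Mz; exists z.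
exact: (defining_compare rdef Mp rhodef Phip h1 h2).
Qed.

Lemma compare_bwd : exists C d : R, [/\ 0 <= C, 0 < d &
  forall w, nrm2 w < d -> `|r (Psi w)| <= C * `|rho w|].
Proof.
have h1 : \forall w \near (0 : C2 R), differentiable Psi w := near_in_open Vo V0 Psid.
have h2 : \forall w \near (0 : C2 R), (Phi @` (M `&` U)) w -> M (Psi w).
  by apply: (near_in_open Vo V0) => w _ [z [Mz Uz] <-]; rewrite PsiK.
have [C [d [C0 d0 H]]] := defining_compare rhodef coord_image0 rdef Psi0 h1 h2.
by exists C, d; split => // w wd; apply: H; rewrite subr0.
Qed.

Lemma Phi_lip : exists L d : R, [/\ 0 <= L, 0 < d &
  forall z, nrm2 (z - p) < d -> nrm2 (Phi z) <= L * nrm2 (z - p)].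
Proof.
have [L [d [L0 d0 H]]] := holo2_lipschitz (near_in_open Uo Up Phid).
exists L, d; split => // z zd; have := H z p zd; rewrite Phip !subr0 subrr nrm20.
by apply.
Qed.

Lemma Psi_lip : exists L d : R, [/\ 0 <= L, 0 < d &
  forall w, nrm2 w < d -> nrm2 (Psi w - p) <= L * nrm2 w].
Proof.
have [L [d [L0 d0 H]]] := holo2_lipschitz (near_in_open Vo V0 Psid).
exists L, d; split => // w wd; have := H w 0; rewrite !subr0 Psi0 nrm20; exact.
Qed.

Lemma V_ball : exists2 d : R, 0 < d & forall w, nrm2 w < d -> (Phi @` U) w.
Proof.
have /nbhs_C2P[d d0 Hd] : nbhs (0 : C2 R) (Phi @` U) by exact: open_nbhs_nbhs.
by exists d => // w wd; apply: Hd; rewrite subr0.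
Qed.

(** [j] parametrizes one of the axes. Lipschitz bounds for [Phi] and [Psi] in both directions
    preserve order 1, and [compare_bwd] carries flatness of [rho] over to [r]. *)
Lemma axis_curve (j : Cx R -> C2 R) : (forall t, nrm2 (j t) = cabs t) ->
  (forall t : Cx R, derivable j t 1) -> (forall n, bO (fun t => `|rho (j t)|) n) ->
  exists g, Gamma_reg p g /\ tangent_inf r g.
Proof.
move=> jn jd flat; exists (Psi \o j).
have j0 : j 0 = 0 by apply: nrm2_eq0; rewrite jn cabs0.
have [dV dV0 HV] := V_ball.
have order : curve_order (Psi \o j) p 1.
  have [L1 [d1 [L10 d10 H1]]] := Phi_lip; have [L2 [d2 [L20 d20 H2]]] := Psi_lip.
  have L11 : 0 < L1 + 1 by rewrite ltr_wpDl.
  have L21 : 0 < L2 + 1 by rewrite ltr_wpDl.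
  exists ((L1 + 1)^-1), L2, (Num.min (Num.min d2 dV) (d1 / (L2 + 1))); split => //.
  - by rewrite invr_gt0.
  - by rewrite !lt_min d20 dV0 divr_gt0.
  move=> t; rewrite !lt_min ltr_pdivlMr// expr1 /= => /andP[/andP[t2 tV] t1].
  have h2 := H2 (j t); rewrite jn in h2; have {}h2 := h2 t2.
  rewrite h2 andbT ler_pdivrMl//.
  have tV' : (Phi @` U) (j t) by apply: HV; rewrite jn.
  have [_ PK] := PsiU tV'.
  have h1 := H1 (Psi (j t)); rewrite PK jn in h1.
  apply: le_trans (h1 _) _; last by rewrite ler_wpM2r ?nrm2_ge0// lerDl.
  apply: le_lt_trans h2 _; apply: le_lt_trans t1.
  by rewrite mulrC ler_wpM2l ?cabs_ge0// lerDl.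
have gG : Gamma p (Psi \o j).
  split; first by rewrite /= j0.
    apply/near0P; exists dV => // t td; have VJ : (Phi @` U) (j t) by apply: HV; rewrite jn.
    exact: (comp_curve (Psid VJ) (jd t)).
  move=> gp; have := (curve_order_bO 2 order).1; move=> H.
  suff : (2 <= 1)%N by []. apply: H.
  move/near0P : gp => [d d0 Hd]; exists 0, d; split => // t td.
  by rewrite Hd// subrr nrm20 mul0r.
split; first by split => //; rewrite (curve_order_ord order).
move=> n; apply/bigO_powP; have [C [d [C0 d0 H]]] := compare_bwd.
apply: bO_le (flat n) _; exists C, d; split => // t td.
by apply: H; rewrite jn.
Qed.

(** The same curve, the preimage of the axis [pi2 = 0], serves for every [m]. The projections [pi1],
    [pi2] and the unit vector [e] transversal to the axis let one proof cover both axes. *)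
Lemma axis_hypersurface (j : Cx R -> C2 R) (pi1 pi2 : C2 R -> Cx R) (e : C2 R) :
  (forall w, pi2 w = 0 -> w = j (pi1 w)) -> (forall w, cabs (pi1 w) <= nrm2 w) ->
  (forall w, differentiable pi2 w) -> (forall w s, pi2 (w + s *: e) = pi2 w + s) ->
  pi2 0 = 0 -> nrm2 e = 1 -> (forall n, bO (fun t => `|rho (j t)|) n) ->
  BG_type_infinite r p.
Proof.
move=> jE pi1le pi2d pi2e pi20 e1 flat m.
pose h z := pi2 (Phi z).
have hd z : U z -> differentiable h z.
  by move=> Uz; exact: (differentiable_comp (Phid Uz) (pi2d (Phi z))).
exists [set z | U z /\ h z = 0]; split.
- move=> q [Uq hq]; exists U, h; split => //.
    by apply/seteqP; split => [z [[? ?] ?]|z [? ?]].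
  have [a [b [Da Heps]]] := differentiable_eps (hd q Uq).
  have [/andP[/eqP a0 /eqP b0]|ab] := boolP ((a == 0) && (b == 0)); last first.
    move: ab; rewrite negb_and => /orP[an|bn].
      by exists (1, 0); rewrite Da /= mulr1 mulr0 addr0.
    by exists (0, 1); rewrite Da /= mulr1 mulr0 add0r.
  (* A vanishing differential would make [Psi] fail to be Lipschitz at [Phi q]. *)
  exfalso; pose w0 := Phi q.
  have Vw0 : (Phi @` U) w0 by exists q.
  have [L [d [L0 d0 HL]]] := holo2_lipschitz (near_in_open Vo Vw0 Psid).
  have L1 : 0 < 2 * (L + 1) by rewrite mulr_gt0// ltr_wpDl.
  have /nbhs_C2P[d1 d10 Hd1] : nbhs w0 (Phi @` U) by exact: open_nbhs_nbhs.
  have [d2 d20 Hd2] := Heps (2 * (L + 1))^-1 (etrans (invr_gt0 _) L1).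
  pose s := Num.min (Num.min (d / 2) (d1 / 2)) (d2 / (2 * (L + 1))).
  have s0 : 0 < s by rewrite !lt_min !divr_gt0.
  have : [/\ s <= d / 2, s <= d1 / 2 & s <= d2 / (2 * (L + 1))] by rewrite !ge_min !lexx !orbT.
  rewrite !ler_pdivlMr// => -[s1 s2 s3].
  (* Moving from [w0] by [s] along [e] changes [h] by exactly [s], whereas a vanishing differential
     allows at most [L * s / (2 * (L + 1)) < s]. *)
  pose w := w0 + (s%:C)%C *: e.
  have ns : nrm2 (w - w0) = s.
    by rewrite /w addrC addKr nrm2Z e1 mulr1 cabs_real ger0_norm// ltW.
  have sd : s < d by exact: lt_of_double_le s0 s1.
  have sd1 : s < d1 by exact: lt_of_double_le s0 s2.
  have Vw : (Phi @` U) w by apply: Hd1; rewrite ns.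
  have [UPw PhiPw] := PsiU Vw.
  have Ld : nrm2 (Psi w - q) <= L * s.
    have := HL w w0; rewrite ns (PsiK Uq) subrr nrm20; exact.
  have := Hd2 (Psi w - q).
  rewrite (_ : q + (Psi w - q) = Psi w); last by rewrite addrC subrK.
  have -> : h (Psi w) = (s%:C)%C by rewrite /h PhiPw pi2e -[pi2 w0]/(h q) hq add0r.
  rewrite hq subr0 a0 b0 !mul0r addr0 subr0 cabs_real ger0_norm ?(ltW s0)// => H.
  have {}H := H (le_lt_trans Ld (lt_le_trans (lt_double_slope L0 s0) s3)).
  have := le_trans H (ler_wpM2l (ltW (etrans (invr_gt0 _) L1)) Ld).
  by rewrite ler_pdivlMl// => K; have := lt_le_trans (lt_double_slope L0 s0) (eq_ind_r (fun x => x <= _) K (mulrC _ _)); rewrite ltxx.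
- split; first exact: Up.
  by rewrite /h Phip pi20.
have [C [d [C0 d0 HC]]] := compare_bwd.
have [L [d1 [L0 d10 HL]]] := Phi_lip.
have [K [d2 [K0 d20 _ HK]]] := bO_nneg (flat m).
have L1 : 0 < L + 1 by rewrite ltr_wpDl.
exists (C * (K * L ^+ m)); apply/nbhs_C2P.
exists (Num.min d1 (Num.min d d2 / (L + 1))).
  by rewrite lt_min d10 divr_gt0// lt_min d0.
move=> z; rewrite lt_min ltr_pdivlMr// => /andP[zd1 zd] [Uz hz].
have nP := HL z zd1.
have : nrm2 (Phi z) < Num.min d d2.
  by apply: le_lt_trans nP _; apply: le_lt_trans zd; rewrite mulrC ler_wpM2l ?nrm2_ge0// lerDl.
rewrite lt_min => /andP[Pd Pd2].
have := HC (Phi z) Pd; rewrite PsiK// => /le_trans; apply.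
rewrite -!mulrA ler_wpM2l// (jE _ hz).
have Pi : cabs (pi1 (Phi z)) <= L * nrm2 (z - p) by apply: le_trans nP; exact: pi1le.
apply: le_trans (HK _ _) _; first exact: le_lt_trans (pi1le _) Pd2.
by rewrite ler_wpM2l// -exprMn lerXn2r ?nnegrE ?cabs_ge0// mulr_ge0 ?nrm2_ge0.
Qed.

End Fixed.
End Coordinates.

(** * Exchange of the two coordinates *)

Section Swap.
Variable R : realType.

(** The half plane [xi.2 >= 1] singles out the second coordinate. When the Taylor series vanishes on
    the axis [z.1 = 0], the coordinates have to be exchanged first. *)
Definition swap2 (z : C2 R) : C2 R := (z.2, z.1).
Definition swap4 (x : R4 R) : R4 R := (x.2, x.1).

Lemma swap2K z : swap2 (swap2 z) = z. Proof. by case: z. Qed.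
Lemma swap4K x : swap4 (swap4 x) = x. Proof. by case: x. Qed.

Lemma derive_swap (f : R4 R -> R) x v :
  'D_v (f \o swap4) x = 'D_(swap4 v) f (swap4 x).
Proof. by case: x v => [x1 x2] [v1 v2]. Qed.

Lemma derivable_swap (f : R4 R -> R) x v :
  derivable f (swap4 x) (swap4 v) -> derivable (f \o swap4) x v.
Proof. by case: x v => [x1 x2] [v1 v2]. Qed.

Lemma swap_continuous (f : R4 R -> R) x :
  {for swap4 x, continuous f} -> {for x, continuous (f \o swap4)}.
Proof.
move=> /R4_continuousP H; apply/R4_continuousP => e e0; have [d d0 Hd] := H e e0.
exists d => // y yx; apply: Hd.
have -> : swap4 y - swap4 x = swap4 (y - x) by [].
by move: yx; rewrite -!nrm_R4E /nrm_R4 /= maxC.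
Qed.

Lemma iterD_swap (f : R4 R -> R) vs :
  Defs.iterD vs (f \o swap4) = Defs.iterD (map swap4 vs) f \o swap4.
Proof.
elim: vs => [//|v vs IH]; apply/funext => x.
rewrite -[LHS]/('D_v (Defs.iterD vs (f \o swap4)) x) IH.
exact: derive_swap.
Qed.

Lemma smooth_swap (f : R4 R -> R) (U : set (R4 R)) : smooth_on f U ->
  smooth_on (f \o swap4) (swap4 @^-1` U).
Proof.
move=> fs vs; rewrite iterD_swap; split=> [x Ux|x v Ux].
  by apply: swap_continuous; have [+ _] := fs (map swap4 vs); apply.
by apply: derivable_swap; have [_ +] := fs (map swap4 vs); apply.
Qed.

Lemma cD_swap w (G : R4 R -> R[i]) x : cD w (G \o swap4) x = cD (swap4 w) G (swap4 x).
Proof.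
exact: (f_equal2 (fun a b => (a +i* b)%C) (derive_swap (fun y => complex.Re (G y)) x w)
  (derive_swap (fun y => complex.Im (G y)) x w)).
Qed.

Lemma wirt_swap s u v (G : R4 R -> R[i]) :
  wirt s u v (G \o swap4) = wirt s (swap4 u) (swap4 v) G \o swap4.
Proof.
apply/funext => x.
exact: (f_equal2 (fun a b : R[i] => (a + s%:C%C * 'i%C * b) / 2) (cD_swap u G x) (cD_swap v G x)).
Qed.

Lemma iter_wirt_swap n s u v (G : R4 R -> R[i]) :
  iter n (wirt s u v) (G \o swap4) = iter n (wirt s (swap4 u) (swap4 v)) G \o swap4.
Proof.
elim: n => [//|n IH].
exact: (etrans (congr1 (wirt s u v) IH) (wirt_swap s u v _)).
Qed.

(** The commutation holds on [U] only, so [f] has to respect equality on [U]; this is the first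
    hypothesis. *)
Lemma iter_comm_on (T X : Type) (U : set T) (P : (T -> X) -> Prop)
    (f g : (T -> X) -> (T -> X)) (G : T -> X) n x :
  (forall H K y, U y -> (forall z, U z -> H z = K z) -> f H y = f K y) ->
  (forall H, P H -> P (f H)) ->
  (forall H y, P H -> U y -> f (g H) y = g (f H) y) -> P G -> U x ->
  iter n f (g G) x = g (iter n f G) x.
Proof.
move=> fext Pf fg; elim: n x => [//|n IH] x PG Ux.
rewrite !iterS (fext _ _ x Ux (fun z Uz => IH z PG Uz)).
by apply: fg => //; elim: n {IH} => [//|n]; exact: Pf.
Qed.

Lemma iter_iter_wirt_comm (U : set (R4 R)) (Uo : open U) n m s u v t p q G x : csmooth U G -> U x ->
  iter n (wirt s u v) (iter m (wirt t p q) G) x = iter m (wirt t p q) (iter n (wirt s u v) G) x.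
Proof.
exact: (iter_comm_on n (fun H K y => @wirt_ext R U Uo s u v H K y)
  (fun H => csmooth_iter Uo 1 s u v (G := H))
  (fun H y => @wirt_iter_comm R U Uo m s u v t p q H y)).
Qed.

(** The exchange puts the derivations of the two variables in the opposite order; commutation of
    Wirtinger derivatives on [U] restores it. *)
Lemma wder_swap (U : set (R4 R)) (F : C2 R -> R) a1 a2 b1 b2 : open U -> U 0 ->
  smooth_on (realify F) U -> wder (F \o swap2) a1 a2 b1 b2 0 = wder F a2 a1 b2 b1 0.
Proof.
move=> Uo U0 Fs; set G := fun x => ((realify F x)%:C)%C.
have E1 := iter_wirt_swap b2 1 (ex2 R) (ey2 R) G.
have E2 := etrans (congr1 (iter b1 (wirt 1 (ex1 R) (ey1 R))) E1)
  (iter_wirt_swap b1 1 (ex1 R) (ey1 R) _).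
have E3 := etrans (congr1 (iter a2 (wirt (-1) (ex2 R) (ey2 R))) E2)
  (iter_wirt_swap a2 (-1) (ex2 R) (ey2 R) _).
have E4 := etrans (congr1 (iter a1 (wirt (-1) (ex1 R) (ey1 R))) E3)
  (iter_wirt_swap a1 (-1) (ex1 R) (ey1 R) _).
have B : csmooth U G := csmooth_base Uo Fs.
have C2 y : U y -> _ := fun Uy => iter_iter_wirt_comm Uo b1 b2 1 (ex2 R) (ey2 R) 1 (ex1 R) (ey1 R) B Uy.
have C3 := iter_wirt_ext Uo a2 (-1) (ex1 R) (ey1 R) U0
  (fun y Uy => iter_wirt_ext Uo a1 (-1) (ex2 R) (ey2 R) Uy C2).
exact: (etrans (congr1 (fun h : R4 R -> R[i] => h 0) E4)
  (etrans (iter_iter_wirt_comm Uo a1 a2 (-1) (ex2 R) (ey2 R) (-1) (ex1 R) (ey1 R) 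
    (csmooth_iter Uo b1 1 (ex2 R) (ey2 R) (csmooth_iter Uo b2 1 (ex1 R) (ey1 R) B)) U0) C3)).
Qed.

Lemma nz_swap (U : set (R4 R)) (F : C2 R -> R) (a b : nat * nat) : open U -> U 0 ->
  smooth_on (realify F) U -> nz (F \o swap2) a b -> nz F (a.2, a.1) (b.2, b.1).
Proof.
move=> Uo U0 Fs; case: a b => [a1 a2] [b1 b2]; rewrite /nz /=.
have K (H : C2 R -> R) i j k l : (taylor_coef H (i, j) (k, l) != 0) = (wder H i j k l 0 != 0).
  rewrite taylor_coefE; move: (taylor_coef _ _ _) => x; rewrite mulf_eq0 negb_or.
  by rewrite pnatr_eq0 -lt0n !muln_gt0 !fact_gt0 /= andbT.
by rewrite !K (wder_swap _ _ _ _ Uo U0 Fs).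
Qed.

Lemma nrm2_swap (z : C2 R) : nrm2 (swap2 z) = nrm2 z.
Proof. by rewrite /nrm2 /= maxC. Qed.

Lemma open_swap2 (U : set (C2 R)) : open U -> open (swap2 @^-1` U).
Proof.
rewrite !openE => Uo x /Uo /nbhs_C2P[d d0 Hd]; apply/nbhs_C2P; exists d => // y yx.
apply: Hd; have -> : swap2 y - swap2 x = swap2 (y - x) by [].
by rewrite nrm2_swap.
Qed.

Lemma differentiable_swap (z : C2 R) : differentiable swap2 z.
Proof. exact: (differentiable_pair (differentiable_snd z) (differentiable_fst z)). Qed.

Lemma swap_image (T : Type) (f : T -> C2 R) (A : set T) :
  (swap2 \o f) @` A = swap2 @^-1` (f @` A).
Proof.
apply/seteqP; split => [_ [x Ax <-]|w [x Ax fx]].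
  by exists x => //; rewrite /= swap2K.
by exists x => //=; rewrite fx swap2K.
Qed.

Lemma holo_coord_swap (p : C2 R) Phi (U : set (C2 R)) :
  holo_coord p Phi U -> holo_coord p (swap2 \o Phi) U.
Proof.
move=> [[Uo Up] Phip Pd Vo [Psi [Psid PsiK]]]; split.
- by [].
- by rewrite /= Phip.
- by move=> z Uz; exact: (differentiable_comp (Pd z Uz) (differentiable_swap (Phi z))).
- by rewrite swap_image; exact: open_swap2.
exists (Psi \o swap2); split=> [w|z Uz]; last by rewrite /= swap2K PsiK.
rewrite swap_image => Vw.
exact: (differentiable_comp (differentiable_swap w) (Psid _ Vw)).
Qed.

Lemma ldf_swap (S : set (C2 R)) (rho : C2 R -> R) :
  local_defining_function S 0 rho ->
  local_defining_function (swap2 @^-1` S) 0 (rho \o swap2).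
Proof.
move=> [W [Wo W0 Ws SW G]]; exists (swap2 @^-1` W); split.
- exact: open_swap2.
- by [].
- exact: (smooth_swap Ws).
- apply/seteqP; split=> [z [Sz Wz]|z [Wz rz]].
    have : (S `&` W) (swap2 z) by [].
    by rewrite SW => -[].
  have : [set z | W z /\ rho z = 0] (swap2 z) by [].
  by rewrite -SW => -[].
- move=> z Sz Wz; have [v Dv] := G (swap2 z) Sz Wz.
  exists (swap4 v); rewrite -[realify (rho \o swap2)]/(realify rho \o swap4).
  by rewrite derive_swap swap4K.
Qed.

End Swap.

(** * Parametrization of smooth complex curves *)

Section ComplexCurves.
Variable R : realType.

Lemma differentiable_idC2 (z : C2 R) : differentiable (fun w : C2 R => w) z.
Proof.
have e : (fun w : C2 R => (w.1, w.2)) = (fun w : C2 R => w) by apply/funext => -[].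
exact: (eq_ind _ (fun f : C2 R -> C2 R => differentiable f z)
  (differentiable_pair (differentiable_fst z) (differentiable_snd z)) _ e).
Qed.

Lemma differentiable_translate (q z : C2 R) : differentiable (fun w : C2 R => q + w) z.
Proof.
have h1 : differentiable (fun _ : C2 R => q) z by exact: differentiable_cst.
exact: (differentiableD h1 (differentiable_idC2 z)).
Qed.

Lemma derive_translate (h : C2 R -> Cx R) (q v : C2 R) :
  'D_v (fun w => h (q + w)) 0 = 'D_v h q.
Proof.
have E : (fun k : Cx R => k^-1 *: (((fun w => h (q + w)) \o shift 0) (k *: v) - h (q + 0))) =
  (fun k => k^-1 *: ((h \o shift q) (k *: v) - h q)).
  by apply/funext => k /=; rewrite !addr0 (addrC q).
exact: (congr1 (fun f : Cx R -> Cx R => lim (f @ 0^')) E).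
Qed.

Lemma derive_translate_swap (h : C2 R -> Cx R) (q v : C2 R) :
  'D_v (fun w => h (q + swap2 w)) 0 = 'D_(swap2 v) h q.
Proof.
have E : (fun k : Cx R => k^-1 *: (((fun w => h (q + swap2 w)) \o shift 0) (k *: v) - h (q + swap2 0))) =
  (fun k => k^-1 *: ((h \o shift q) (k *: swap2 v) - h q)).
  apply/funext => k /=; rewrite addr0 (_ : q + swap2 (0 : C2 R) = q) ?(addrC q)//.
  exact: (add0r q).
exact: (congr1 (fun f : Cx R -> Cx R => lim (f @ 0^')) E).
Qed.

(** The implicit function theorem writes the curve as a graph [(t, phi t)] over the other variable;
    [phi t = O(t)] makes the order equal to 1. *)
Lemma complex_curve_param (X : set (C2 R)) (p : C2 R) : complex_curve X -> X p ->
  exists g : Cx R -> C2 R, [/\ Gamma p g, curve_order g p 1 & \forall t \near (0 : Cx R), X (g t)].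
Proof.
move=> Xc Xp; have [U [h [Uo Up hd XU [v hv]]]] := Xc p Xp.
have h0 : h p = 0 by have : (X `&` U) p by []; rewrite XU => -[].
have hinX z : U z -> h z = 0 -> X z.
  by move=> Uz hz; have : [set z | U z /\ h z = 0] z by []; rewrite -XU => -[].
have /nbhs_C2P[dU dU0 HU] : nbhs p U by exact: open_nbhs_nbhs.
(* [S] is the identity or [swap2], chosen so that the derivative in the second variable does not
   vanish. *)
have key (S : C2 R -> C2 R) : (forall z, nrm2 (S z) = nrm2 z) -> S 0 = 0 ->
    (forall z, differentiable S z) -> 'D_(0, 1) (fun w => h (p + S w)) 0 != 0 ->
    exists g : Cx R -> C2 R, [/\ Gamma p g, curve_order g p 1 & \forall t \near (0 : Cx R), X (g t)].
  move=> Sn S0 Sd HD.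
  have pS z : nrm2 (p + S z - p) = nrm2 z by rewrite addrC addKr Sn.
  have Hd : \forall z \near (0 : C2 R), differentiable (fun w => h (p + S w)) z.
    apply/nbhs_C2P; exists dU; first exact: dU0.
    move=> z; rewrite subr0 => zd.
    have Uz : U (p + S z) by apply: HU; rewrite pS.
    have d1 : differentiable (fun w => p + S w) z.
      exact: (differentiable_comp (Sd z) (differentiable_translate p (S z))).
    exact: (differentiable_comp d1 (hd _ Uz)).
  have H0 : h (p + S 0) = 0 by rewrite S0 addr0.
  have [phi [phi0 /near0P[d1 d10 phid] /near0P[d2 d20 phiz]]] := implicit_function Hd H0 HD.
  pose j t : C2 R := (t, phi t); pose g t := p + S (j t).
  have gn t : nrm2 (g t - p) = Num.max (cabs t) (cabs (phi t)) by rewrite /g pS.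
  have jd t : cabs t < d1 -> derivable j t 1.
    move=> td; have h1 : derivable (fun s : Cx R => s) t (1 : Cx R) by exact: derivable_id.
    exact: (derivable_pair h1 (phid t td)).
  have phi00 : derivable phi 0 1 by apply: phid; rewrite cabs0.
  have [l Hl] := derivable_cder phi00.
  have [d3 d30 H3] := Hl 1 ltr01.
  have phile t : cabs t < d3 -> cabs (phi t) <= (1 + cabs l) * cabs t.
    move=> /H3; rewrite add0r phi0 subr0 mul1r => H.
    rewrite -(subrK (l * t) (phi t)); apply: le_trans (cabsD _ _) _.
    by rewrite mulrDl mul1r cabsM lerD2r.
  have order : curve_order g p 1.
    exists 1, (1 + (1 + cabs l)), d3; split => //.
      by rewrite !addr_ge0// cabs_ge0.
    move=> t /phile h3; rewrite gn mul1r expr1 le_max lexx /= ge_max.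
    have := cabs_ge0 t; have : 0 <= cabs l * cabs t by rewrite mulr_ge0 ?cabs_ge0.
    by move=> ? ?; apply/andP; split; lra.
  exists g; split; [split| |].
  - by rewrite /g /j phi0 -[(0, 0)]/(0 : C2 R) S0 addr0.
  - apply/near0P; exists d1; first exact: d10.
    move=> t td.
    have dT : differentiable (fun w => p + S w) (j t).
      exact: (differentiable_comp (Sd _) (differentiable_translate p _)).
    exact: (comp_curve dT (jd t td)).
  - move=> gp; suff : (2 <= 1)%N by []. apply: (curve_order_bO 2 order).1.
    move/near0P : gp => [d d0 Hd']; exists 0, d; split; first exact: d0.
    by move=> t td; rewrite Hd'// subrr nrm20 mul0r.
  - exact: order.
  have K0 : 0 < 2 + cabs l by have := cabs_ge0 l; lra.
  apply/near0P; exists (Num.min d2 (Num.min d3 (dU / (2 + cabs l)))).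
    by rewrite !lt_min d20 d30 divr_gt0.
  move=> t; rewrite !lt_min ltr_pdivlMr// => /andP[t2 /andP[t3 tU]].
  apply: hinX; last exact: phiz.
  apply: HU; rewrite gn gt_max; have h3 := phile t t3.
  have := cabs_ge0 t; have : 0 <= cabs l * cabs t by rewrite mulr_ge0 ?cabs_ge0.
  by move=> ? ?; apply/andP; split; lra.
have [a [b [Da _]]] := differentiable_eps (hd p Up).
have [b0|bn] := eqVneq b 0.
  apply: (key (@swap2 R)).
  - exact: nrm2_swap.
  - by [].
  - exact: differentiable_swap.
  rewrite derive_translate_swap Da /= mulr1 mulr0 addr0.
  by apply/negP => /eqP a0; move: hv; rewrite Da a0 b0 !mul0r addr0 eqxx.
apply: (key (fun z => z)).
- by [].
- by [].
- exact: differentiable_idC2.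
by rewrite derive_translate Da /= mulr1 mulr0 add0r.
Qed.

End ComplexCurves.

(** * Taylor series that vanish on a coordinate axis *)

Section Axes.
Variable R : realType.

Section Flat.
Variable U : set (R4 R).
Hypothesis Uo : open U.
Hypothesis U0 : U 0.
Variable F : C2 R -> R.
Hypothesis Fs : smooth_on (realify F) U.

Lemma conjc0X k : k != 0%N -> conjc (0 : R[i]) ^+ k = 0.
Proof.
by move=> /negPf k0; have -> : conjc (0 : R[i]) = 0; [exact: rmorph0|rewrite expr0n k0].
Qed.

(** When every Taylor polynomial vanishes on [j], the function is its own Taylor remainder there, of
    arbitrarily high order. *)
Lemma flat_curve (j : Cx R -> C2 R) : (forall t, nrm2 (j t) = cabs t) ->
  (forall n t, taylor_poly F n (j t) = 0) -> forall n, bO (fun t => `|F (j t)|) n.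
Proof.
move=> jn T n; have [C [e [C0 e0 H]]] := taylor_expansion Uo U0 Fs n.
exists C, e; split; first exact: e0.
by move=> t te; have := H (j t); rewrite jn T subr0 cabs_real; apply.
Qed.

Lemma flat_axis1 : (forall a b, nz F a b -> (a.2 + b.2)%N != 0%N) ->
  forall n, bO (fun t => `|F (t, 0)|) n.
Proof.
move=> H; apply: (@flat_curve (fun t => (t, 0))) => [t|n t].
  by rewrite /nrm2 /= cabs0 max_l// cabs_ge0.
rewrite /taylor_poly; do 4!apply: big1 => ? _.
set x := taylor_coef _ _ _; have [->|x0] := eqVneq x 0; first by rewrite !mul0r.
have := H _ _ x0; rewrite addn_eq0 negb_and /= => /orP[h|h].
  by rewrite (expr0n _) (negPf h) mulr0 !mul0r.
by rewrite [X in _ * X](_ : _ = 0) ?mulr0//; exact: conjc0X h.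
Qed.

Lemma flat_axis2 : (forall a b, nz F a b -> (a.1 + b.1)%N != 0%N) ->
  forall n, bO (fun t => `|F (0, t)|) n.
Proof.
move=> H; apply: (@flat_curve (fun t => (0, t))) => [t|n t].
  by rewrite /nrm2 /= cabs0 max_r// cabs_ge0.
rewrite /taylor_poly; do 4!apply: big1 => ? _.
set x := taylor_coef _ _ _; have [->|x0] := eqVneq x 0; first by rewrite !mul0r.
have := H _ _ x0; rewrite addn_eq0 negb_and /= => /orP[h|h].
  by rewrite (expr0n _) (negPf h) mulr0 !mul0r.
by rewrite [X in _ * X * _](_ : _ = 0) ?mulr0 ?mul0r//; exact: conjc0X h.
Qed.

(** By [cD_wirt] every directional derivative at 0 is a combination of the four first-order Taylor
    coefficients. *)
Lemma first_order (v : R4 R) : 'D_v (realify F) 0 != 0 ->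
  exists a b, nz F a b /\ (a.1 + b.1 + (a.2 + b.2) = 1)%N.
Proof.
move=> vn; apply: contrapT => H; move/negP: vn; apply; apply/eqP.
have E := cD_wirt Uo (toC2 v) (csmooth_base Uo Fs) U0.
have Z i j k l : (i + k + (j + l) = 1)%N -> wder F i j k l 0 = 0.
  move=> ijkl; rewrite taylor_coefE.
  have [->|x0] := eqVneq (taylor_coef F (i, j) (k, l)) 0; first by rewrite mul0r.
  by exfalso; apply: H; exists (i, j), (k, l).
have Z1 := Z 1%N 0%N 0%N 0%N erefl; have Z2 := Z 0%N 1%N 0%N 0%N erefl.
have Z3 := Z 0%N 0%N 1%N 0%N erefl; have Z4 := Z 0%N 0%N 0%N 1%N erefl.
have {}E := etrans E (f_equal2 +%R (f_equal2 +%R (f_equal2 +%R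
  (congr1 (fun x => (toC2 v).1 * x) Z1) (congr1 (fun x => (toC2 v).2 * x) Z2))
  (congr1 (fun x => conjc (toC2 v).1 * x) Z3)) (congr1 (fun x => conjc (toC2 v).2 * x) Z4)).
rewrite !mulr0 !addr0 toC2K in E.
exact: (congr1 (fun x : R[i] => complex.Re x) E).
Qed.

End Flat.

Section Polyhedron.
Variable F : C2 R -> R.

Lemma sum_eq0_weight n (w q : 'I_n -> R) : (forall i, 0 <= w i) -> \sum_(i < n) w i = 1 ->
  (forall i, 0 <= q i) -> \sum_(i < n) w i * q i = 0 -> exists i, q i = 0.
Proof.
move=> w0 w1 q0 s0; apply: contrapT => H.
have wz i : w i = 0.
  have /eqP := psumr_eq0P (P := predT) (F := fun i => w i * q i) (fun i _ => mulr_ge0 (w0 i) (q0 i)) s0 (i := i) isT.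
  by rewrite mulf_eq0 => /orP[/eqP//|/eqP qi]; exfalso; apply: H; exists i.
have : (\sum_(i < n) w i : R) = 0 by apply: big1 => i _; exact: wz.
by rewrite w1 => /eqP; rewrite oner_eq0.
Qed.

Lemma NP_axis1 xi : newton_polyhedron F xi -> xi.2 = 0 ->
  exists a b, nz F a b /\ (a.2 + b.2 = 0)%N.
Proof.
move=> /NP_elim[n [w [q [a [b [w0 w1 H ->]]]]]] /= s0.
have [|i qi] := @sum_eq0_weight n w (fun i => (q i).2) w0 w1 _ s0.
  by move=> i; have [_ [_ h]] := H i; exact: le_trans h.
have [nzi [_ h]] := H i; exists (a i), (b i); split; first exact: nzi.
by move: h; rewrite qi lern0 => /eqP.
Qed.

Lemma NP_axis2 xi : newton_polyhedron F xi -> xi.1 = 0 ->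
  exists a b, nz F a b /\ (a.1 + b.1 = 0)%N.
Proof.
move=> /NP_elim[n [w [q [a [b [w0 w1 H ->]]]]]] /= s0.
have [|i qi] := @sum_eq0_weight n w (fun i => (q i).1) w0 w1 _ s0.
  by move=> i; have [_ [h _]] := H i; exact: le_trans h.
have [nzi [h _]] := H i; exists (a i), (b i); split; first exact: nzi.
by move: h; rewrite qi lern0 => /eqP.
Qed.

Lemma not_convenientP : ~ convenient F ->
  (forall a b, nz F a b -> (a.2 + b.2)%N != 0%N) \/ (forall a b, nz F a b -> (a.1 + b.1)%N != 0%N).
Proof.
move=> nc; apply: contrapT => /not_orP[/existsNP[a /existsNP[b /not_implyP[h1 /negP/negPn/eqP h2]]]].
move=> /existsNP[c /existsNP[d /not_implyP[h3 /negP/negPn/eqP h4]]]; apply: nc; split.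
  by have := NP_exp h1; rewrite h2; eexists; split; [eassumption|].
by have := NP_exp h3; rewrite h4; eexists; split; [eassumption|].
Qed.

(** With [xi.2 = 0] excluded, the exponent of total degree 1 can only be [(0, 1)]; its orthant
    already fills the half plane, and every other exponent lies in it. *)
Lemma NP_halfplane : (forall a b, nz F a b -> (a.2 + b.2)%N != 0%N) ->
  (exists a b, nz F a b /\ (a.1 + b.1 + (a.2 + b.2) = 1)%N) ->
  newton_polyhedron F = [set xi | 0 <= xi.1 /\ 1 <= xi.2].
Proof.
move=> H [a [b [nab e]]]; apply/seteqP; split=> [xi|xi [/= h1 h2]].
  move=> /NP_elim[n [w [q [a' [b' [w0 w1 Hq ->]]]]]] /=; split.
    by apply: sumr_ge0 => i _; rewrite mulr_ge0//; have [_ [h _]] := Hq i; exact: le_trans h.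
  rewrite -[leLHS]w1; apply: ler_sum => i _; rewrite ler_peMr//.
  have [nzi [_ h]] := Hq i; apply: le_trans h.
  by rewrite ler1n lt0n; exact: H nzi.
have := H _ _ nab; rewrite -lt0n => ab2.
have [ab1 ab2'] : (a.1 + b.1 = 0)%N /\ (a.2 + b.2 = 1)%N by split; lia.
by apply: (NP_orthant nab); rewrite ?ab1 ?ab2'.
Qed.

End Polyhedron.
End Axes.

(** * Convenient defining functions *)

Section ConvenientBound.
Variable R : realType.

Section Model.
Variable U : set (R4 R).
Hypothesis Uo : open U.
Hypothesis U0 : U 0.
Variable F : C2 R -> R.
Hypothesis Fs : smooth_on (realify F) U.

Lemma F_lipschitz : exists L d : R, [/\ 0 <= L, 0 < d & forall z w, nrm2 z < d -> nrm2 w < d ->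
  `|F z - F w| <= L * nrm2 (z - w)].
Proof.
have [L [d [L0 d0 H]]] := smooth_lipschitz Uo U0 Fs.
have ofB (a b : C2 R) : ofC2 a - ofC2 b = ofC2 (a - b) by case: a b => [[? ?] [? ?]] [[? ?] [? ?]].
exists L, d; split; [exact: L0|exact: d0|] => z w zd wd.
have := H (ofC2 w) (ofC2 z); rewrite !subr0 ofB /realify /= !ofC2K => {}H.
apply: le_trans (H (le_lt_trans (nrm_ofC2_le w) wd) (le_lt_trans (nrm_ofC2_le z) zd)) _.
by rewrite ler_wpM2l// nrm_ofC2_le.
Qed.

Lemma bO_small nf (e : R) : 0 < e -> bO nf 1 ->
  exists2 d : R, 0 < d & forall t : Cx R, cabs t < d -> nf t < e.
Proof.
move=> e0 /bO_nneg[K [d [K0 d0 _ H]]]; have K1 : 0 < K + 1 by rewrite ltr_wpDl.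
exists (Num.min d (e / (K + 1))); first by rewrite lt_min d0 divr_gt0.
move=> t; rewrite lt_min ltr_pdivlMr// => /andP[/H h1 h2]; apply: le_lt_trans h1 _.
by apply: le_lt_trans h2; rewrite expr1 mulrC ler_wpM2l ?cabs_ge0// lerDl.
Qed.

Lemma bO_D (nf1 nf2 : Cx R -> R) n : bO nf1 n -> bO nf2 n -> bO (fun t => nf1 t + nf2 t) n.
Proof.
move=> [K1 [d1 [d10 H1]]] [K2 [d2 [d20 H2]]]; exists (K1 + K2), (Num.min d1 d2).
split; first by rewrite lt_min d10.
by move=> t; rewrite lt_min => /andP[/H1 h1 /H2 h2]; rewrite mulrDl lerD.
Qed.

(** [F] is Lipschitz near 0, so a change of order [N] in the curve changes [F] by order [N]. *)
Lemma bO_perturb (j k : Cx R -> C2 R) N : bO (fun t => nrm2 (j t)) 1 -> bO (fun t => nrm2 (k t)) 1 ->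
  bO (fun t => nrm2 (k t - j t)) N -> bO (fun t => `|F (j t)|) N -> bO (fun t => `|F (k t)|) N.
Proof.
move=> j1 k1 jk Fj; have [L [d [L0 d0 H]]] := F_lipschitz.
have [d1 d10 H1] := bO_small d0 j1; have [d2 d20 H2] := bO_small d0 k1.
have Ljk : bO (fun t => L * nrm2 (k t - j t)) N.
  by apply: bO_le jk _; exists L, 1; split.
apply: bO_le (bO_D Fj Ljk) _; exists 1, (Num.min d1 d2); split; [exact: ler01|by rewrite lt_min d10|].
move=> t; rewrite lt_min => /andP[t1 t2]; rewrite mul1r.
have := H _ _ (H2 t t2) (H1 t t1).
by have := ler_normD (F (k t) - F (j t)) (F (j t)); rewrite subrK; lra.
Qed.

Lemma hlead_pow n : hlead (fun t : Cx R => t ^+ n) 1 n.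
Proof. by exists 0, 1; split=> // t _; rewrite mul1r subrr cabs0 mul0r. Qed.

Lemma bO_nrm2 (f1 f2 : Cx R -> Cx R) n : bO (fun t => cabs (f1 t)) n -> bO (fun t => cabs (f2 t)) n ->
  bO (fun t => nrm2 ((f1 t, f2 t) : C2 R)) n.
Proof.
move=> h1 h2; apply: bO_le (bO_D h1 h2) _; exists 1, 1; split=> // t _.
by rewrite mul1r nrm2_le /= lerDl lerDr !cabs_ge0.
Qed.

Lemma bO_zero (f : Cx R -> Cx R) n : (\forall t \near (0 : Cx R), f t = 0) -> bO (fun t => cabs (f t)) n.
Proof. by move=> /near0P[e e0 H]; exists 0, e; split => // t /H ->; rewrite cabs0 mul0r. Qed.

Lemma bO_ext (nf nf' : Cx R -> R) n : bO nf n -> (\forall t \near (0 : Cx R), nf' t <= nf t) -> bO nf' n.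
Proof.
move=> h /near0P[e e0 H]; apply: bO_le h _; exists 1, e; split => // t te.
by rewrite mul1r H.
Qed.

Hypothesis Fnd : N_nondegenerate F.
Variables (p1 p2 r1 r2 : nat * nat).
Hypothesis nzp : nz F p1 p2.
Hypothesis p0 : (p1.2 + p2.2 = 0)%N.
Hypothesis nzr : nz F r1 r2.
Hypothesis r0 : (r1.1 + r2.1 = 0)%N.

(* A component that vanishes identically is replaced by a power of [t] so high that the
   order of [F] along the curve is not affected. *)
Lemma model_order (eta1 eta2 : Cx R -> Cx R) (a N : nat) (C : R) :
  (\forall t \near (0 : Cx R), derivable eta1 t 1) -> (\forall t \near (0 : Cx R), derivable eta2 t 1) ->
  eta1 0 = 0 -> eta2 0 = 0 -> 0 < C ->
  (exists2 d : R, 0 < d & forall t, cabs t < d -> C * cabs t ^+ a <= nrm2 ((eta1 t, eta2 t) : C2 R)) ->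
  bO (fun t => `|F (eta1 t, eta2 t)|) N -> (N <= maxn (p1.1 + p2.1) (r1.2 + r2.2) * a)%N.
Proof.
move=> d1 d2 e1 e2 C0 low FN.
have core f1 f2 c1 c2 a1 a2 := core_order Uo U0 Fs Fnd nzp p0 nzr r0
  (eta1 := f1) (eta2 := f2) (c1 := c1) (c2 := c2) (a1 := a1) (a2 := a2) (N := N).
have le1 a1 : (a1 <= a)%N -> (N <= a1 * (p1.1 + p2.1))%N ->
    (N <= maxn (p1.1 + p2.1) (r1.2 + r2.2) * a)%N.
  by move=> h1 h2; apply: leq_trans h2 _; rewrite mulnC leq_mul// leq_maxl.
have le2 a2 : (a2 <= a)%N -> (N <= a2 * (r1.2 + r2.2))%N ->
    (N <= maxn (p1.1 + p2.1) (r1.2 + r2.2) * a)%N.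
  by move=> h1 h2; apply: leq_trans h2 _; rewrite mulnC leq_mul// leq_maxr.
have lowb n : bO (fun t => cabs (eta1 t)) n -> bO (fun t => cabs (eta2 t)) n -> (n <= a)%N.
  by move=> h1 h2; exact: (bO_lower C0 low (bO_nrm2 h1 h2)).
(* The replacing exponent is at least [N], so that the change of the curve is negligible, and at
   least 1, as [core_order] asks for positive exponents. *)
have A0 : (0 < maxn N 1)%N by lia.
have NA : (N <= maxn N 1)%N by lia.
have c10 : (1 : Cx R) != 0 by exact: oner_neq0.
have pw := hlead_upper (hlead_pow (maxn N 1)).
have pw1 := bO_weaken A0 pw; have pwN := bO_weaken NA pw.
have zN : bO (fun t : Cx R => cabs (0 : Cx R)) N by exists 0, 1; split=> // t _; rewrite cabs0 mul0r.
have [z1|[a1 [c1 [a10 c10' l1]]]] := holo_hlead d1 e1; have [z2|[a2 [c2 [a20 c20 l2]]]] := holo_hlead d2 e2.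
(* Two vanishing components would be [O(t ^+ a.+1)], against the lower bound on the curve. *)
- have : (a.+1 <= a)%N by exact: (lowb _ (bO_zero _ z1) (bO_zero _ z2)).
  by rewrite ltnn.
- have a2a : (a2 <= a)%N := lowb _ (bO_zero _ z1) (hlead_upper l2).
  have h1 := bO_weaken a20 (hlead_upper l2).
  have F' : bO (fun t => `|F (t ^+ maxn N 1, eta2 t)|) N.
    apply: (bO_perturb (j := fun t => (eta1 t, eta2 t)) (k := fun t => (t ^+ maxn N 1, eta2 t))
       (bO_nrm2 (bO_zero 1 z1) h1) (bO_nrm2 pw1 h1) _ FN).
    apply: (bO_ext pwN); move/near0P: z1 => [d d0 z1]; apply/near0P; exists d; first exact: d0.
    by move=> t /z1 ->; rewrite nrm2_le /= subr0 subrr cabs0 cabs_ge0 lexx.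
  exact: (le2 _ a2a (core _ _ _ _ _ _ A0 a20 c10 c20 (hlead_pow _) l2 F').2).
- have a1a : (a1 <= a)%N := lowb _ (hlead_upper l1) (bO_zero _ z2).
  have h1 := bO_weaken a10 (hlead_upper l1).
  have F' : bO (fun t => `|F (eta1 t, t ^+ maxn N 1)|) N.
    apply: (bO_perturb (j := fun t => (eta1 t, eta2 t)) (k := fun t => (eta1 t, t ^+ maxn N 1))
       (bO_nrm2 h1 (bO_zero 1 z2)) (bO_nrm2 h1 pw1) _ FN).
    apply: (bO_ext pwN); move/near0P: z2 => [d d0 z2]; apply/near0P; exists d; first exact: d0.
    by move=> t /z2 ->; rewrite nrm2_le /= subr0 subrr cabs0 cabs_ge0 lexx.
  exact: (le1 _ a1a (core _ _ _ _ _ _ a10 A0 c10' c10 l1 (hlead_pow _) F').1).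
have [h1 h2] := core _ _ _ _ _ _ a10 a20 c10' c20 l1 l2 FN.
have [a12|/ltnW a21] := leqP a1 a2.
  by apply: (le1 a1) => //; exact: (lowb _ (hlead_upper l1) (bO_weaken a12 (hlead_upper l2))).
by apply: (le2 a2) => //; exact: (lowb _ (bO_weaken a21 (hlead_upper l1)) (hlead_upper l2)).
Qed.

End Model.

Section Transfer.
Variables (M : set (C2 R)) (p : C2 R) (r : C2 R -> R).
Variables (Phi : C2 R -> C2 R) (U : set (C2 R)) (rho : C2 R -> R).
Hypothesis Mp : M p.
Hypothesis rdef : local_defining_function M p r.
Hypothesis hc : holo_coord p Phi U.
Hypothesis rhodef : local_defining_function (Phi @` (M `&` U)) 0 rho.
Hypothesis rhond : N_nondegenerate rho.
Variables (p1 p2 r1 r2 : nat * nat).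
Hypothesis nzp : nz rho p1 p2.
Hypothesis p0 : (p1.2 + p2.2 = 0)%N.
Hypothesis nzr : nz rho r1 r2.
Hypothesis r0 : (r1.1 + r2.1 = 0)%N.

(** The curve is carried by [Phi] to the model coordinates: [compare_fwd] transfers the order of [r]
    to [rho], and the Lipschitz bound for [Psi] transfers the lower bound on the curve. *)
Lemma curve_bound g a N : Gamma p g -> (0 < a)%N -> curve_order g p a ->
  bO (fun t => `|r (g t)|) N -> (N <= maxn (p1.1 + p2.1) (r1.2 + r2.2) * a)%N.
Proof.
move=> [g0 /near0P[dg dg0 gd] _] a0 go rN.
have [Psi [Psi0 V0 Psid PsiU PsiK]] := holo_coord_inv hc.
have [[Uo Up] Phip Phid _ _] := hc.
have /nbhs_C2P[dU dU0 HU] : nbhs p U by exact: open_nbhs_nbhs.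
have g1 : bO (fun t => nrm2 (g t - p)) 1 := (curve_order_bO 1 go).2 a0.
have [C1 [e1 [C10 e10 H1]]] := compare_fwd Mp rdef hc rhodef.
have [L2 [e2 [L20 e20 H2]]] := Phi_lip hc.
have [L3 [e3 [L30 e30 H3]]] := Psi_lip hc Psi0 V0 Psid.
pose eta t := Phi (g t).
have m0 : 0 < Num.min dU (Num.min e1 e2) by rewrite !lt_min dU0 e10.
have [d4 d40 H4] := bO_small m0 g1.
have eta1 : bO (fun t => nrm2 (eta t)) 1.
  apply: bO_le g1 _; exists L2, d4; split; [exact: L20|exact: d40|].
  by move=> t /H4; rewrite !lt_min => /andP[_ /andP[_ /H2]].
have [d5 d50 H5] := bO_small e30 eta1.
have [W [Wo W0 Ws _ _]] := rhodef.
have ed : forall t, cabs t < Num.min dg d4 -> derivable eta t 1.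
  move=> t; rewrite lt_min => /andP[tg /H4]; rewrite !lt_min => /andP[/HU Ut _].
  exact: (comp_curve (Phid _ Ut) (gd t tg)).
have md0 : 0 < Num.min dg d4 by rewrite lt_min dg0.
have ed1 : \forall t \near (0 : Cx R), derivable (fun s => (eta s).1 : Cx R) t 1.
  by apply/near0P; exists (Num.min dg d4); [exact: md0|move=> t /ed/derivable_comp1[]].
have ed2 : \forall t \near (0 : Cx R), derivable (fun s => (eta s).2 : Cx R) t 1.
  by apply/near0P; exists (Num.min dg d4); [exact: md0|move=> t /ed/derivable_comp1[]].
have eta0 : eta 0 = 0 by rewrite /eta g0.
have [c [K [d6 [c0 _ d60 H6]]]] := go.
have L31 : 0 < L3 + 1 by rewrite ltr_wpDl.
have pe t : ((eta t).1, (eta t).2) = eta t by case: (eta t).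
apply: (model_order (open_toC2 Wo) W0 Ws rhond nzp p0 nzr r0 ed1 ed2 _ _ (divr_gt0 c0 L31)).
- by rewrite eta0.
- by rewrite eta0.
- exists (Num.min (Num.min d4 d5) d6); first by rewrite !lt_min d40 d50.
  move=> t; rewrite !lt_min => /andP[/andP[/H4 t4 /H5 t5] /H6/andP[t6 _]].
  move: t4; rewrite !lt_min => /andP[/HU Ut _].
  rewrite pe mulrAC ler_pdivrMr//; apply: le_trans t6 _.
  have := H3 (eta t) t5; rewrite /eta PsiK// => /le_trans; apply.
  by rewrite mulrC ler_wpM2l ?nrm2_ge0// lerDl.
apply: bO_le rN _; exists C1, d4; split; [exact: C10|exact: d40|].
move=> t /H4; rewrite !lt_min => /andP[_ /andP[t1 _]]; rewrite pe.
exact: H1.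
Qed.

End Transfer.
End ConvenientBound.

(** * The equivalences *)

Section Equivalences.
Variable R : realType.
Variables (M : set (C2 R)) (p : C2 R) (r : C2 R -> R).
Hypothesis Mp : M p.
Hypothesis rdef : local_defining_function M p r.

Section Coordinate.
Variables (Phi : C2 R -> C2 R) (U : set (C2 R)) (rho : C2 R -> R).
Hypothesis hc : holo_coord p Phi U.
Hypothesis rhodef : local_defining_function (Phi @` (M `&` U)) 0 rho.

Lemma ldf_first_order (S : set (C2 R)) (F : C2 R -> R) : S 0 -> local_defining_function S 0 F ->
  exists a b, nz F a b /\ (a.1 + b.1 + (a.2 + b.2) = 1)%N.
Proof.
move=> S0 [W [Wo W0 Ws _ G]]; have [v Dv] := G 0 S0 W0.
exact: (first_order (open_toC2 Wo) W0 Ws Dv).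
Qed.

Lemma not_convenient_tangent : ~ convenient rho -> exists g, Gamma_reg p g /\ tangent_inf r g.
Proof.
move=> nc; have [Psi [Psi0 V0 Psid PsiU PsiK]] := holo_coord_inv hc.
have [W [Wo W0 Ws _ _]] := rhodef.
have AC := axis_curve Mp rdef hc rhodef Psi0 V0 Psid PsiU PsiK.
have i1 (t : Cx R) : derivable (fun s : Cx R => s) t (1 : Cx R) by exact: derivable_id.
have c1 (t : Cx R) : derivable (fun s : Cx R => 0 : Cx R) t (1 : Cx R) by exact: derivable_cst.
have [H|H] := not_convenientP nc.
  apply: (AC (fun t => (t, 0)) _ (fun t => derivable_pair (i1 t) (c1 t)) (flat_axis1 (open_toC2 Wo) W0 Ws H)).
  by move=> t; rewrite /nrm2 /= cabs0 max_l// cabs_ge0.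
apply: (AC (fun t => (0, t)) _ (fun t => derivable_pair (c1 t) (i1 t)) (flat_axis2 (open_toC2 Wo) W0 Ws H)).
by move=> t; rewrite /nrm2 /= cabs0 max_r// cabs_ge0.
Qed.

Lemma not_convenient_BG : ~ convenient rho -> BG_type_infinite r p.
Proof.
move=> nc; have [Psi [Psi0 V0 Psid PsiU PsiK]] := holo_coord_inv hc.
have [W [Wo W0 Ws _ _]] := rhodef.
have AH := axis_hypersurface Mp rdef hc rhodef Psi0 V0 Psid PsiU PsiK.
have [H|H] := not_convenientP nc.
  apply: (AH (fun t => (t, 0)) fst snd (0, 1) _ _ _ _ _ _ (flat_axis1 (open_toC2 Wo) W0 Ws H)).
  - by move=> [w1 w2] /= ->.
  - exact: nrm2_1.
  - exact: differentiable_snd.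
  - by move=> w s; rewrite /= -[s *: 1]/(s * 1) mulr1.
  - by [].
  - by rewrite /nrm2 /= cabs0 cabs1 max_r// ler01.
apply: (AH (fun t => (0, t)) snd fst (1, 0) _ _ _ _ _ _ (flat_axis2 (open_toC2 Wo) W0 Ws H)).
- by move=> [w1 w2] /= ->.
- exact: nrm2_2.
- exact: differentiable_fst.
- by move=> w s; rewrite /= -[s *: 1]/(s * 1) mulr1.
- by [].
- by rewrite /nrm2 /= cabs0 cabs1 max_l// ler01.
Qed.

Lemma not_convenient_halfplane : ~ convenient rho ->
  exists Phi U rho, [/\ holo_coord p Phi U, local_defining_function (Phi @` (M `&` U)) 0 rho &
                       newton_polyhedron rho = [set xi | 0 <= xi.1 /\ 1 <= xi.2]].
Proof.
move=> nc; have S00 := coord_image0 Mp hc.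
have [H|H] := not_convenientP nc.
  exists Phi, U, rho; split; [exact: hc|exact: rhodef|].
  exact: (NP_halfplane H (ldf_first_order S00 rhodef)).
(* Here the series vanishes on [z.1 = 0], so the exchanged coordinate is used. *)
have hc' := holo_coord_swap hc.
have rd := ldf_swap rhodef; rewrite -swap_image in rd.
have [W [Wo W0 Ws _ _]] := rhodef.
exists (@swap2 R \o Phi), U, (rho \o @swap2 R); split; [exact: hc'|exact: rd|].
apply: (NP_halfplane _ (ldf_first_order (coord_image0 Mp hc') rd)) => a b nab.
exact: (H _ _ (nz_swap (open_toC2 Wo) W0 Ws nab)).
Qed.

Lemma Delta1_not_convenient : N_nondegenerate rho -> Delta1 r p = +oo%E -> ~ convenient rho.
Proof.
move=> nd Dinf [[x [NPx x2]] [y [NPy y1]]].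
have [p1 [p2 [nzp p0]]] := NP_axis1 NPx x2.
have [r1 [r2 [nzr r0]]] := NP_axis2 NPy y1.
pose D := maxn (p1.1 + p2.1) (r1.2 + r2.2).
suff : (Delta1 r p <= (D%:R)%:E)%E by rewrite Dinf leye_eq.
apply: ge_ereal_sup => _ [g Gg <-].
have [a a0 go] := Gamma_order Gg.
(* The order is a positive natural number, so neither [fine] nor the inverse in [Delta1] takes a
   default value. *)
rewrite (curve_order_ord go) /=.
have a0' : (0 : R) < a%:R by rewrite ltr0n.
have B : (ord_comp r g <= ((D * a)%:R : R)%:E)%E.
  by apply: ord0_le => n rn; rewrite ler_nat; exact: (curve_bound Mp rdef hc rhodef nd nzp p0 nzr r0 Gg a0 go rn).
have := lee_wpmul2r _ B; move=> /(_ (a%:R^-1)%:E); rewrite lee_fin invr_ge0 (ltW a0') => /(_ isT) h.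
by apply: le_trans h _; rewrite -EFinM lee_fin natrM mulfK// lt0r_neq0.
Qed.

End Coordinate.

Lemma tangent_reg : (exists g, Gamma_reg p g /\ tangent_inf r g) -> Delta1_reg r p = +oo%E.
Proof.
move=> [g [Gg tg]]; apply/eqP; rewrite -leye_eq.
have <- : ord_comp r g = +oo%E by apply: ord0_infty => n; apply/bigO_powP; exact: tg.
by apply: ereal_sup_ubound; exists g.
Qed.

(** On a regular curve the denominator in [Delta1] is 1. *)
Lemma reg_Delta1 : Delta1_reg r p = +oo%E -> Delta1 r p = +oo%E.
Proof.
move=> Dinf; apply/eqP; rewrite -leye_eq -Dinf; apply: ge_ereal_sup => _ [g [Gg og] <-].
by apply: ereal_sup_ubound; exists g => //; rewrite og /= invr1 mule1.
Qed.

Lemma tangent_Delta1 : (exists g, Gamma p g /\ tangent_inf r g) -> Delta1 r p = +oo%E.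
Proof.
move=> [g [Gg tg]]; apply/eqP; rewrite -leye_eq.
have oc : ord_comp r g = +oo%E by apply: ord0_infty => n; apply/bigO_powP; exact: tg.
have [a a0 go] := Gamma_order Gg.
apply: ereal_sup_ubound; exists g; first exact: Gg.
by rewrite oc (curve_order_ord go) /= gt0_mulye// lte_fin invr_gt0 ltr0n.
Qed.

(** The curve given for [m] has a parametrization of order 1, along which the bound by
    [|z - p| ^+ m] becomes one by [|t| ^+ m]. The curve may change with [m], so it is the supremum
    that is infinite. *)
Lemma BG_reg : BG_type_infinite r p -> Delta1_reg r p = +oo%E.
Proof.
move=> BG; apply/eqyP => A A0.
have [m Am] : exists m : nat, A <= m%:R.
  by exists (Num.truncn A).+1; rewrite ltW// truncnS_gt.
apply: (@le_trans _ _ (m%:R)%:E); first by rewrite lee_fin.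
have [X [Xc Xp [K /nbhs_C2P[d d0 HK]]]] := BG m.
have [g [Gg go /near0P[d1 d10 Hg]]] := complex_curve_param Xc Xp.
apply: (@le_trans _ _ (ord_comp r g)); last first.
  by apply: ereal_sup_ubound; exists g => //; split; [exact: Gg|rewrite (curve_order_ord go)].
apply: ord0_ge.
have g1 : bO (fun t => nrm2 (g t - p)) 1 := (curve_order_bO 1 go).2 isT.
have [d2 d20 H2] := bO_small d0 g1.
have [K3 [d3 [K30 d30 _ H3]]] := bO_nneg g1.
exists (`|K| * K3 ^+ m), (Num.min d1 (Num.min d2 d3)); split; first by rewrite !lt_min d10 d20.
move=> t; rewrite !lt_min => /andP[t1 /andP[t2 t3]].
apply: le_trans (HK _ (H2 t t2) (Hg t t1)) _.
apply: (@le_trans _ _ (`|K| * nrm2 (g t - p) ^+ m)).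
  by rewrite ler_wpM2r ?exprn_ge0 ?nrm2_ge0// ler_norm.
rewrite -mulrA ler_wpM2l// -exprMn lerXn2r ?nnegrE ?nrm2_ge0 ?mulr_ge0 ?cabs_ge0//.
by have := H3 t t3; rewrite expr1.
Qed.

Lemma halfplane_not_convenient (F : C2 R -> R) :
  newton_polyhedron F = [set xi | 0 <= xi.1 /\ 1 <= xi.2] -> ~ convenient F.
Proof.
by move=> E [[x [+ x2]] _]; rewrite E /= x2 => -[_]; rewrite ler10.
Qed.

End Equivalences.

Unset Implicit Arguments.
Set Strict Implicit.
Set Printing Implicit Defensive.

Theorem theorem5p3 (R : realType) (M : set (C2 R)) (p : C2 R) (r : C2 R -> R) :
  real_hypersurface M -> M p -> local_defining_function M p r ->
  (exists Phi U, N_canonical M p Phi U) ->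
  [<-> Delta1 r p = +oo%E;
       Delta1_reg r p = +oo%E;
       exists g, Gamma_reg p g /\ tangent_inf r g;
       exists g, Gamma p g /\ tangent_inf r g;
       exists Phi U rho, [/\ holo_coord p Phi U,
                             local_defining_function (Phi @` (M `&` U)) 0 rho &
                             ~ convenient rho];
       exists Phi U rho, [/\ holo_coord p Phi U,
                             local_defining_function (Phi @` (M `&` U)) 0 rho &
                             newton_polyhedron rho = [set xi | 0 <= xi.1 /\ 1 <= xi.2]];
       BG_type_infinite r p].
Proof.
move=> _ Mp rdef [Phi0 [U0 [hc0 [rho0 [rd0 nd0]]]]].
(* Nondegeneracy is used here, and it makes the fixed canonical coordinate itself the witness for
   failure of convenience. *)
have NC := Delta1_not_convenient Mp rdef hc0 rd0 nd0.
have c15 : Delta1 r p = +oo%E -> exists Phi U rho, [/\ holo_coord p Phi U,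
    local_defining_function (Phi @` (M `&` U)) 0 rho & ~ convenient rho].
  by move=> /NC nc; exists Phi0, U0, rho0.
have c53 : (exists Phi U rho, [/\ holo_coord p Phi U,
    local_defining_function (Phi @` (M `&` U)) 0 rho & ~ convenient rho]) ->
    exists g, Gamma_reg p g /\ tangent_inf r g.
  by move=> [Phi [U [rho [hc rd nc]]]]; exact: (not_convenient_tangent Mp rdef hc rd nc).
tfae.
- by move=> /c15/c53; exact: tangent_reg.
- by move=> /reg_Delta1/c15/c53.
- by move=> [g [[Gg _] tg]]; exists g.
- by move=> /tangent_Delta1/c15.
(* The given coordinate leads to infinite [Delta1], and [NC] then brings the argument back to the
   canonical coordinate, where the half plane is exhibited. *)
- by move=> /c53/tangent_reg/reg_Delta1/NC; exact: (not_convenient_halfplane Mp hc0 rd0).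
- move=> [Phi [U [rho [hc rd /halfplane_not_convenient nc]]]].
  exact: (not_convenient_BG Mp rdef hc rd nc).
- by move=> /BG_reg/reg_Delta1.
Qed.
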